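(* For every positive integer $d$ there exist constants $c_d, C_d > 0$ depending only on $d$ such that for every positive integer $N$, \[ c_d N^{\frac{d}{2d+2}} \le \operatorname{disc}(\mathcal{A}_d) \le C_d N^{\frac{d}{2d+2}}, \] i.e. $\operatorname{disc}(\mathcal{A}_d)=\Theta_d(N^{\frac{d}{2d+2}})$.
   Context: For $N\in\mathbb{N}$ write $[N]=\{1,\dots,N\}$. An arithmetic progression in $d$ dimensions is a set $\{\mathbf{a}+i\mathbf{b}: i=0,1,\dots,l-1\}$ with $\mathbf{a},\mathbf{b}\in\mathbb{Z}^d$, $\mathbf{b}\neq\mathbf{0}$, $l\in\mathbb{N}$. $\mathcal{A}_d$ is the family of all arithmetic progressions in $d$ dimensions contained in $[N]^d$. For a coloring $\chi:[N]^d\to\{1,-1\}$ and $A\subseteq[N]^d$, $\chi(A)=\sum_{x\in A}\chi(x)$, and $\operatorname{disc}(\mathcal{A}_d)=\min_{\chi}\max_{A\in\mathcal{A}_d}|\chi(A)|$, the minimum over all colorings $\chi:[N]^d\to\{1,-1\}$. *)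

(* Defs.v *)
From mathcomp Require Import all_boot all_order all_algebra.
From mathcomp Require Import boolp.

Set Implicit Arguments.
Unset Strict Implicit.
Unset Printing Implicit Defensive.

Import GRing.Theory Num.Theory.
Local Open Scope ring_scope.

(* A point of [N]^d : coordinate k has value (x k).+1 ∈ {1,...,N}. *)
Definition point (d N : nat) := {ffun 'I_d -> 'I_N}.

Definition coord (d N : nat) (x : point d N) (k : 'I_d) : int := ((x k).+1)%:Z.

Definition ap_set (d N : nat) (a b : 'I_d -> int) (l : nat) : {set point d N} :=
  [set x : point d N | [exists i : 'I_l,
      [forall k : 'I_d, coord x k == a k + (nat_of_ord i)%:Z * b k]]].

Definition is_AP (d N : nat) (A : {set point d N}) : Prop :=
  exists (a b : 'I_d -> int) (l : nat),
    [/\ (exists k, b k != 0), (0 < l)%N,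
        (forall (i : nat) (k : 'I_d), (i < l)%N ->
            (1 <= a k + i%:Z * b k <= N%:Z)%R) &
        A = @ap_set d N a b l].

Definition sgn (b : bool) : int := if b then -1 else 1.

Definition chi_sum (d N : nat) (chi : {ffun point d N -> bool})
    (A : {set point d N}) : int :=
  \sum_(x in A) sgn (chi x).

Definition disc_AP (d N : nat) : nat :=
  \big[minn/ (#|point d N|).+1 ]_(chi : {ffun point d N -> bool})
    \max_(A : {set point d N} | `[< is_AP A >]) `|chi_sum chi A|%N.

(* Main.v *)
(** The lower bound is Roth's argument. Read the coordinates of a point as base-B digits, which
    embeds [N]^d in Z/M. By the pigeonhole principle every frequency r admits a nonzero step b
    with entries at most D ~ N^(1/(d+1)) such that the phases r i b, i < L ~ D^d, stay within
    one radian of 0; so the progression of step b and length L has a Fourier coefficient at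
    least L cos 1 at r. Summing over b and using Parseval, the mean of |chi(A)|^2 over these
    progressions is of order L ~ N^(d/(d+1)).

    The upper bound iterates partial colorings (Matousek-Spencer). On every line, cut the still
    uncolored set X into consecutive blocks of 16^j points; a progression meets X in a
    difference of two prefixes of a line, hence in boundedly many blocks of each size. There are
    O(|X| N^d / s^(d+1)) blocks of size s, so entropy gives a partial coloring with discrepancy
    O(N^(d/(2d+2))). To have a convergent sum over the iterations one must gain a power of the
    density rho = |X| / N^d. Call x and x + i b neighbours, for b bounded by Q and i < S. If there
    were many blocks of size s ~ rho^delta N^(d/(d+1)), X would contain many neighbours, and by
    Cauchy-Schwarz many walks of length k = 2^(d+1). But walks with multipliers i_1, ..., i_k
    join two given points in at most r(i)^d ways, where r(i) counts the solutions g of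
    i_1 g_1 + ... + i_k g_k = 0 with |g_j| <= 2Q, and r(i) is small on average: this bounds the
    number of walks, and thus of blocks, by a power of rho times the trivial bound. *)

From Pilot Require Import Defs.
From Stdlib Require Import Reals.
From mathcomp Require all_boot all_order all_algebra.
From mathcomp Require boolp reals sequences exp trigo Rstruct.
From mathcomp Require ring lra zify.
Open Scope R_scope.

(** With the trivial block count alone, every iteration would again cost [N^(d/(2d+2))], whatever
    the density, and the sum would carry a logarithm. The density enters as [|X| = v^(4E) N^d],
    where [E] is [density_exponent]. The critical block size becomes [v^4 N^(d/(d+1))], whose square
    root gains [v^2]; one factor [v] is given back to the tolerances of the short blocks, and the
    remaining error [v N^(d/(2d+2))] decays geometrically over the iterations. Sparsity is invisible
    in single steps: up to powers of the density a point has about [S Q^d = N^(2d/(d+1))]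
    neighbours, which for [d > 1] can be far fewer than [|X|]. For fixed multipliers, a walk of [k]
    steps has about [Q^(dk)] choices of directions, and this reaches [N^d] only from [k = d + 1] on.
    From there on the number of walks can be compared with the number of pairs of endpoints. The
    length [2^(d+1)] is a sufficient power of two, as repeated Cauchy-Schwarz requires. Writing
    [N = n^(d+1)] makes every scale a power of [n]: steps about [n], multipliers about [n^d]. *)

Module Discrepancy.

Import all_boot all_order all_algebra.
Import boolp reals sequences exp trigo.
Import ring lra zify.
Import Pilot.Defs.
Import Order.TTheory GRing.Theory Num.Theory.
Set Implicit Arguments. Unset Strict Implicit. Unset Printing Implicit Defensive.
Local Open Scope ring_scope.

(** * Solutions of linear equations in a box *)

Lemma big_tupleS (V : nmodType) (T : finType) K (F : seq T -> V) :
  \sum_(t : K.+1.-tuple T) F t = \sum_(a : T) \sum_(t : K.-tuple T) F (a :: t).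
Proof.
rewrite pair_big /=.
rewrite (reindex (fun p : T * K.-tuple T => [tuple of p.1 :: p.2])) //=.
exists (fun t : K.+1.-tuple T => (thead t, [tuple of behead t])).
  by move=> [a t] _ /=; congr pair; apply: val_inj.
by move=> t _ /=; rewrite -tuple_eta.
Qed.

Lemma big_tuple0 (V : nmodType) (T : finType) (F : seq T -> V) :
  \sum_(t : 0.-tuple T) F t = F [::].
Proof.
rewrite (bigD1 [tuple]) //= big1 ?addr0 // => t /eqP[].
exact: tuple0.
Qed.

(** The intervals [[x, x + e)] with [x] in [P] are disjoint and lie in an interval of [len + e - 1]
    integers. *)
Lemma count_congruent n (P : pred 'I_n) (e a len : nat) : (0 < e)%N ->
  (forall x, P x -> (a <= x < a + len)%N) ->
  (forall x y, P x -> P y -> (x <= y)%N -> (e %| y - x)%N) ->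
  (e * #|P| <= (len + e).-1)%N.
Proof.
move=> e0 Pa Pe.
case: (pickP P) => [x0 Px0|P0]; last by rewrite (eq_card0 P0) muln0.
have L0 : (0 < (len + e).-1)%N \/ (len + e).-1 = 0%N by case: (_.-1); [right|left].
case: L0 => [L0|L0]; last by have := Pa _ Px0; lia.
pose f (p : 'I_n * 'I_e) : 'I_(len + e).-1.-1.+1 := inord (p.1 + p.2 - a).
have -> : (e * #|P|)%N = #|[predX P & 'I_e]|.
  by rewrite cardX card_ord mulnC.
rewrite -[X in (_ <= X)%N](prednK L0) -[X in (_ <= X)%N]card_ord.
apply: (@leq_card_in _ _ f).
move=> [x t] [y t'] /andP[/= Px _] /andP[/= Py _] E.
have := congr1 val E; rewrite /f /=.
have ht := ltn_ord t; have ht' := ltn_ord t'.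
have hx := Pa _ Px; have hy := Pa _ Py.
rewrite !inordK; try lia.
move=> E2.
have exy : x = y.
  apply/val_inj => /=.
  case: (leqP x y) => hxy.
    have /dvdnP[q hq] := Pe _ _ Px Py hxy.
    have q0 : q = 0%N by nia.
    rewrite q0 in hq; lia.
  have /dvdnP[q hq] := Pe _ _ Py Px (ltnW hxy).
  have q0 : q = 0%N by nia.
  rewrite q0 in hq; lia.
congr pair => //; apply/val_inj => /=; rewrite exy in E2; lia.
Qed.

(** The weight [phi] is arbitrary so that summing out one variable of the linear form gives a
    [lin_sum] again, with a new weight. *)
Fixpoint lin_sum (S : nat) (gs : seq int) (phi : int -> nat) (c : int) : nat :=
  if gs is g :: gs' then (\sum_(x < S) lin_sum S gs' phi (c + (x : nat)%:Z * g))%N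
  else phi c.

Lemma lin_sum_exchange S gs phi (g c : int) :
  (\sum_(x < S) lin_sum S gs phi (c + (x : nat)%:Z * g)
   = lin_sum S gs (fun c => \sum_(x < S) phi (c + (x : nat)%:Z * g)%R)%N c)%N.
Proof.
elim: gs c => [//|h gs IH] c /=.
rewrite exchange_big /=; apply: eq_bigr => y _.
by rewrite -IH; apply: eq_bigr => x _; rewrite addrAC.
Qed.

Lemma lin_sum_le S gs (k l : nat) phi psi (c : int) :
  (forall c, k * phi c <= l * psi c)%N ->
  (k * lin_sum S gs phi c <= l * lin_sum S gs psi c)%N.
Proof.
move=> H; elim: gs c => [//|h gs IH] c /=.
by rewrite !big_distrr /=; apply: leq_sum => x _; apply: IH.
Qed.

(** The solutions form one class modulo [e = h / gcd(h, g)], or there are none; since [e <= h <= S],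
    the bound [S / e + 1] is at most [2 S / e]. *)
Lemma count_linear_congruence (S h : nat) (g c : int) : (0 < h <= S)%N ->
  (h * (\sum_(x < S) (h %| (c + (x : nat)%:Z * g)%R)%Z) <=
   (2 * S * gcdn h `|g|) * (gcdn h `|g| %| c)%Z)%N.
Proof.
move=> /andP[h0 hS].
set h' := gcdn h `|g|.
have h'0 : (0 < h')%N by rewrite gcdn_gt0 h0.
have h'g : (h' %| g)%Z by exact: (dvdn_gcdr h `|g|).
case: (boolP (h' %| c)%Z) => hc; last first.
  rewrite muln0 big1 ?muln0 // => x _.
  apply/eqP; rewrite eqb0; apply: contra hc => H.
  have : (h' %| c + (x : nat)%:Z * g)%Z.
    by apply: dvdz_trans H; exact: (dvdn_gcdl h `|g|).
  by move=> H'; rewrite -[c](addrK ((x : nat)%:Z * g)) rpredB // dvdz_mull.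
rewrite muln1.
rewrite -big_mkcond /= sum1_card.
have /dvdnP[e he] := dvdn_gcdl h `|g|; rewrite -/h' in he.
have e0 : (0 < e)%N by lia.
set P := [pred x : 'I_S | (h %| c + (x : nat)%:Z * g)%Z].
have Hm : (e * #|P| <= (S + e).-1)%N.
  apply: (@count_congruent S P e 0 S e0).
    by move=> x _; rewrite add0n ltn_ord.
  move=> x y /= Px Py xy.
  have : (h %| ((y - x)%N)%:Z * g)%Z.
    rewrite -subzn // mulrBl.
    have -> : (y : nat)%:Z * g - (x : nat)%:Z * g = (c + (y : nat)%:Z * g) - (c + (x : nat)%:Z * g).
      by rewrite opprD addrACA subrr add0r.
    exact: rpredB.
  rewrite dvdzE abszM !absz_nat => H.
  have /dvdnP[q hq] := dvdn_gcdr h `|g|; rewrite -/h' in hq.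
  rewrite he hq mulnA in H; rewrite dvdn_pmul2r // in H.
  rewrite -(Gauss_dvdl _ (_ : coprime e q)) //.
  rewrite /coprime; apply/eqP.
  have : (gcdn e q * h' = 1 * h')%N by rewrite muln_gcdl -he -hq mul1n.
  by move/eqP; rewrite eqn_pmul2r // => /eqP.
rewrite [X in (X * _)%N]he (mulnC e) -mulnA (mulnC (2 * S)%N) leq_mul2l.
apply/orP; right; apply: leq_trans Hm _; nia.
Qed.

Lemma sum_all_tuple (T : finType) (P : pred T) K :
  (\sum_(t : K.-tuple T) all P t = #|P| ^ K)%N.
Proof.
elim: K => [|K IH]; first by rewrite (big_tuple0 (fun t => (all P t : nat))).
rewrite (big_tupleS K (fun t => (all P t : nat))) /= expnS.
rewrite -{1}sum1_card [X in (X * _)%N]big_mkcond /=.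
rewrite big_distrl /=; apply: eq_bigr => a _.
rewrite -[a \in P]/(P a); case: (P a) => /=; last by rewrite big1.
by rewrite mul1n IH.
Qed.

Definition gcd_list (h : nat) (gs : seq int) : nat :=
  foldl (fun a g => gcdn a `|g|%N) h gs.

(** Summing out the variable of [g] replaces the modulus [h] by [gcd(h, g)] at the price of a factor
    [2 S gcd(h, g) / h]; these factors telescope. *)
Lemma lin_sum_congruence (S h : nat) (gs : seq int) (c : int) : (0 < h <= S)%N ->
  (h * lin_sum S gs (fun c => (h %| c)%Z) c <=
   (2 * S) ^ size gs * gcd_list h gs)%N.
Proof.
elim: gs h c => [|g gs IH] h c /andP[h0 hS] /=.
  by rewrite expn0 mul1n; case: (h %| c)%Z; rewrite ?muln1 ?muln0.
rewrite lin_sum_exchange.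
have h'0 : (0 < gcdn h `|g| <= S)%N.
  by rewrite gcdn_gt0 h0 /= (leq_trans _ hS) // dvdn_leq // dvdn_gcdl.
set h' := gcdn h `|g| in h'0 *.
have H : forall c : int, (h * (\sum_(x < S) (h %| (c + (x : nat)%:Z * g)%R)%Z) <= (2 * S * h') * (h' %| c)%Z)%N.
  by move=> c'; apply: count_linear_congruence; rewrite h0.
have H' := @lin_sum_le S gs h (2 * S * h') (fun c => \sum_(x < S) (h %| (c + (x : nat)%:Z * g)%R)%Z)%N (fun c => (h' %| c)%Z) c H.
apply: leq_trans H' _.
by rewrite expnS -!mulnA leq_mul2l leq_mul2l IH ?orbT.
Qed.

Lemma gcd_list_dvd h gs : (gcd_list h gs %| h)%N /\ all (fun g => (gcd_list h gs %| g)%Z) gs.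
Proof.
elim: gs h => [|g gs IH] h //=.
have [H1 H2] := IH (gcdn h `|g|); split.
  exact: dvdn_trans H1 (dvdn_gcdl _ _).
rewrite H2 andbT; exact: dvdn_trans H1 (dvdn_gcdr _ _).
Qed.

(** * Average of a gcd over tuples of bounded integers *)

Section GcdSum.
Variable R : realFieldType.

Lemma sum_inv_sq (r : nat) : \sum_(1 <= g < r.+1) (g%:R ^- 2 : R) <= 2.
Proof.
suff : \sum_(1 <= g < r.+2) (g%:R ^- 2 : R) <= 2 - r.+1%:R^-1.
  rewrite big_nat_recr //= => H.
  apply: le_trans (le_trans H _); first by rewrite lerDl invr_ge0 exprn_ge0.
  by rewrite gerDl oppr_le0 invr_ge0.
elim: r => [|r IH].
  rewrite big_nat1 expr1n invr1; lra.
rewrite big_nat_recr //=.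
have E : (r.+2%:R ^- 2 : R) <= r.+1%:R^-1 - r.+2%:R^-1.
  have p1 : (0 : R) < r.+1%:R by [].
  have -> : (r.+2%:R : R) = r.+1%:R + 1 by rewrite -natr1.
  set a := r.+1%:R in p1 *.
  have -> : a^-1 - (a + 1)^-1 = (a * (a + 1))^-1 by field; lra.
  rewrite lef_pV2 ?posrE; nra.
apply: le_trans (lerD IH E) _.
by rewrite addrA subrK.
Qed.

(* The entry p of the alphabet 'I_(4Q+1) stands for the integer p - 2Q. *)
Definition centered (Q : nat) (p : 'I_(4 * Q).+1) : int := (p : nat)%:Z - (2 * Q)%:Z.

(** The gcd is at most the sum of all divisors [g] of [r] that divide every entry. For each [g] at
    most [(3 r / g)^K] tuples qualify, because [2 r + g <= 3 r] in [count_congruent], and the sum of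
    [g^(1 - K)] is bounded since [K > 2]. *)
Lemma sum_gcd_list (K Q r : nat) : (2 < K)%N -> (0 < r <= 2 * Q)%N ->
  \sum_(t : K.-tuple 'I_(4 * Q).+1 | all (fun p => `|centered p| <= r)%N t)
     (gcd_list r (map (@centered Q) t))%:R <= 2 * (3 * r%:R : R) ^+ K.
Proof.
move=> K3 /andP[r0 rQ].
pose D g (t : K.-tuple 'I_(4 * Q).+1) :=
  all (fun p => (`|centered p| <= r)%N && (g %| centered p)%Z) t.
have step1 (t : K.-tuple 'I_(4 * Q).+1) : all (fun p => `|centered p| <= r)%N t ->
   (gcd_list r (map (@centered Q) t))%:R <=
   \sum_(1 <= g < r.+1 | (g %| r)%N) (g%:R * (D g t)%:R : R).
  move=> Ht; have [G1 G2] := gcd_list_dvd r (map (@centered Q) t).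
  set G := gcd_list _ _ in G1 G2 *.
  have G0 : (0 < G)%N by apply: dvdn_gt0 G1.
  have Gin : G \in index_iota 1 r.+1 by rewrite mem_index_iota G0 ltnS dvdn_leq.
  rewrite [leRHS]big_mkcond (bigD1_seq G Gin) ?iota_uniq //= G1.
  have -> : D G t.
    rewrite all_map in G2; apply/allP => p pt; rewrite (allP Ht) //=.
    exact: (allP G2).
  by rewrite mulr1 lerDl sumr_ge0 // => i _; case: ifP => // _; rewrite mulr_ge0.
apply: le_trans (ler_sum _ step1) _.
rewrite exchange_big /=.
have step2 g : (0 < g)%N -> (g %| r)%N ->
   \sum_(t : K.-tuple 'I_(4 * Q).+1 | all (fun p => `|centered p| <= r)%N t)
     (g%:R * (D g t)%:R : R) <= (3 * r%:R) ^+ K * g%:R ^- 2.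
  move=> g0 gr.
  rewrite -big_distrr /=.
  have gle : (g <= r)%N by apply: dvdn_leq.
  pose P (p : 'I_(4 * Q).+1) := (`|centered p| <= r)%N && (g %| centered p)%Z.
  have cP : (g * #|P| <= 3 * r)%N.
    apply: leq_trans (@count_congruent _ P g (2 * Q - r) (2 * r).+1 g0 _ _) _; last by lia.
      by move=> x /andP[]; rewrite /centered; lia.
    move=> x y /andP[_ Hx] /andP[_ Hy] xy.
    have : (g %| centered y - centered x)%Z by apply: rpredB.
    have -> : centered y - centered x = ((y - x)%N)%:Z by rewrite /centered -subzn //; lia.
    by rewrite dvdzE.
  have cD : \sum_(t : K.-tuple 'I_(4 * Q).+1 | all (fun p => `|centered p| <= r)%N t)
        (D g t)%:R <= (#|P|%:R : R) ^+ K.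
    apply: (@le_trans _ _ (\sum_(t : K.-tuple 'I_(4 * Q).+1) (all P t)%:R)).
      by rewrite [leRHS](bigID (fun t : K.-tuple _ => all (fun p => `|centered p| <= r)%N t)) /= lerDl sumr_ge0.
    by rewrite -natr_sum sum_all_tuple natrX.
  have gR : (0 : R) < g%:R by rewrite ltr0n.
  apply: le_trans (ler_wpM2l (ltW gR) cD) _.
  have cPR : g%:R * #|P|%:R <= 3 * r%:R :> R by rewrite -!natrM ler_nat.
  have K2 : (g%:R ^+ 3 <= g%:R ^+ K :> R) by rewrite ler_weXn2l // ler1n.
  have : (g%:R * #|P|%:R) ^+ K <= (3 * r%:R) ^+ K :> R.
    by rewrite lerXn2r // nnegrE mulr_ge0.
  rewrite exprMn => H.
  rewrite ler_pdivlMr ?exprn_gt0 //; apply: le_trans H.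
  by rewrite mulrAC -exprS ler_wpM2r // exprn_ge0.
apply: (@le_trans _ _ (\sum_(1 <= g < r.+1 | (g %| r)%N) (3 * r%:R) ^+ K * g%:R ^- 2)).
  rewrite [leLHS]big_nat_cond [leRHS]big_nat_cond; apply: ler_sum => g /andP[/andP[g1 _] gr].
  exact: step2.
rewrite -big_distrr /= mulrC ler_wpM2r ?exprn_ge0 ?mulr_ge0 //.
apply: le_trans (sum_inv_sq r).
rewrite [leRHS](bigID (fun g => (g %| r)%N)) /= lerDl sumr_ge0 // => g _.
by rewrite invr_ge0 exprn_ge0.
Qed.

End GcdSum.

(** * Zeros of the form [i_1 g_1 + ... + i_K g_K] in multipliers and steps *)

Section DotCount.
Variables S Q : nat.
Let T := ('I_S * 'I_(4 * Q).+1)%type.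

Definition dot (t : seq T) : int := \sum_(p <- t) (p.1 : nat)%:Z * centered p.2.

Lemma dot_cons p t : dot (p :: t) = (p.1 : nat)%:Z * centered p.2 + dot t.
Proof. by rewrite /dot big_cons. Qed.

Lemma dot_rot n t : dot (rot n t) = dot t.
Proof. by apply: perm_big; rewrite perm_rot. Qed.

Lemma sum_dot K (P : pred 'I_(4 * Q).+1) (phi : int -> nat) (c : int) :
  (\sum_(t : K.-tuple T | all (fun p => P p.2) t) phi (c + dot t)%R =
   \sum_(g : K.-tuple 'I_(4 * Q).+1 | all P g) lin_sum S (map (@centered Q) g) phi c)%N.
Proof.
rewrite big_mkcond [RHS]big_mkcond /=.
elim: K c => [|K IH] c.
  rewrite (big_tuple0 (fun t : seq T => if all (fun p => P p.2) t then phi (c + dot t) else 0%N)).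
  rewrite (big_tuple0 (fun g => if all P g then lin_sum S (map (@centered Q) g) phi c else 0%N)) /=.
  by rewrite /dot big_nil addr0.
rewrite (big_tupleS K (fun t : seq T => if all (fun p => P p.2) t then phi (c + dot t) else 0%N)).
rewrite (big_tupleS K (fun g => if all P g then lin_sum S (map (@centered Q) g) phi c else 0%N)) /=.
transitivity (\sum_i \sum_(v : 'I_(4 * Q).+1) \sum_(t : K.-tuple T)
    if P v && all (fun p => P p.2) t then phi (c + ((i : 'I_S) : nat)%:Z * centered v + dot t)%R else 0)%N.
  rewrite [RHS](pair_bigA _ (fun (i : 'I_S) (v : 'I_(4 * Q).+1) => \sum_(t : K.-tuple T)
    if P v && all (fun p => P p.2) t then phi (c + (i : nat)%:Z * centered v + dot t)%R else 0)%N) /=.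
  apply: eq_bigr => -[i v] _; apply: eq_bigr => t _.
  by rewrite dot_cons addrA.
rewrite exchange_big /=; apply: eq_bigr => v _.
case: (P v) => /=; last by rewrite !big1 // => i _; rewrite big1.
under eq_bigr => i _ do rewrite IH.
rewrite exchange_big /=; apply: eq_bigr => g _.
by case: (all P g) => //; rewrite big1.
Qed.

(* Rotating an entry of maximal modulus r to the front turns dot t = 0 into a
   congruence modulo r for the remaining entries, all of which are at most r;
   this is what avoids a logarithmic loss. *)
Definition head_maximal (t : seq T) :=
  if t is p :: t' then
    (centered p.2 != 0) && all (fun q => `|centered q.2| <= `|centered p.2|)%N t'
  else false.

Lemma exists_rot_head_maximal (t : seq T) : has (fun p => centered p.2 != 0) t ->
  exists2 j, (j < size t)%N & head_maximal (rot j t).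
Proof.
move=> /hasP[p0 p0t p0n].
have [p pt pmax] : exists2 p, p \in t & forall q, q \in t -> (`|centered q.2| <= `|centered p.2|)%N.
  clear p0n; elim: t p0 p0t => [//|a t IH] _ _.
  case: t IH => [|b t] IH.
    by exists a; rewrite ?mem_head // => q; rewrite inE => /eqP ->.
  have [p pt pm] := IH b (mem_head _ _).
  case: (leqP `|centered a.2| `|centered p.2|) => h.
    exists p; first by rewrite inE pt orbT.
    by move=> q; rewrite inE => /orP[/eqP->//|/pm].
  exists a; first by rewrite mem_head.
  move=> q; rewrite inE => /orP[/eqP->//|/pm] hq.
  exact: leq_trans hq (ltnW h).
have jt : (index p t < size t)%N by rewrite index_mem.
exists (index p t) => //.
have Er : rot (index p t) t = p :: drop (index p t).+1 t ++ take (index p t) t.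
  by rewrite /rot (drop_nth p jt) nth_index.
rewrite Er /=; apply/andP; split.
  have := pmax _ p0t; rewrite -absz_eq0 in p0n *; rewrite -absz_eq0 => h.
  by rewrite -lt0n; apply: leq_trans h; rewrite lt0n.
apply/allP => q qs; apply: pmax; rewrite -(mem_rot (index p t)) Er inE qs orbT //.
Qed.

Definition head_solution (t : seq T) : bool := (dot t == 0) && head_maximal t.

(** The term [S ^ K.+1] counts the tuples whose steps all vanish. Any other zero has a rotation
    satisfying [head_maximal], and rotations are bijections that preserve [dot]. *)
Lemma sum_dot_zero_le K :
  (\sum_(t : K.+1.-tuple T) (dot t == 0) <=
   S ^ K.+1 + K.+1 * \sum_(t : K.+1.-tuple T) head_solution t)%N.
Proof.
have card0 : #|[pred p : T | centered p.2 == 0]| = S.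
  have zQ : (2 * Q < (4 * Q).+1)%N by lia.
  transitivity #|[predX 'I_S & pred1 (Ordinal zQ)]|; last by rewrite cardX card1 card_ord muln1.
  apply: eq_card => -[i v]; rewrite !inE /= /centered.
  by apply/eqP/eqP => [H|->/=]; [apply/val_inj => /=; lia|lia].
rewrite -[X in (X ^ _)%N]card0 -sum_all_tuple.
have -> : (K.+1 * \sum_(t : K.+1.-tuple T) head_solution t =
    \sum_(t : K.+1.-tuple T) \sum_(j < K.+1) head_solution (rot j t))%N.
  rewrite exchange_big /= -[X in (X * _)%N](card_ord K.+1) -sum_nat_const.
  apply: eq_bigr => j _.
  rewrite [LHS](reindex (fun t : K.+1.-tuple T => [tuple of rot j t])) //=.
  exists (fun t : K.+1.-tuple T => [tuple of rotr j t]).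
    by move=> t _; apply/val_inj; rewrite /= rotK.
  by move=> t _; apply/val_inj; rewrite /= rotrK.
rewrite -big_split /=; apply: leq_sum => t _.
case: (boolP (dot t == 0)) => //= d0.
case: (boolP (all _ t)) => //=; rewrite -has_predC => /exists_rot_head_maximal[j].
rewrite size_tuple => jK hm.
by rewrite (bigD1 (Ordinal jK)) //= /head_solution dot_rot d0 hm.
Qed.

Variable R : realFieldType.

(** Given a head step of modulus [r] and all other entries, at most one head multiplier gives a
    zero, and only if [r] divides the [dot] of the rest. Since [r <= 2 Q <= S], [lin_sum_congruence]
    and [sum_gcd_list] bound the solutions with this head by [2 (6 S)^K r^(K-1)]; there are [4 Q]
    nonzero head steps. *)
Lemma sum_head_solution K : (2 < K)%N -> (2 * Q <= S)%N ->
  (\sum_(t : K.+1.-tuple T) head_solution t)%:R <= (4 * (12 * S%:R * Q%:R) ^+ K : R).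
Proof.
move=> K2 QS.
rewrite (big_tupleS K (fun t => head_solution t : nat)) /=.
have -> : (\sum_(p : T) \sum_(t : K.-tuple T) head_solution (p :: t) =
   \sum_(v : 'I_(4 * Q).+1) \sum_(i < S) \sum_(t : K.-tuple T) head_solution ((i, v) :: t))%N.
  rewrite [RHS]exchange_big /=.
  rewrite [RHS](pair_bigA _ (fun (i : 'I_S) (v : 'I_(4 * Q).+1) => \sum_(t : K.-tuple T) head_solution ((i, v) :: t)))%N /=.
  by apply: eq_bigr => -[].
have headv (v : 'I_(4 * Q).+1) :
  (\sum_(i < S) \sum_(t : K.-tuple T) head_solution ((i, v) :: t))%:R <=
  (centered v != 0)%:R * (2 * (6 * S%:R) ^+ K * (2 * Q%:R) ^+ K.-1) :> R.
  set r := `|centered v|%N.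
  case: (boolP (centered v == 0)) => [v0|v0].
    rewrite mul0r big1 // => i _; rewrite big1 // => t _.
    by rewrite /head_solution /= v0 andbF.
  have r0 : (0 < r)%N by rewrite lt0n absz_eq0.
  have rQ : (r <= 2 * Q)%N by rewrite /r /centered; have := ltn_ord v; lia.
  rewrite mul1r exchange_big /=.
  have : (\sum_(t : K.-tuple T) \sum_(i < S) head_solution ((i, v) :: t) <=
          \sum_(t : K.-tuple T | all (fun p => `|centered p.2| <= r) t) (r %| (0 + dot t)%R)%Z)%N.
    rewrite [X in (_ <= X)%N]big_mkcond; apply: leq_sum => t _.
    case: (boolP (all _ t)) => al; last first.
      by rewrite big1 // => i _; rewrite /head_solution /= (negbTE al) !andbF.
    rewrite add0r; case: (boolP (r %| dot t)%Z) => rd; last first.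
      rewrite leqn0 big1 // => i _; rewrite /head_solution dot_cons /=.
      case: eqP => //= /eqP H; case/negP: rd.
      rewrite addrC addr_eq0 in H; rewrite (eqP H).
      by rewrite rpredN dvdz_mull // dvdzE.
    rewrite (leq_trans (n := \sum_(i < S) (((i : nat)%:Z * centered v + dot t)%R == 0))%N) //.
      by apply: leq_sum => i _; rewrite /head_solution dot_cons; case: (head_maximal _); rewrite ?andbT ?andbF.
    case: (pickP (fun i : 'I_S => ((i : nat)%:Z * centered v + dot t)%R == 0)) => [i0 Hi0|H0]; last first.
      by rewrite big1 // => i _; rewrite H0.
    rewrite (bigD1 i0) //= Hi0 big1 ?addn0 // => i ii0.
    apply/eqP; rewrite eqb0; apply: contra ii0 => Hi.
    have : (i : nat)%:Z * centered v = (i0 : nat)%:Z * centered v.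
      by apply: (addIr (dot t)); rewrite (eqP Hi) (eqP Hi0).
    by move/(mulIf v0) => [] E; apply/eqP/val_inj.
  rewrite (sum_dot K (fun x => `|centered x| <= r)%N (fun c => (r %| c)%Z : nat) 0).
  rewrite -(ler_nat R) => /le_trans -> //.
  have rR : (0 : R) < r%:R by rewrite ltr0n.
  rewrite -(ler_pM2l rR) natr_sum mulr_sumr.
  apply: (@le_trans _ _ (\sum_(g : K.-tuple 'I_(4 * Q).+1 | all (fun x => `|centered x| <= r)%N g)
      (2 * S%:R) ^+ K * (gcd_list r (map (@centered Q) g))%:R)).
    apply: ler_sum => g _.
    rewrite -!natrM -natrX -natrM ler_nat.
    have := @lin_sum_congruence S r (map (@centered Q) g) 0.
    by rewrite size_map size_tuple; apply; rewrite r0 (leq_trans rQ).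
  rewrite -mulr_sumr.
  have := @sum_gcd_list R K Q r K2; rewrite r0 rQ => /(_ isT) H.
  apply: le_trans (ler_wpM2l _ H) _; first by rewrite exprn_ge0 // mulr_ge0.
  have -> : r%:R * (2 * (6 * S%:R) ^+ K * (2 * Q%:R) ^+ K.-1) = 2 * (6 * S%:R) ^+ K * (r%:R * (2 * Q%:R) ^+ K.-1) :> R by ring.
  have -> : (2 * S%:R) ^+ K * (2 * (3 * r%:R) ^+ K) = 2 * (6 * S%:R) ^+ K * (r%:R * r%:R ^+ K.-1) :> R.
    rewrite -exprS prednK; last by lia.
    have -> : 6 * S%:R = 3 * (2 * S%:R) :> R by ring.
    rewrite !(exprMn _ 3) !exprMn; ring.
  rewrite ler_wpM2l ?mulr_ge0 ?exprn_ge0 ?mulr_ge0 // ler_wpM2l ?(ltW rR) //.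
  by rewrite lerXn2r ?nnegrE ?mulr_ge0 // -natrM ler_nat.
rewrite natr_sum; apply: le_trans (ler_sum _ (fun v _ => headv v)) _.
rewrite -mulr_suml.
have : \sum_(v : 'I_(4 * Q).+1) (centered v != 0)%:R <= 4 * Q%:R :> R.
  have zQ : (2 * Q < (4 * Q).+1)%N by lia.
  rewrite (bigD1 (Ordinal zQ)) //= /centered /= subrr eqxx add0r.
  apply: (@le_trans _ _ (\sum_(i < (4 * Q).+1 | i != Ordinal zQ) 1)).
    by apply: ler_sum => i _; rewrite lern1 leq_b1.
  rewrite sumr_const -natrM ler_nat.
  by apply: eq_leq; have := cardC1 (Ordinal zQ); rewrite card_ord.
have P0 : 0 <= 2 * (6 * S%:R) ^+ K * (2 * Q%:R) ^+ K.-1 :> R.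
  by rewrite !mulr_ge0 ?exprn_ge0 ?mulr_ge0.
move=> H; apply: le_trans (ler_wpM2r P0 H) _.
have -> : 4 * Q%:R * (2 * (6 * S%:R) ^+ K * (2 * Q%:R) ^+ K.-1) =
   4 * (6 * S%:R) ^+ K * ((2 * Q%:R) * (2 * Q%:R) ^+ K.-1) :> R by ring.
rewrite -exprS prednK; last by lia.
rewrite -mulrA -exprMn.
by have -> : 6 * S%:R * (2 * Q%:R) = 12 * S%:R * Q%:R :> R by ring.
Qed.

Lemma count_dot_zero K : (2 < K)%N -> (2 * Q <= S)%N ->
  (\sum_(t : K.+1.-tuple T) (dot t == 0))%:R <=
  S%:R ^+ K.+1 + 4 * K.+1%:R * (12 * S%:R * Q%:R) ^+ K :> R.
Proof.
move=> K2 QS.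
have := sum_dot_zero_le K; rewrite -(ler_nat R) natrD natrX natrM => /le_trans -> //.
rewrite lerD2l -mulrA [leRHS]mulrCA ler_wpM2l //.
exact: sum_head_solution.
Qed.

End DotCount.

(** * Pairs and walks in sparse sets *)

Lemma leq_sum_injective (I J : finType) (h : I -> J) (F : J -> nat) :
  injective h -> (\sum_i F (h i) <= \sum_j F j)%N.
Proof.
move=> h_inj.
have -> : (\sum_i F (h i) = \sum_(j in h @: setT) F j)%N.
  by rewrite big_imset /=; [apply: eq_bigl => i; rewrite inE | move=> ? ? _ _; apply: h_inj].
by rewrite [X in (_ <= X)%N](bigID (mem (h @: setT))) leq_addr.
Qed.

(** * Representations of an integer with prescribed multipliers *)

Section Representations.
Variables Q : nat.

Fixpoint rep (s : seq nat) (v : int) : nat :=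
  if s is i :: s' then (\sum_(p < (2 * Q).+1) rep s' (v - i%:Z * ((p : nat)%:Z - Q%:Z))%R)%N
  else v == 0.

(** The range [[-2Q, 2Q]] is that of the differences of two steps counted by [rep]. *)
Fixpoint rep2 (s : seq nat) (v : int) : nat :=
  if s is i :: s' then (\sum_(p < (4 * Q).+1) rep2 s' (v - i%:Z * centered p)%R)%N
  else v == 0.

(** Subtracting one fixed representation of [v0] maps the representations of [v] injectively to
    wider ones of [v - v0]. For [v0 = v] this bounds every [rep s v] by the single number
    [rep2 s 0]. *)
Lemma rep_shift s v v0 : (0 < rep s v0)%N -> (rep s v <= rep2 s (v - v0)%R)%N.
Proof.
elim: s v v0 => [|i s IH] v v0 /=.
  by case: eqP => // ->; rewrite subr0.
move=> H; have [p0 Hp0] : exists p0 : 'I_(2 * Q).+1, (0 < rep s (v0 - i%:Z * ((p0 : nat)%:Z - Q%:Z)))%N.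
  apply/existsP; move: H; apply: contraTT; rewrite negb_exists => /forallP H.
  by rewrite -leqNgt leqn0 big1 // => p _; apply/eqP; rewrite -leqn0 leqNgt.
apply: (@leq_trans (\sum_(p < (2 * Q).+1)
  rep2 s (v - i%:Z * ((p : nat)%:Z - Q%:Z) - (v0 - i%:Z * ((p0 : nat)%:Z - Q%:Z)))%R)%N).
  by apply: leq_sum => p _; apply: IH.
have hlt (p : 'I_(2 * Q).+1) : (p + 2 * Q - p0 < (4 * Q).+1)%N.
  by have := ltn_ord p; have := ltn_ord p0; lia.
pose h (p : 'I_(2 * Q).+1) := Ordinal (hlt p).
apply: leq_trans (@leq_sum_injective _ _ h (fun q => rep2 s (v - v0 - i%:Z * centered q)%R) _).
  apply: leq_sum => p _; rewrite /centered /=.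
  have := ltn_ord p; have := ltn_ord p0 => h1 h2.
  have -> : ((p + 2 * Q - p0)%N)%:Z = (p : nat)%:Z + (2 * Q)%:Z - (p0 : nat)%:Z :> int by lia.
  by apply: eq_leq; congr rep2; ring.
move=> p q [] E; apply/val_inj => /=.
by have := ltn_ord p; have := ltn_ord q; have := ltn_ord p0; lia.
Qed.

Lemma rep_le s v : (rep s v <= rep2 s 0)%N.
Proof.
case: (posnP (rep s v)) => [->//|H].
by have := rep_shift v H; rewrite subrr.
Qed.

Lemma sum_rep2 (S K : nat) (v : int) :
  (\sum_(s : K.-tuple 'I_S) rep2 (map val s) v =
   \sum_(t : K.-tuple ('I_S * 'I_(4 * Q).+1)) (v == dot t))%N.
Proof.
elim: K v => [|K IH] v.
  rewrite (big_tuple0 (fun s : seq 'I_S => rep2 (map val s) v)).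
  rewrite (big_tuple0 (fun t : seq ('I_S * 'I_(4 * Q).+1) => (v == dot t : nat))).
  by rewrite /dot big_nil.
rewrite (big_tupleS K (fun s : seq 'I_S => rep2 (map val s) v)).
rewrite (big_tupleS K (fun t : seq ('I_S * 'I_(4 * Q).+1) => (v == dot t : nat))) /=.
transitivity (\sum_(i < S) \sum_(p < (4 * Q).+1) \sum_(t : K.-tuple ('I_S * 'I_(4 * Q).+1))
   (v == dot ((i, p) :: t)))%N.
  apply: eq_bigr => i _; rewrite exchange_big /=; apply: eq_bigr => p _.
  rewrite IH; apply: eq_bigr => t _; congr nat_of_bool.
  by rewrite dot_cons /= subr_eq addrC.
rewrite (pair_bigA _ (fun (i : 'I_S) (p : 'I_(4 * Q).+1) => \sum_(t : K.-tuple ('I_S * 'I_(4 * Q).+1))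
   (v == dot ((i, p) :: t)))%N) /=.
by apply: eq_bigr => -[].
Qed.

End Representations.

(** * Walks in a set of lattice points and Cauchy-Schwarz *)

Section Walks.
Variables (T : finType) (d : nat) (e : T -> 'I_d -> int).
Hypothesis e_inj : forall x y, (forall k, e x k = e y k) -> x = y.
Variables (X : {set T}) (S Q : nat).

Definition dirv (b : {ffun 'I_d -> 'I_(2 * Q).+1}) (k : 'I_d) : int := (b k : nat)%:Z - Q%:Z.

Definition step (i : nat) b (x y : T) : bool :=
  [forall k, e y k == e x k + i%:Z * dirv b k].

(** A multiplicity: one pair may be joined by several [(i, b)], and [i = 0] contributes loops.
    Multipliers are nonnegative, but the box of [b] is symmetric, hence [adj_sym]. *)
Definition adj (x y : T) : nat :=
  (\sum_(i < S) \sum_(b : {ffun 'I_d -> 'I_(2 * Q).+1}) step i b x y)%N.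

Lemma stepP i b x y : reflect (forall k, e y k = e x k + i%:Z * dirv b k) (step i b x y).
Proof. by apply: (iffP forallP) => H k; apply/eqP; have := H k; rewrite ?(rwP eqP). Qed.

Lemma step_functional i b x y y' : step i b x y -> step i b x y' -> y = y'.
Proof. by move=> /stepP H /stepP H'; apply: e_inj => k; rewrite H H'. Qed.

Lemma adj_sym x y : adj x y = adj y x.
Proof.
apply: eq_bigr => i _.
pose h (b : {ffun 'I_d -> 'I_(2 * Q).+1}) := [ffun k => rev_ord (b k)].
have hK : involutive h by move=> b; apply/ffunP => k; rewrite !ffunE rev_ordK.
rewrite (reindex_inj (inv_inj hK)) /=; apply: eq_bigr => b _; congr nat_of_bool.
have dh k : dirv (h b) k = - dirv b k.
  by rewrite /dirv ffunE /=; have := ltn_ord (b k); lia.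
by apply/stepP/stepP => H k; rewrite H dh; ring.
Qed.

Fixpoint walks (n : nat) (x : T) : nat :=
  if n is n'.+1 then (\sum_(y in X) adj x y * walks n' y)%N else 1%N.

Definition total_walks n := (\sum_(x in X) walks n x)%N.

(** Two walks from [x] join to one walk of length [i + j] after the first is reversed, which
    [adj_sym] permits. *)
Lemma sum_walks_mul i j : (\sum_(x in X) walks i x * walks j x = total_walks (i + j))%N.
Proof.
elim: i j => [|i IH] j; first by apply: eq_bigr => x _; rewrite mul1n.
rewrite addSnnS -IH /=.
under eq_bigr => x _ do rewrite big_distrl /=.
rewrite exchange_big /=; apply: eq_bigr => y _.
rewrite big_distrr /=; apply: eq_bigr => x _.
by rewrite adj_sym; lia.
Qed.

Lemma total_walks_double j : (total_walks j ^ 2 <= #|X| * total_walks (2 * j))%N.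
Proof.
rewrite mul2n -addnn -sum_walks_mul.
rewrite -(leq_pmul2l (isT : 0 < 2)%N) /total_walks -mulnn.
have -> : (2 * ((\sum_(x in X) walks j x) * \sum_(x in X) walks j x) =
  \sum_(x in X) \sum_(y in X) 2 * (walks j x * walks j y))%N.
  rewrite big_distrl big_distrr /=; apply: eq_bigr => x _.
  by rewrite big_distrr big_distrr.
have -> : (2 * (#|X| * \sum_(x in X) walks j x * walks j x) =
  \sum_(x in X) \sum_(y in X) (walks j x ^ 2 + walks j y ^ 2))%N.
  under [RHS]eq_bigr => x _ do rewrite big_split /= sum_nat_const.
  rewrite big_split /= sum_nat_const -big_distrr /= mul2n addnn.
  by congr (_ * _).*2; apply: eq_bigr => x _; rewrite mulnn.
by apply: leq_sum => x _; apply: leq_sum => y _; apply: nat_Cauchy.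
Qed.

Lemma total_walks_pow j :
  (total_walks 1 ^ (2 ^ j) <= #|X| ^ (2 ^ j).-1 * total_walks (2 ^ j))%N.
Proof.
elim: j => [|j IH]; first by rewrite expn1 mul1n.
have p0 : (0 < 2 ^ j)%N by rewrite expn_gt0.
have -> : (2 ^ j.+1 = 2 ^ j * 2)%N by rewrite expnS mulnC.
rewrite expnM.
apply: (@leq_trans ((#|X| ^ (2 ^ j).-1 * total_walks (2 ^ j)) ^ 2)); first by rewrite leq_exp2r.
rewrite expnMn -expnM.
have -> : (#|X| ^ (2 ^ j * 2).-1 = #|X| ^ ((2 ^ j).-1 * 2) * #|X|)%N.
  by rewrite -(expnSr #|X|); congr (_ ^ _)%N; lia.
by rewrite -mulnA leq_mul2l (mulnC (2 ^ j)%N 2) total_walks_double orbT.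
Qed.

Fixpoint walks_along (s : seq nat) (x : T) : nat :=
  if s is i :: s' then
    (\sum_(b : {ffun 'I_d -> 'I_(2 * Q).+1}) \sum_(y in X) step i b x y * walks_along s' y)%N
  else 1%N.

Lemma walks_sum n x : walks n x = (\sum_(s : n.-tuple 'I_S) walks_along (map val s) x)%N.
Proof.
elim: n x => [|n IH] x.
  by rewrite (big_tuple0 (fun s : seq 'I_S => walks_along (map val s) x)).
rewrite (big_tupleS n (fun s : seq 'I_S => walks_along (map val s) x)) /=.
under eq_bigr => y _ do rewrite /adj big_distrl /=.
rewrite exchange_big /=; apply: eq_bigr => i _.
under eq_bigr => y _ do rewrite big_distrl /=.
rewrite exchange_big [RHS]exchange_big /=; apply: eq_bigr => b _.
rewrite [RHS]exchange_big /=; apply: eq_bigr => y _.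
by rewrite IH big_distrr.
Qed.

End Walks.

(** * Bounds for walks with a given sequence of multipliers *)

Section WalkBounds.
Variables (T : finType) (d : nat) (e : T -> 'I_d -> int).
Hypothesis e_inj : forall x y, (forall k, e x k = e y k) -> x = y.
Variables (X : {set T}) (S Q : nat).
Local Notation walks_along := (walks_along e X Q).

Lemma walks_along_le s x : (walks_along s x <= (2 * Q).+1 ^ (d * size s))%N.
Proof.
elim: s x => [|i s IH] x /=; first by rewrite muln0.
rewrite mulnS expnD.
have -> : ((2 * Q).+1 ^ d = #|{: {ffun 'I_d -> 'I_(2 * Q).+1}}|)%N.
  by rewrite card_ffun !card_ord.
rewrite -sum_nat_const; apply: leq_sum => b _.
case: (pickP (fun y => step e i b x y)) => [y0 Hy0|H0]; last first.
  by rewrite big1 // => y _; rewrite H0.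
rewrite big_mkcond /= (bigD1 y0) //= big1 ?addn0.
  by rewrite Hy0 mul1n; case: (_ \in _).
move=> y yy0; case: (boolP (step e i b x y)) => [H|_]; last by rewrite mul0n if_same.
by case/eqP: yy0; apply: (step_functional e_inj H Hy0).
Qed.


(** A walk along [s] from [x] to [y] represents each coordinate of [y - x] by the multipliers [s],
    independently for each coordinate. The inequality comes from forgetting that the intermediate
    points lie in [X]. *)
Lemma walks_along_le_rep s x : x \in X ->
  (walks_along s x <= \sum_(y in X) \prod_(k < d) rep Q s (e y k - e x k)%R)%N.
Proof.
elim: s x => [|i s IH] x xX /=.
  rewrite (bigD1 x) //= (eq_bigr (fun=> 1%N)); first by rewrite big1_eq.
  by move=> k _; rewrite subrr.
have E y : (\prod_(k < d) \sum_(p < (2 * Q).+1) rep Q s (e y k - e x k - i%:Z * ((p : nat)%:Z - Q%:Z))%R =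
  \sum_(b : {ffun 'I_d -> 'I_(2 * Q).+1}) \prod_(k < d) rep Q s (e y k - e x k - i%:Z * dirv b k)%R)%N.
  by rewrite bigA_distr_bigA.
under [X in (_ <= X)%N]eq_bigr => y _ do rewrite E.
rewrite [X in (_ <= X)%N]exchange_big /=; apply: leq_sum => b _.
case: (pickP (fun y => step e i b x y && (y \in X))) => [y0 /andP[Hy0 y0X]|H0]; last first.
  rewrite big1 // => y yX; have := H0 y; rewrite yX andbT => ->; by [].
rewrite (bigD1 y0) //= big1 ?addn0; last first.
  move=> y /andP[yX yy0]; case: (boolP (step e i b x y)) => [H|_]; last by rewrite mul0n.
  by case/eqP: yy0; apply: (step_functional e_inj H Hy0).
rewrite Hy0 mul1n; apply: leq_trans (IH _ y0X) _.
apply: leq_sum => y _; apply: eq_leq; apply: eq_bigr => k _; congr rep.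
by rewrite (stepP _ _ _ _ _ Hy0); ring.
Qed.

Lemma sum_walks_along_le1 s :
  (\sum_(x in X) walks_along s x <= #|X| * (2 * Q).+1 ^ (d * size s))%N.
Proof. by rewrite -sum_nat_const; apply: leq_sum => x _; apply: walks_along_le. Qed.

Lemma sum_walks_along_le2 s :
  (\sum_(x in X) walks_along s x <= #|X| ^ 2 * rep2 Q s 0 ^ d)%N.
Proof.
rewrite -mulnn -mulnA -sum_nat_const; apply: leq_sum => x xX.
apply: leq_trans (walks_along_le_rep s xX) _.
rewrite -sum_nat_const; apply: leq_sum => y _.
rewrite -[X in (_ ^ X)%N](card_ord d) -prod_nat_const.
by apply: leq_prod => k _; apply: rep_le.
Qed.

Variable R : realFieldType.

(** The sequences [s] with [rep2 Q s 0 >= tau] are rare, by Markov's inequality and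
    [count_dot_zero], and receive the trivial bound. For the others fewer than [tau^d] walks join
    any of the [|X|^2] pairs. *)
Lemma total_walks_le K (tau : R) : 0 < tau -> (2 < K)%N -> (2 * Q <= S)%N ->
  (total_walks e X S Q K.+1)%:R <=
   #|X|%:R * (2 * Q).+1%:R ^+ (d * K.+1) / tau *
      (S%:R ^+ K.+1 + 4 * K.+1%:R * (12 * S%:R * Q%:R) ^+ K)
   + #|X|%:R ^+ 2 * S%:R ^+ K.+1 * tau ^+ d.
Proof.
move=> tau0 K2 QS.
have -> : total_walks e X S Q K.+1 =
  (\sum_(s : K.+1.-tuple 'I_S) \sum_(x in X) walks_along (map val s) x)%N.
  by rewrite exchange_big /=; apply: eq_bigr => x _; rewrite walks_sum.
rewrite natr_sum.
apply: (@le_trans _ _ (\sum_(s : K.+1.-tuple 'I_S)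
   (#|X|%:R * (2 * Q).+1%:R ^+ (d * K.+1) / tau * (rep2 Q (map val s) 0)%:R
     + #|X|%:R ^+ 2 * tau ^+ d))).
  apply: ler_sum => s _.
  set r := rep2 _ _ _.
  have [h|h] := leP tau r%:R.
    apply: (@le_trans _ _ (#|X|%:R * (2 * Q).+1%:R ^+ (d * K.+1))).
      have := sum_walks_along_le1 (map val s).
      by rewrite size_map size_tuple -(ler_nat R) natrM natrX.
    apply: (@le_trans _ _ (#|X|%:R * (2 * Q).+1%:R ^+ (d * K.+1) / tau * r%:R)).
      rewrite -mulrA ler_peMr ?mulr_ge0 ?exprn_ge0 //.
      by rewrite mulrC ler_pdivlMr // mul1r.
    by rewrite lerDl mulr_ge0 // exprn_ge0 // ltW.
  apply: (@le_trans _ _ (#|X|%:R ^+ 2 * tau ^+ d)).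
    have := sum_walks_along_le2 (map val s); rewrite -(ler_nat R) natrM !natrX => /le_trans -> //.
    rewrite ler_wpM2l ?exprn_ge0 // lerXn2r ?nnegrE ?(ltW tau0) //; exact: ltW.
  by rewrite lerDr !mulr_ge0 ?exprn_ge0 ?invr_ge0 ?(ltW tau0).
rewrite big_split /= -mulr_sumr sumr_const card_tuple card_ord.
apply: lerD; last first.
  by rewrite -[_ *+ (S ^ _)]mulr_natr natrX mulrAC.
rewrite ler_wpM2l //.
  by rewrite !mulr_ge0 ?exprn_ge0 ?invr_ge0 ?(ltW tau0).
rewrite -natr_sum (sum_rep2 Q S K.+1 0).
apply: le_trans (count_dot_zero R K2 QS).
by rewrite ler_nat; apply: leq_sum => t _; rewrite eq_sym.
Qed.

End WalkBounds.

(* With |X| = u^density_exponent N^d and N = n^(d+1), the trivial bound on the number of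
   pairs is C |X| Q^d S; the gain extracted from the sparsity of X is u^(d+3). *)
Section PairCount.
Variables (R : realFieldType) (d : nat).
Hypothesis d0 : (0 < d)%N.

(** A power of two for [total_walks_pow], with [K > 2] for [sum_gcd_list] and [K > d] to absorb the
    solutions whose steps all vanish. *)
Definition walk_length : nat := 2 ^ d.+1.
(** Of the [d + 1] factors [u^(k(d+3))] of the density, [d] cancel the negative power of [u] in
    [tau^d], and one remains as the gain for walks of length [k]. *)
Definition density_exponent : nat := walk_length * d.+1 * (d + 3).
Local Notation k := walk_length.
Local Notation K := (walk_length.-1).

Lemma walk_length_gt : (d < K)%N /\ (2 < K)%N.
Proof.
rewrite /walk_length; case: d d0 => // d' _.
by have := ltn_expl d'.+1 (isT : 1 < 2)%N; rewrite [in (2 ^ d'.+2)%N]expnS; lia.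
Qed.

Lemma total_walks1_bound : exists2 C : R, 0 < C &
  forall (T : finType) (e : T -> 'I_d -> int) (X : {set T}) (S Q : nat) (n u : R),
   (forall x y, (forall i, e x i = e y i) -> x = y) ->
   0 < u <= 1 -> 1 <= n ->
   n / u <= Q%:R <= 2 * (n / u) -> 8 * (n ^+ d / u) <= S%:R <= 16 * (n ^+ d / u) ->
   #|X|%:R <= u ^+ density_exponent * n ^+ (d * d.+1) ->
   (total_walks e X S Q 1)%:R <= C * #|X|%:R * n ^+ (2 * d) * u ^+ 2.
Proof.
have [dK K2] := walk_length_gt.
have kS : k = K.+1 by rewrite prednK // expn_gt0.
pose C0 : R := 16 + 4 * k%:R * 12 ^+ K.
have C00 : 0 <= C0 by rewrite addr_ge0 // !mulr_ge0 // exprn_ge0.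
pose C1 : R := 3 ^+ (d * k) * C0 + 1.
have C11 : 1 <= C1 by rewrite lerDr mulr_ge0 // exprn_ge0.
have C1p : 0 <= C1 by apply: le_trans C11.
exists (C1 * (16 * 2 ^+ d)).
  by rewrite !mulr_gt0 ?exprn_gt0 // (lt_le_trans ltr01).
move=> T e X S Q n u e_inj /andP[u0 u1] n1 /andP[Qn nQ] /andP[Sn nS] mle.
set m : R := #|X|%:R in mle *; set s : R := S%:R in Sn nS *; set q : R := Q%:R in Qn nQ *.
have n0 : 0 < n by apply: lt_le_trans n1.
have nd1 : 1 <= n ^+ d by rewrite exprn_ege1.
have nu1 : 1 <= n / u by rewrite ler_pdivlMr // mul1r (le_trans u1).
have ndn : n <= n ^+ d by rewrite -{1}[n]expr1 ler_weXn2l.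
have q1 : 1 <= q by apply: le_trans Qn.
have q0 : 0 < q by apply: lt_le_trans q1.
have ndu1 : n / u <= n ^+ d / u by rewrite ler_pM2r ?invr_gt0.
have s0 : 0 < s by lra.
have m0 : 0 <= m by [].
have QS : (2 * Q <= S)%N by rewrite -(ler_nat R) natrM -/q -/s; lra.
(* This uses [d < K]: the term [s^k] of the vanishing steps is then at most a constant times
   [(s q)^K]. *)
have sqK : s <= 16 * q ^+ K.
  apply: le_trans nS _; rewrite ler_pM2l //.
  apply: (@le_trans _ _ ((n / u) ^+ d)).
    rewrite exprMn ler_pM2l ?exprn_gt0 // exprVn lef_pV2 ?posrE ?exprn_gt0 //.
    by rewrite -[leRHS]expr1 ler_wiXn2l ?(ltW u0).
  apply: (@le_trans _ _ ((n / u) ^+ K)); first by rewrite ler_weXn2l // ltnW.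
  by rewrite lerXn2r ?nnegrE // ltW // (lt_le_trans ltr01).
(* Chosen so that the rare sequences contribute the trivial bound [m s^k q^(dk)] times [u^(k(d+3))],
   up to a constant. *)
pose tau := q ^+ K / s / u ^+ (k * (d + 3)).
have tau0 : 0 < tau by rewrite !divr_gt0 ?exprn_gt0.
have := total_walks_le e_inj X tau0 K2 QS; rewrite -kS -/m -/s -/q.
set B1 := _ * (s ^+ k + _); set B2 := _ * tau ^+ d => ak.
have sk : s ^+ k = s ^+ K * s by rewrite kS exprSr.
have qk : q ^+ k = q ^+ K * q by rewrite kS exprSr.
have b1 : B1 <= m * s ^+ k * q ^+ (d * k) * u ^+ (k * (d + 3)) * (3 ^+ (d * k) * C0).
  have Jle : s ^+ k + 4 * k%:R * (12 * s * q) ^+ K <= C0 * (s ^+ K * q ^+ K).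
    rewrite /C0 [leRHS]mulrDl; apply: lerD.
      by rewrite sk mulrCA ler_pM2l ?exprn_gt0.
    by rewrite !exprMn !mulrA.
  have q3 : (2 * Q).+1%:R ^+ (d * k) <= 3 ^+ (d * k) * q ^+ (d * k).
    rewrite -exprMn lerXn2r ?nnegrE ?mulr_ge0 // ?(ltW q0) // -natr1 natrM -/q; lra.
  apply: (@le_trans _ _ (m * (3 ^+ (d * k) * q ^+ (d * k)) / tau * (C0 * (s ^+ K * q ^+ K)))).
    rewrite /B1 ler_pM //; first by rewrite !mulr_ge0 ?exprn_ge0 ?invr_ge0 // ltW.
      by rewrite addr_ge0 ?mulr_ge0 ?exprn_ge0 ?mulr_ge0 // ltW.
    by rewrite ler_wpM2r ?invr_ge0 ?(ltW tau0) // ler_wpM2l.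
  rewrite le_eqVlt; apply/orP; left; apply/eqP; rewrite sk /tau.
  have uk0 : u ^+ (k * (d + 3)) != 0 by rewrite expf_neq0 // gt_eqF.
  have qK0 : q ^+ K != 0 by rewrite expf_neq0 // gt_eqF.
  have sn0 : s != 0 by rewrite gt_eqF.
  move: (3 ^+ (d * k)) (q ^+ (d * k)) (u ^+ _) uk0 (q ^+ K) qK0 (s ^+ K) => x1 x2 x3 h3 x4 h4 x5.
  by field; rewrite h3 h4 sn0.
have b2 : B2 <= m * s ^+ k * q ^+ (d * k) * u ^+ (k * (d + 3)).
  have mt : m * tau ^+ d <= q ^+ (d * k) * u ^+ (k * (d + 3)).
    apply: le_trans (ler_wpM2r (exprn_ge0 d (ltW tau0)) mle) _.
    have -> : density_exponent = (k * (d + 3) + k * (d + 3) * d)%N by rewrite /density_exponent mulnAC mulnS.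
    rewrite exprD [u ^+ (_ * d)]exprM /tau expr_div_n.
    have ud0 : (u ^+ (k * (d + 3))) ^+ d != 0 by rewrite !expf_neq0 // gt_eqF.
    have -> : (u ^+ (k * (d + 3)) * (u ^+ (k * (d + 3))) ^+ d * n ^+ (d * d.+1) *
       ((q ^+ K / s) ^+ d / (u ^+ (k * (d + 3))) ^+ d)) =
       (n ^+ (d * d.+1) * (q ^+ K / s) ^+ d) * u ^+ (k * (d + 3)).
      move: (u ^+ (k * (d + 3))) ud0 => y; move: (y ^+ d) => x hx.
      field; exact: hx.
    rewrite ler_wpM2r ?exprn_ge0 ?(ltW u0) //.
    rewrite mulnC exprM -exprMn mulnC exprM lerXn2r ?nnegrE ?exprn_ge0 ?(ltW q0) //.
      by rewrite mulr_ge0 ?exprn_ge0 ?divr_ge0 ?exprn_ge0 // ltW.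
    rewrite qk mulrCA ler_pM2l ?exprn_gt0 // ler_pdivrMr // exprS.
    apply: ler_pM; rewrite ?exprn_ge0 ?(ltW n0) //.
      by apply: le_trans Qn; rewrite ler_pdivlMr // ler_piMr // ltW.
    apply: le_trans Sn; rewrite mulrA ler_pdivlMr //.
    have h : n ^+ d * u <= n ^+ d by rewrite ler_piMr // exprn_ge0 // ltW.
    lra.
  have -> : B2 = m * s ^+ k * (m * tau ^+ d) by rewrite /B2 expr2 -!mulrA [m * (s ^+ k * _)]mulrCA.
  by rewrite -[leRHS]mulrA ler_wpM2l // mulr_ge0 ?exprn_ge0 // ltW.
have ak' : (total_walks e X S Q k)%:R <= m * s ^+ k * q ^+ (d * k) * u ^+ (k * (d + 3)) * C1.
  by apply: le_trans ak _; rewrite /C1 mulrDr mulr1 lerD.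
(* A [k]-th root turns the gain [u^(k(d+3))] into [u^(d+3)]; since [C1 >= 1], the constant needs no
   root. *)
have a1 : (total_walks e X S Q 1)%:R <= C1 * (m * s * q ^+ d * u ^+ (d + 3)).
  have k0 : (0 < k)%N by rewrite kS.
  have P0 : 0 <= m * s * q ^+ d * u ^+ (d + 3) by rewrite !mulr_ge0 ?exprn_ge0 // ltW.
  rewrite -(ler_pXn2r k0) ?nnegrE ?(mulr_ge0 C1p P0) //.
  have := total_walks_pow e X S Q d.+1; rewrite -/walk_length -(ler_nat R) natrX natrM natrX -/m.
  move=> /le_trans -> //.
  apply: le_trans (ler_wpM2l (exprn_ge0 _ m0) ak') _.
  apply: (@le_trans _ _ (C1 * (m * s * q ^+ d * u ^+ (d + 3)) ^+ k)).
    rewrite le_eqVlt; apply/orP; left; apply/eqP.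
    rewrite !exprMn -!exprM [((d + 3) * k)%N]mulnC.
    have -> : m ^+ k = m ^+ K * m by rewrite kS exprSr.
    by ring.
  by rewrite [leRHS]exprMn ler_wpM2r ?(exprn_ge0 k P0) // -{1}[C1]expr1 ler_weXn2l.
apply: le_trans a1 _.
rewrite -!mulrA ler_wpM2l // [leRHS]mulrCA [leRHS]mulrCA [X in _ <= _ * X]mulrCA.
rewrite [leRHS](_ : _ = m * (16 * (n ^+ d / u) * ((2 * (n / u)) ^+ d * u ^+ (d + 3)))).
  rewrite ler_wpM2l // ler_pM ?mulr_ge0 ?exprn_ge0 ?(ltW s0) ?(ltW q0) ?(ltW u0) //.
  by rewrite ler_wpM2r ?exprn_ge0 ?(ltW u0) // lerXn2r ?nnegrE ?(ltW q0) // (le_trans (ltW q0)).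
have ud0 : u ^+ d != 0 by rewrite expf_neq0 // gt_eqF.
rewrite !exprMn exprVn exprD mul2n -addnn exprD.
have un0 : u != 0 by rewrite gt_eqF.
move: (u ^+ d) ud0 (n ^+ d) (2 ^+ d) => x hx y z; field; by rewrite un0 hx.
Qed.

End PairCount.

(** * Partial colorings *)

Section Kraft.
Variables (R : realType) (Om I K : finType) (c : I -> Om -> K) (l : I -> K -> R).

(* Jensen bounds the average of exp(-length) from below by exp(-L); grouping the
   outcomes by their code words and using Kraft's inequality bounds it by the
   size of the largest group. *)
Lemma kraft_bucket (om0 : Om) (L : R) :
  (forall i, \sum_k expR (- l i k) <= 1) ->
  \sum_om \sum_i l i (c i om) <= #|Om|%:R * L ->
  exists om1, #|Om|%:R * expR (- L) <= #|[pred om | [forall i, c i om == c i om1]]|%:R.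
Proof.
move=> kraft meanL.
pose V om1 := #|[pred om | [forall i, c i om == c i om1]]|.
case: (@arg_maxnP _ om0 xpredT V isT) => om1 _ Vmax; exists om1.
pose w i k := expR (- l i k).
apply: (@le_trans _ _ (\sum_om \prod_i w i (c i om))).
  apply: (@le_trans _ _ (\sum_om expR (- L) * (1 + (L - \sum_i l i (c i om))))).
    rewrite -mulr_sumr mulrC ler_wpM2l ?expR_ge0 // big_split /= sumrB !sumr_const.
    by rewrite lerDl subr_ge0 -[L *+ _]mulr_natl.
  apply: ler_sum => om _.
  have -> : \prod_i w i (c i om) = expR (- L) * expR (L - \sum_i l i (c i om)).
    by rewrite -expRD addrA addNr add0r -sumrN expR_sum.
  by rewrite ler_wpM2l ?expR_ge0 ?expR_ge1Dx.
pose pat om : {ffun I -> K} := [ffun i => c i om].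
rewrite (partition_big pat xpredT) //=.
apply: (@le_trans _ _ (\sum_(f : {ffun I -> K}) (V om1)%:R * \prod_i w i (f i))).
  apply: ler_sum => f _.
  have -> : \sum_(om | pat om == f) \prod_i w i (c i om) =
            \sum_(om | pat om == f) \prod_i w i (f i).
    apply: eq_bigr => om /eqP <-; apply: eq_bigr => i _; by rewrite ffunE.
  rewrite sumr_const -[leLHS]mulr_natl.
  have p0 : 0 <= \prod_i w i (f i) by apply: prodr_ge0 => i _; apply: expR_ge0.
  rewrite ler_wpM2r // ler_nat.
  case: (pickP (fun om => pat om == f)) => [om2 /eqP h|h0]; last by rewrite (eq_card0 h0).
  apply: leq_trans (Vmax om2 isT); apply: subset_leq_card; apply/subsetP => om.
  rewrite -[_ \in _]/(pat om == f) => /eqP h2; rewrite inE; apply/forallP => i; apply/eqP.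
  by have := congr1 (fun g : {ffun I -> K} => g i) h2; rewrite -h !ffunE.
rewrite -mulr_sumr -(bigA_distr_bigA w) ler_piMr //.
by apply: prodr_ile1 => i; rewrite kraft sumr_ge0 // => k _; apply: expR_ge0.
Qed.

End Kraft.

(** * A large set of colorings has a member far from a given one *)

Section HammingBall.
Variables (R : realType) (T : finType).

Lemma sum_hamming_weight (g : {ffun T -> bool}) (x : R) :
  \sum_(f : {ffun T -> bool}) x ^+ #|[pred z | f z != g z]| = (1 + x) ^+ #|T|.
Proof.
rewrite -prodr_const.
have -> : \prod_(z in T) (1 + x) = \prod_(z : T) \sum_(b : bool) (if b != g z then x else 1).
  by apply: eq_bigr => z _; rewrite big_bool; case: (g z) => /=; rewrite // addrC.
rewrite bigA_distr_bigA; apply: eq_bigr => f _.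
by rewrite -prodr_const [LHS]big_mkcond.
Qed.

(** Weight the colorings by [8^(-distance)]: if all distances were below [m / 16], the set would
    have at most [(9/8)^m 8^(m/16)] members. Taking 16th powers avoids the fractional exponent and
    leaves [(9/8)^16 8 <= 128 < 256 <= (2 e^(-1/4))^16]. *)
Lemma exists_far_coloring (B : {set {ffun T -> bool}}) (g : {ffun T -> bool}) :
  (0 < #|T|)%N -> #|{ffun T -> bool}|%:R * expR (- (#|T|%:R / 4)) <= #|B|%:R :> R ->
  exists2 f, f \in B & (#|T| <= 16 * #|[pred z | f z != g z]|)%N.
Proof.
set m := #|T| => m0 HB.
case: (pickP (fun f => (f \in B) && (m <= 16 * #|[pred z | f z != g z]|)%N)) => [f /andP[]|H].
  by exists f.
exfalso; pose D := (m.-1 %/ 16)%N.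
have hD f : f \in B -> (#|[pred z | f z != g z]| <= D)%N.
  move=> fB; have := H f; rewrite fB /= => /negbT; rewrite -ltnNge /D => h.
  by rewrite leq_divRL // mulnC; lia.
have D16 : (16 * D <= m)%N by rewrite mulnC (leq_trans (leq_trunc_div _ _)) ?leq_pred.
have B1 : #|B|%:R * (8^-1 : R) ^+ D <= (9 / 8) ^+ m.
  have -> : 9 / 8 = 1 + 8^-1 :> R by field.
  rewrite -(sum_hamming_weight g) mulr_natl -sumr_const big_mkcond /=.
  apply: ler_sum => f _; case: ifP => [/hD h|_]; last by rewrite exprn_ge0 // invr_ge0.
  by rewrite ler_wiXn2l ?invr_ge0 // invf_le1 // ler1n.
have B2 : #|B|%:R ^+ 16 <= ((9 / 8) ^+ 16 * 8 : R) ^+ m.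
  have : #|B|%:R <= (9 / 8) ^+ m * 8 ^+ D :> R.
    by rewrite -ler_pdivrMr ?exprn_gt0 // -exprVn.
  move=> h; apply: (@le_trans _ _ (((9 / 8) ^+ m * 8 ^+ D) ^+ 16)).
    by rewrite lerXn2r ?nnegrE // mulr_ge0 // exprn_ge0 // divr_ge0.
  rewrite [leLHS]exprMn [leRHS]exprMn -!exprM [(m * 16)%N]mulnC.
  rewrite ler_wpM2l ?exprn_ge0 ?divr_ge0 //.
  by rewrite mulnC ler_weXn2l // ler1n.
have B3 : ((256 : R)) ^+ m <= #|B|%:R ^+ 16.
  apply: (@le_trans _ _ ((#|{ffun T -> bool}|%:R * expR (- (m%:R / 4))) ^+ 16)); last first.
    by rewrite lerXn2r ?nnegrE // mulr_ge0 // expR_ge0.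
  have -> : expR (- (m%:R / 4)) = (expR (- 4^-1)) ^+ m :> R.
    by rewrite -expRM_natl; congr expR; rewrite -mulr_natl; field.
  rewrite card_ffun card_bool natrX -exprMn -exprM mulnC exprM lerXn2r ?nnegrE //.
    by rewrite exprn_ge0 // mulr_ge0 // expR_ge0.
  have e1 : 2^-1 <= expR (- 4^-1) ^+ 2 :> R.
    rewrite -expRM_natl; apply: le_trans (expR_ge1Dx _).
    rewrite -mulr_natl; lra.
  have -> : (2 * expR (- 4^-1)) ^+ 16 = (4 * expR (- 4^-1) ^+ 2) ^+ 8 :> R.
    by move: (expR _) => x; ring.
  apply: (@le_trans _ _ (2 ^+ 8)); first by rewrite -natrX ler_nat.
  rewrite lerXn2r ?nnegrE ?mulr_ge0 ?exprn_ge0 ?expR_ge0 //; lra.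
have : (256 : R) ^+ m <= ((9 / 8) ^+ 16 * 8) ^+ m by apply: le_trans B3 B2.
rewrite ler_pXn2r ?nnegrE ?mulr_ge0 ?exprn_ge0 ?mulr_ge0 ?invr_ge0 //.
have -> : (9 / 8) ^+ 16 * 8 = (((9 / 8) ^+ 2) ^+ 2) ^+ 4 * 8 :> R by rewrite -!exprM.
have h1 : (9 / 8) ^+ 2 <= 4 / 3 :> R by rewrite expr2; lra.
have h2 : ((9 / 8) ^+ 2) ^+ 2 <= 2 :> R.
  apply: (@le_trans _ _ ((4 / 3) ^+ 2)); last by rewrite expr2; lra.
  by rewrite lerXn2r ?nnegrE ?exprn_ge0 ?divr_ge0.
have h3 : (((9 / 8) ^+ 2) ^+ 2) ^+ 4 <= 2 ^+ 4 :> R.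
  by rewrite lerXn2r ?nnegrE ?exprn_ge0 ?divr_ge0.
move: h3; move: (_ ^+ 4) => y; rewrite -natrX => h3 h4.
have : (256 : R) <= (2 ^ 4)%:R * 8 by lra.
by rewrite -natrM ler_nat.
Qed.

End HammingBall.

(** * Moments of the sum of a random coloring *)

Section Moments.
Variables (R : realType) (T : finType).

Definition csum (f : {ffun T -> bool}) (A : {set T}) : int := \sum_(x in A) sgn (f x).

(** A crude form of [cosh t <= exp(t^2 / 2)]: for [|t| <= 1/2] it follows from
    [exp x <= 1 / (1 - x)], for larger [|t|] from [|t| <= 2 t^2]. *)
Lemma cosh_le (t : R) : expR t + expR (- t) <= 2 * expR (2 * t ^+ 2).
Proof.
have [ht|ht] := lerP (`|t|) (1 / 2).
  have t2 : t ^+ 2 <= 1 / 4.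
    rewrite -real_normK ?num_real // (_ : 1 / 4 = (1 / 2) ^+ 2); last by field.
    by rewrite lerXn2r ?nnegrE ?divr_ge0.
  have /ler_normlP[h1 h2] := ht.
  have inv (x : R) : `|x| <= 1 / 2 -> expR x <= (1 - x)^-1.
    move=> /ler_normlP[hx1 hx2].
    rewrite -[x]opprK expRN lef_pV2 ?posrE ?expR_gt0 ?opprK //; last by lra.
    exact: expR_ge1Dx.
  have e1 := inv _ ht; have e2 : expR (- t) <= (1 + t)^-1.
    by have := inv (- t); rewrite normrN opprK; apply.
  have E : (1 - t)^-1 + (1 + t)^-1 = 2 / (1 - t ^+ 2) by field; lra.
  have e3 : (1 - t ^+ 2)^-1 <= expR (2 * t ^+ 2).
    apply: le_trans (expR_ge1Dx _).
    rewrite -[leLHS]mul1r ler_pdivrMr; first by have := sqr_ge0 t; nra.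
    lra.
  lra.
have h : `|t| <= 2 * t ^+ 2.
  by rewrite -[t ^+ 2]real_normK ?num_real //; nra.
have e (x : R) : `|x| = `|t| -> expR x <= expR (2 * t ^+ 2).
  by move=> hx; rewrite ler_expR (le_trans (ler_norm x)) // hx.
have := e t erefl; have := e (- t) (normrN t); lra.
Qed.

Lemma sum_expR_csum (t : R) (A : {set T}) :
  \sum_f expR (t * (csum f A)%:~R) <= 2 ^+ #|T| * expR (2 * t ^+ 2 * #|A|%:R).
Proof.
have -> : \sum_f expR (t * (csum f A)%:~R) =
   \sum_(f : {ffun T -> bool}) \prod_x (if x \in A then expR (t * (sgn (f x))%:~R) else 1).
  apply: eq_bigr => f _; rewrite /csum rmorph_sum mulr_sumr expR_sum big_mkcond /=.
  by apply: eq_bigr.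
rewrite -(bigA_distr_bigA (fun x b => if x \in A then expR (t * (sgn b)%:~R) else 1 : R)).
apply: (@le_trans _ _ (\prod_(x : T) (2 * (if x \in A then expR (2 * t ^+ 2) else 1)))).
  apply: ler_prod => x _; rewrite big_bool; case: (x \in A) => /=.
    rewrite addr_ge0 ?expR_ge0 //= mulr1 mulrN1 addrC; exact: cosh_le.
  by rewrite addr_ge0 //= mulr1 (_ : 1 + 1 = 2).
rewrite big_split /= prodr_const -big_mkcond /= prodr_const.
by rewrite -expRM_natr.
Qed.

(** By [y^(2q) / (2q)! <= exp |y| <= exp y + exp (-y)] the moment is bounded by exponential moments;
    [t] normalizes the sum to unit variance. *)
Lemma moment_le (t : R) (q : nat) (A : {set T}) : t ^+ 2 * #|A|%:R = 1 -> (0 < q)%N ->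
  \sum_f (t * (csum f A)%:~R) ^+ (2 * q) <= (2 * q)`!%:R * (2 * expR 2) * 2 ^+ #|T|.
Proof.
move=> tA q0.
have pw (y : R) : y ^+ (2 * q) <= (2 * q)`!%:R * (expR y + expR (- y)).
  have -> : y ^+ (2 * q) = `|y| ^+ (2 * q) by rewrite !exprM real_normK ?num_real.
  apply: (@le_trans _ _ ((2 * q)`!%:R * expR `|y|)).
    have f0 : 0 < (2 * q)`!%:R :> R by rewrite ltr0n fact_gt0.
    rewrite mulrC -ler_pdivrMr //.
    have := @expR_ge1Dxn R `|y| (2 * q).-1 (normr_ge0 _).
    rewrite prednK; last by rewrite muln_gt0.
    by apply: le_trans; rewrite lerDr.
  rewrite ler_wpM2l //; case: (ger0P y) => _; by rewrite ?lerDl ?lerDr expR_ge0.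
apply: le_trans (ler_sum _ (fun f _ => pw _)) _.
rewrite -mulr_sumr big_split /= -mulrA ler_wpM2l //.
have h1 := sum_expR_csum t A; have h2 := sum_expR_csum (- t) A.
rewrite sqrrN in h2; rewrite -[2 * _ * _]mulrA tA mulr1 in h1 h2.
under [X in _ + X <= _]eq_bigr => f _ do rewrite -mulNr.
apply: le_trans (lerD h1 h2) _.
rewrite le_eqVlt; apply/orP; left; apply/eqP; ring.
Qed.

End Moments.

(** * The entropy method with explicit code words *)

Section PartialColoring.
Variables (R : realType).

(** [|y| / 2] rounded to the nearest integer, so that the class of 0 is the symmetric interval
    [(-1, 1)] and needs no sign. *)
Definition digit (y : R) : nat := Num.truncn ((`|y| + 1) / 2).

Lemma digit_itv (y : R) : 2 * (digit y)%:R - 1 <= `|y| < 2 * (digit y)%:R + 1.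
Proof.
have h : 0 <= (`|y| + 1) / 2 by rewrite divr_ge0 // addr_ge0.
have /andP[h1 h2] := truncn_itv h.
move: h1 h2; rewrite -/(digit y) -[(digit y).+1%:R]natr1 => h1 h2.
by apply/andP; split; lra.
Qed.

Lemma digit_le_pow (y : R) q : (0 < q)%N -> (digit y)%:R <= y ^+ (2 * q).
Proof.
move=> q0; have -> : y ^+ (2 * q) = `|y| ^+ (2 * q) by rewrite !exprM real_normK ?num_real.
have [/andP[h1 _]] := (digit_itv y).
case: (posnP (digit y)) => [->|]; first by rewrite exprn_ge0.
rewrite -(ler_nat R) => d1.
have y1 : 1 <= `|y| by lra.
apply: (@le_trans _ _ `|y|); first lra.
by rewrite -{1}[`|y|]expr1 ler_weXn2l // muln_gt0.
Qed.

Lemma digit_close (y z : R) : digit y = digit z ->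
  ((y < 0) && (0 < digit y)%N) = ((z < 0) && (0 < digit z)%N) -> `|y - z| <= 2.
Proof.
have /andP[h1 h2] := digit_itv y; have /andP[h3 h4] := digit_itv z.
move=> E; rewrite E in h1 h2 *.
case: (posnP (digit z)) h1 h2 h3 h4 => [->|d0] h1 h2 h3 h4.
  move=> _; apply: le_trans (ler_normB _ _) _; lra.
rewrite !andbT => s; apply/ler_normlP.
case: (ltrP y 0) s h1 h2 => hy; case: (ltrP z 0) h3 h4 => hz // h3 h4 _ h1 h2.
  by rewrite !ltr0_norm // in h1 h2 h3 h4; split; lra.
by rewrite !ger0_norm // in h1 h2 h3 h4; split; lra.
Qed.

(** For [r = exp(-lam)] the full geometric series gives [exp(-zeta) (1 + r) / (1 - r)], and [(1 + r)
    / (1 - r) = 1 + 2 / (exp lam - 1) <= exp zeta]. *)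
Lemma kraft_sum (lam zeta : R) M : 0 < lam -> 2 / (expR lam - 1) <= zeta ->
  \sum_(k : bool * 'I_M) expR (- (zeta + lam * ((k.2 : nat)%:R + k.1%:R))) <= 1.
Proof.
move=> lam0 hz.
rewrite -(pair_bigA _ (fun (b : bool) (j : 'I_M) => expR (- (zeta + lam * ((j : nat)%:R + b%:R))))) big_bool.
pose r := expR (- lam).
have E (b : bool) : \sum_(j < M) expR (- (zeta + lam * ((j : nat)%:R + b%:R))) =
    expR (- zeta) * r ^+ b * \sum_(j < M) r ^+ j.
  rewrite mulr_sumr; apply: eq_bigr => j _.
  rewrite -[r ^+ b]expRM_natl -[r ^+ j]expRM_natl -expRD -expRD.
  congr (expR _).
  by rewrite mulrDr !opprD !mulrN ![_ * lam]mulrC addrA addrAC.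
rewrite (E true) (E false) expr1 expr0 mulr1 /= -mulrDl.
have e1 : 1 < expR lam by rewrite -expR0 ltr_expR.
have r0 : 0 < r by apply: expR_gt0.
have r1 : r < 1 by rewrite -expR0 ltr_expR; lra.
have rE : r = (expR lam)^-1 by rewrite /r expRN.
have geo : \sum_(j < M) r ^+ j <= (1 - r)^-1.
  rewrite -[leRHS]mul1r ler_pdivlMr ?subr_gt0 //.
  have := subrX1 r M; have : 0 <= r ^+ M by rewrite exprn_ge0 // ltW.
  rewrite mulrC; move: (\sum_(_ < _) _) (r ^+ M) => a b; lra.
have ez : 1 + 2 / (expR lam - 1) <= expR zeta.
  by apply: le_trans (expR_ge1Dx _); rewrite lerD2l.
have zp : 0 < expR (- zeta) by apply: expR_gt0.
have P0 : 0 <= expR (- zeta) * r + expR (- zeta) by rewrite addr_ge0 ?mulr_ge0 // ltW.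
apply: le_trans (ler_wpM2l P0 geo) _.
have -> : (expR (- zeta) * r + expR (- zeta)) / (1 - r) = expR (- zeta) * (1 + 2 / (expR lam - 1)).
  by rewrite rE; field; lra.
by rewrite expRN mulrC ler_pdivrMr ?expR_gt0 // mul1r.
Qed.

(** The first term bounds the offset [2 / (exp lam - 1)], by one term of the exponential series; the
    second bounds the mean of [lam * digit], by the moment of order [2q]. Both come with the factor
    [lam^-(2q-1)]. *)
Definition cost_const (q : nat) : R := 2 * ((2 * q).-1)`!%:R + (2 * q)`!%:R * (2 * expR 2).

Lemma cost_const_ge0 q : 0 <= cost_const q.
Proof. by rewrite addr_ge0 ?mulr_ge0 ?expR_ge0. Qed.

(* The discrepancy of S, rounded to a multiple of 2 lam_S sqrt|S|, is given a code word
   of expected length O(lam_S^-(2q-1)); two colorings with the same code words that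
   differ in many points are subtracted. *)
Lemma partial_coloring (T I : finType) (S : I -> {set T}) (lam t : I -> R) (q : I -> nat) :
  (0 < #|T|)%N -> (forall i, 0 < lam i) -> (forall i, 0 < t i) ->
  (forall i, t i ^+ 2 * #|S i|%:R = 1) -> (forall i, 0 < q i)%N ->
  \sum_i cost_const (q i) / lam i ^+ (2 * q i).-1 <= #|T|%:R / 4 ->
  exists f g : {ffun T -> bool}, (#|T| <= 16 * #|[pred z | f z != g z]|)%N /\
    forall i, t i * `|(csum f (S i) - csum g (S i))%:~R| <= 2 * lam i.
Proof.
move=> T0 lam0 t0 tS q0 hcost.
pose y i f := t i * (csum f (S i))%:~R / lam i.
pose M := \max_(p : I * {ffun T -> bool}) digit (y p.1 p.2).
have hM i f : (digit (y i f) < M.+1)%N.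
  by rewrite ltnS (@leq_bigmax _ (fun p => digit (y p.1 p.2)) (i, f)).
pose sg i f := (y i f < 0) && (0 < digit (y i f))%N.
(* A negative nonzero digit k is stored as (true, k - 1), so that zero has one code word. *)
pose code i f : bool * 'I_M.+1 := (sg i f, inord (digit (y i f) - sg i f)).
pose zeta i := 2 / (expR (lam i) - 1).
pose l i (k : bool * 'I_M.+1) := zeta i + lam i * ((k.2 : nat)%:R + k.1%:R).
have lcode i f : l i (code i f) = zeta i + lam i * (digit (y i f))%:R.
  rewrite /l /code /= inordK; last by rewrite (leq_ltn_trans (leq_subr _ _)).
  rewrite -natrD subnK // /sg; case: (digit _) => [|n]; first by rewrite andbF.
  by rewrite andbT; apply: leq_trans (leq_b1 _) _.
have meanl i : \sum_f l i (code i f) <= #|{ffun T -> bool}|%:R * (cost_const (q i) / lam i ^+ (2 * q i).-1).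
  have l0 := lam0 i; have qi := q0 i.
  have q2 : (2 * q i = (2 * q i).-1.+1)%N by lia.
  have lp : 0 < lam i ^+ (2 * q i).-1 by rewrite exprn_gt0.
  have lpq : 0 < lam i ^+ (2 * q i) by rewrite exprn_gt0.
  have zl : zeta i <= 2 * ((2 * q i).-1)`!%:R / lam i ^+ (2 * q i).-1.
    rewrite /zeta -mulrA ler_pM2l //.
    have f0 : 0 < ((2 * q i).-1)`!%:R :> R by rewrite ltr0n fact_gt0.
    have -> : ((2 * q i).-1)`!%:R / lam i ^+ (2 * q i).-1 = (lam i ^+ (2 * q i).-1 / ((2 * q i).-1)`!%:R)^-1.
      by rewrite invfM invrK mulrC.
    rewrite lef_pV2 ?posrE ?divr_gt0 //; last by rewrite subr_gt0 -expR0 ltr_expR.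
    rewrite lerBrDl.
    have := @expR_ge1Dxn R (lam i) (2 * q i).-2 (ltW l0).
    by have -> : ((2 * q i).-2.+1 = (2 * q i).-1)%N by lia.
  have dl : \sum_f (digit (y i f))%:R <= (2 * q i)`!%:R * (2 * expR 2) * 2 ^+ #|T| / lam i ^+ (2 * q i).
    apply: (@le_trans _ _ (\sum_f (y i f) ^+ (2 * q i))).
      by apply: ler_sum => f _; apply: digit_le_pow.
    rewrite /y; under eq_bigr => f _ do rewrite expr_div_n.
    rewrite -mulr_suml ler_pM2r ?invr_gt0 //; exact: moment_le.
  under eq_bigr => f _ do rewrite lcode.
  rewrite big_split /= sumr_const -mulr_sumr -[zeta i *+ _]mulr_natl.
  apply: le_trans (lerD (ler_wpM2l (ler0n _ _) zl) (ler_wpM2l (ltW l0) dl)) _.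
  rewrite card_ffun card_bool natrX /cost_const le_eqVlt; apply/orP; left; apply/eqP.
  have -> : lam i ^+ (2 * q i) = lam i * lam i ^+ (2 * q i).-1 by rewrite [in LHS]q2 exprS.
  move: (2%:R ^+ #|T|) (lam i ^+ (2 * q i).-1) lp => a b b0.
  by field; rewrite !gt_eqF.
have := @kraft_bucket R {ffun T -> bool} I _ code l [ffun=> false] (#|T|%:R / 4).
case=> [i||g Hg].
- exact: kraft_sum.
- rewrite exchange_big /=; apply: le_trans (ler_sum _ (fun i _ => meanl i)) _.
  by rewrite -mulr_sumr ler_wpM2l.
pose B := [set om | [forall i, code i om == code i g]].
have := @exists_far_coloring R T B g T0; rewrite cardsE => /(_ Hg)[f fB far].
exists f, g; split=> // i.
rewrite inE in fB; have /forallP/(_ i)/eqP[E1 E2] := fB.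
have E3 : digit (y i f) = digit (y i g).
  have := congr1 val E2; rewrite /= !inordK ?(leq_ltn_trans (leq_subr _ _) (hM _ _)) // E1.
  move: E1; rewrite /sg; case: (digit (y i f)) => [|n]; case: (digit (y i g)) => [|n'];
   rewrite ?andbF ?andbT //; case: (y i f < 0); case: (y i g < 0) => //= _; lia.
have := digit_close E3 E1.
rewrite /y -mulrBl -mulrBr -rmorphB normrM normfV (gtr0_norm (lam0 i)) ler_pdivrMr //.
by rewrite normrM (gtr0_norm (t0 i)).
Qed.

End PartialColoring.

(** * Blocks of collinear points *)

Section Lines.
Variables (d N : nat).
Local Notation T := (point d N).
Implicit Types (x y z : T) (b : 'I_d -> int).

Lemma coord_inj x y : (forall k, coord x k = coord y k) -> x = y.
Proof. by move=> H; apply/ffunP => k; apply/val_inj; have := H k; rewrite /coord => -[]. Qed.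

Lemma coord_bound x k : 1 <= coord x k <= N%:Z.
Proof. by rewrite /coord; have := ltn_ord (x k); lia. Qed.

Definition offset b x y (t : int) : bool := [forall k, coord y k == coord x k + t * b k].

Lemma offsetP b x y t : reflect (forall k, coord y k = coord x k + t * b k) (offset b x y t).
Proof. by apply: (iffP forallP) => H k; apply/eqP; have := H k; rewrite ?(rwP eqP). Qed.

Lemma offset0 b x : offset b x x 0.
Proof. by apply/offsetP => k; rewrite mul0r addr0. Qed.

Lemma offset0_eq b x y : offset b x y 0 -> x = y.
Proof. by move=> /offsetP H; apply: coord_inj => k; rewrite H mul0r addr0. Qed.

Lemma offsetN b x y t : offset b x y t -> offset b y x (- t).
Proof. by move=> /offsetP H; apply/offsetP => k; rewrite H; ring. Qed.

Lemma offsetD b x y z t s : offset b x y t -> offset b y z s -> offset b x z (t + s).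
Proof. by move=> /offsetP H /offsetP H'; apply/offsetP => k; rewrite H' H; ring. Qed.

Lemma offset_mul_lt b x y t k : offset b x y t -> `|t| * `|b k| < N%:Z.
Proof.
move=> /offsetP/(_ k) H; rewrite -normrM.
have -> : t * b k = coord y k - coord x k by rewrite H addrAC subrr add0r.
have := coord_bound x k; have := coord_bound y k; lia.
Qed.

Section Direction.
Variables (b : 'I_d -> int).
Hypothesis b0 : exists k, b k != 0.

Lemma offset_unique x y t s : offset b x y t -> offset b x y s -> t = s.
Proof.
case: b0 => k bk /offsetP/(_ k) H /offsetP/(_ k).
rewrite H => /addrI /eqP.
by rewrite -subr_eq0 -mulrBl mulf_eq0 (negbTE bk) orbF subr_eq0 => /eqP.
Qed.

Lemma offset_lt x y t : offset b x y t -> `|t| < N%:Z.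
Proof.
case: b0 => k bk /(offset_mul_lt k); apply: le_lt_trans.
by rewrite ler_peMr // -gtz0_ge1 normr_gt0.
Qed.

(** The bound [i < N] loses nothing, since a longer offset along a nonzero [b] leaves the box
    ([offset_lt]); it makes the relation decidable. *)
Definition before x y : bool := [exists i : 'I_N, offset b x y (i : nat)%:Z].

Lemma beforeP x y : reflect (exists2 t : int, 0 <= t & offset b x y t) (before x y).
Proof.
apply: (iffP existsP) => [[i Hi]|[t t0 Ht]]; first by exists (i : nat)%:Z.
have := offset_lt Ht; rewrite ger0_norm // => tN.
case: t t0 Ht tN => // i _ Hi; rewrite ltz_nat => iN.
by exists (Ordinal iN).
Qed.

Definition collinear x y := before x y || before y x.

Lemma collinearP x y : reflect (exists t, offset b x y t) (collinear x y).
Proof.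
apply: (iffP orP) => [[/beforeP[t _ H]|/beforeP[t _ H]]|[t Ht]].
- by exists t.
- by exists (- t); apply: offsetN.
case: (lerP 0 t) => t0; [left|right]; apply/beforeP; first by exists t.
by exists (- t); [lia | apply: offsetN].
Qed.

Lemma collinear_refl x : collinear x x.
Proof. by apply/collinearP; exists 0; apply: offset0. Qed.

Lemma collinear_sym x y : collinear x y = collinear y x.
Proof. by rewrite /collinear orbC. Qed.

Lemma collinear_trans x y z : collinear x y -> collinear y z -> collinear x z.
Proof.
move=> /collinearP[t H] /collinearP[s H']; apply/collinearP; exists (t + s).
exact: offsetD H H'.
Qed.

Lemma before_refl x : before x x.
Proof. by apply/beforeP; exists 0 => //; apply: offset0. Qed.

Lemma before_trans x y z : before x y -> before y z -> before x z.
Proof.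
move=> /beforeP[t t0 H] /beforeP[s s0 H']; apply/beforeP; exists (t + s); first by lia.
exact: offsetD H H'.
Qed.

Lemma before_anti x y : before x y -> before y x -> x = y.
Proof.
move=> /beforeP[t t0 H] /beforeP[s s0 H'].
have st : t + s = 0 by apply: (offset_unique (offsetD H H')); apply: offset0.
have t00 : t = 0 by lia.
by rewrite t00 in H; apply: offset0_eq H.
Qed.

Definition sbefore x y := before x y && (x != y).

Lemma sbeforeW x y : sbefore x y -> before x y. Proof. by case/andP. Qed.

Lemma sbefore_trans1 x y z : before x y -> sbefore y z -> sbefore x z.
Proof.
move=> xy /andP[yz nyz]; rewrite /sbefore (before_trans xy yz) /=.
by apply: contra nyz => /eqP E; apply/eqP/before_anti => //; rewrite -E.
Qed.

Lemma sbefore_trans2 x y z : sbefore x y -> before y z -> sbefore x z.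
Proof.
move=> /andP[xy nxy] yz; rewrite /sbefore (before_trans xy yz) /=.
by apply: contra nxy => /eqP E; apply/eqP/before_anti => //; rewrite E.
Qed.

Lemma not_before x y : collinear x y -> ~~ before x y -> sbefore y x.
Proof.
rewrite /collinear => /orP[->//|yx] nxy; rewrite /sbefore yx.
by apply: contra nxy => /eqP ->; apply: before_refl.
Qed.

Variable X : {set T}.

Definition rank x := #|[set z in X | sbefore z x]|.
Definition line x := [set y in X | collinear x y].

Lemma rank_lt x y : x \in X -> sbefore x y -> (rank x < rank y)%N.
Proof.
move=> xX xy; apply: proper_card; apply/properP; split.
  apply/subsetP => z; rewrite !inE => /andP[-> zx] /=.
  exact: sbefore_trans1 (sbeforeW zx) xy.
by exists x; rewrite !inE ?xX ?xy // /sbefore eqxx andbF.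
Qed.

Lemma rank_lt_line x y : y \in line x -> (rank y < #|line x|)%N.
Proof.
rewrite inE => /andP[yX xy]; apply: proper_card; apply/properP; split.
  apply/subsetP => z; rewrite !inE => /andP[-> zy] /=.
  by apply: collinear_trans xy _; rewrite /collinear (sbeforeW zy) orbT.
by exists y; rewrite !inE yX // /sbefore eqxx andbF.
Qed.

Lemma rank_inj x y z : y \in line x -> z \in line x -> rank y = rank z -> y = z.
Proof.
rewrite !inE => /andP[yX xy] /andP[zX xz] E.
have yz : collinear y z by apply: collinear_trans xz; rewrite collinear_sym.
apply/eqP; apply/negPn/negP => nyz.
case/orP: yz => h.
  have := @rank_lt y z yX; rewrite /sbefore h nyz E ltnn => /(_ isT) //.
have := @rank_lt z y zX; rewrite /sbefore h eq_sym nyz E ltnn => /(_ isT) //.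
Qed.

Definition segment x u v := [set y in line x | (u <= rank y < v)%N].

Lemma in_segment x u v y : (y \in segment x u v) = (y \in line x) && (u <= rank y < v)%N.
Proof. exact: in_set. Qed.

Lemma card_segment_le x u v : (#|segment x u v| <= v - u)%N.
Proof.
case: (posnP #|segment x u v|) => [->//|/card_gt0P[y0]].
rewrite in_segment => /andP[y0x /andP[uy0 y0v]].
have E : (v - u = (v - u).-1.+1)%N by lia.
pose h y : 'I_(v - u).-1.+1 := inord (rank y - u).
rewrite [X in (_ <= X)%N]E -[X in (_ <= X)%N]card_ord.
apply: (@leq_card_in _ _ h) => y z.
rewrite !in_segment => /andP[yx /andP[uy yv]] /andP[zx /andP[uz zv]] H.
have /= := congr1 val H; rewrite !inordK; try lia.
move=> H2; apply: (rank_inj yx zx); lia.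
Qed.

Lemma segment_cat x u v w : (u <= v)%N -> (v <= w)%N ->
  segment x u w = segment x u v :|: segment x v w /\ [disjoint segment x u v & segment x v w].
Proof.
move=> uv vw; split.
  apply/setP => y; rewrite in_setU !in_segment; case: (y \in line x) => //=.
  by case: (leqP u (rank y)); case: (ltnP (rank y) v) => //=; lia.
rewrite -setI_eq0; apply/eqP/setP => y; rewrite in_setI !in_segment in_set0.
by case: (leqP v (rank y)); rewrite ?andbF.
Qed.

(** The upper bounds for the segments [[0, u)], [[u, v)] and [[v, #|line x|)] add up to the size of
    the line, so each of them is an equality. *)
Lemma card_segment x u v : (u <= v)%N -> (v <= #|line x|)%N -> #|segment x u v| = (v - u)%N.
Proof.
move=> uv vl.
have [E1 D1] := segment_cat x (leq0n u) (leq_trans uv vl).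
have [E2 D2] := segment_cat x uv vl.
have E0 : segment x 0 #|line x| = line x.
  apply/setP => y; rewrite in_segment /=; case: (boolP (y \in line x)) => //= yx.
  exact: rank_lt_line.
have c1 : #|line x| = (#|segment x 0 u| + #|segment x u #|line x| |)%N.
  rewrite -{1}E0 E1 cardsU; move: D1; rewrite -setI_eq0 => /eqP ->; by rewrite cards0 subn0.
have c2 : #|segment x u #|line x| | = (#|segment x u v| + #|segment x v #|line x| |)%N.
  rewrite E2 cardsU; move: D2; rewrite -setI_eq0 => /eqP ->; by rewrite cards0 subn0.
have := card_segment_le x 0 u; have := card_segment_le x u v.
have := card_segment_le x v #|line x|; lia.
Qed.

End Direction.
End Lines.

(** * Covering the trace of a progression by blocks *)

Section Blocks.
Variables (d N : nat).
Local Notation T := (point d N).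
Variables (b : 'I_d -> int) (X : {set T}).
Hypothesis b0 : exists k, b k != 0.

Definition block (s : nat) (x : T) : {set T} :=
  segment b X x (rank b X x %/ s * s) ((rank b X x %/ s).+1 * s).

(** Only full blocks are kept; the shorter rest at the end of a line is covered by blocks of smaller
    sizes. *)
Definition blocks (s : nat) : {set {set T}} :=
  [set block s x | x in [set x in X | #|block s x| == s]].

Lemma in_line x y : (y \in line b X x) = (y \in X) && collinear b x y.
Proof. exact: in_set. Qed.

Lemma line_eq x y : collinear b x y -> line b X y = line b X x.
Proof.
move=> xy; apply/setP => z; rewrite !in_line; congr andb; apply/idP/idP.
  exact: (collinear_trans b0 xy).
by apply: (collinear_trans b0); rewrite collinear_sym.
Qed.

Lemma block_sub s x y : y \in block s x -> y \in X.
Proof. by rewrite in_segment in_line => /andP[/andP[]]. Qed.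

Lemma block_eq s x y : (0 < s)%N -> y \in block s x -> block s y = block s x.
Proof.
move=> s0; rewrite in_segment in_line => /andP[/andP[yX xy] /andP[h1 h2]].
have E : (rank b X y %/ s = rank b X x %/ s)%N.
  apply/eqP; rewrite eqn_leq -ltnS ltn_divLR // h2 /=.
  by rewrite leq_divRL.
by rewrite /block E; apply/setP => z; rewrite !in_segment (line_eq xy).
Qed.

Lemma full_segment_block s x q : (0 < s)%N -> (q.+1 * s <= #|line b X x|)%N ->
  segment b X x (q * s) (q.+1 * s) \in blocks s.
Proof.
move=> s0 qs.
have cs : #|segment b X x (q * s) (q.+1 * s)| = s.
  by rewrite card_segment // ?leq_mul2r ?leqnSn ?orbT // mulSn addnK.
have /card_gt0P[y] : (0 < #|segment b X x (q * s) (q.+1 * s)|)%N by rewrite cs.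
move=> yseg; have := yseg; rewrite in_segment in_line => /andP[/andP[yX xy] /andP[h1 h2]].
have E : (rank b X y %/ s = q)%N.
  by apply/eqP; rewrite eqn_leq -ltnS ltn_divLR // h2 /= leq_divRL.
have Eb : block s y = segment b X x (q * s) (q.+1 * s).
  by rewrite /block E; apply/setP => z; rewrite !in_segment (line_eq xy).
by rewrite -Eb; apply: imset_f; rewrite inE yX Eb cs eqxx.
Qed.

Lemma card_blocks s : (0 < s)%N -> (#|blocks s| * s <= #|X|)%N.
Proof.
move=> s0.
have -> : (#|blocks s| * s = \sum_(B in blocks s) \sum_(x in X | x \in B) 1)%N.
  rewrite -sum_nat_const; apply: eq_bigr => B /imsetP[x]; rewrite inE => /andP[xX /eqP cB] ->.
  rewrite sum1_card -{1}cB; apply: eq_card => y.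
  by rewrite -[RHS]topredE /=; apply/idP/andP => [h|[]//]; split=> //; apply: block_sub h.
rewrite (exchange_big_dep (mem X)) /=; last by move=> B x _ /andP[].
rewrite -sum1_card; apply: leq_sum => x xX.
rewrite sum1_card -[X in (_ <= X)%N](cards1 (block s x)).
apply: subset_leq_card; apply/subsetP => B; rewrite !inE.
move=> /andP[/imsetP[y _ ->] /andP[_ h]]; apply/eqP; exact/esym/block_eq.
Qed.

(** Each [x] lies in at most one block, and the [s] points of that block are all collinear with
    [x]. *)
Lemma card_blocks_sq s : (0 < s)%N ->
  (#|blocks s| * s ^ 2 <= \sum_(x in X) \sum_(y in X) collinear b x y)%N.
Proof.
move=> s0.
have -> : (#|blocks s| * s ^ 2 = \sum_(B in blocks s) \sum_(x in X | x \in B) #|B|)%N.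
  rewrite -sum_nat_const; apply: eq_bigr => B /imsetP[x]; rewrite inE => /andP[xX /eqP cB] ->.
  rewrite sum_nat_const cB -mulnn -{1}cB; congr (_ * _)%N; apply: eq_card => y.
  by rewrite -[RHS]topredE /=; apply/idP/andP => [h|[]//]; split=> //; apply: block_sub h.
rewrite (exchange_big_dep (mem X)) /=; last by move=> B x _ /andP[].
apply: leq_sum => x xX.
apply: (@leq_trans (\sum_(B in [set block s x]) #|B|)).
  rewrite [X in (_ <= X)%N](bigID (fun B => (B \in blocks s) && (x \in B))) /=.
  apply: leq_trans (leq_addr _ _); rewrite leq_eqVlt; apply/orP; left; apply/eqP.
  apply: eq_bigl => B; rewrite in_set1.
  case: (boolP (B \in blocks s)) => /= [/imsetP[y _ ->]|_]; last by rewrite andbF.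
  case: (boolP (x \in block s y)) => [h|_]; last by rewrite ?andbF.
  by rewrite xX (block_eq s0 h) eqxx.
rewrite big_set1.
have -> : (\sum_(y in X) collinear b x y = #|line b X x|)%N.
  rewrite -big_mkcondr /= sum1_card; apply: eq_card => y; by rewrite !inE.
by apply: subset_leq_card; apply/subsetP => y; rewrite in_segment => /andP[].
Qed.

Variables (R : realFieldType) (g : T -> int) (D : nat -> R).
Hypothesis D0 : forall j, 0 <= D j.
Hypothesis hD : forall j B, B \in blocks (16 ^ j) -> `|\sum_(y in B) g y|%:~R <= D j.

Local Notation G x u v := (\sum_(y in segment b X x u v) g y).

Lemma segment_sum_cat x u v w : (u <= v)%N -> (v <= w)%N -> G x u w = G x u v + G x v w.
Proof.
move=> uv vw; have [-> dis] := segment_cat b X x uv vw.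
by rewrite -bigU //; apply: eq_bigl => y; rewrite in_setU.
Qed.

Lemma segment_sum_blocks x j c q : ((q + c) * 16 ^ j <= #|line b X x|)%N ->
  `|G x (q * 16 ^ j) ((q + c) * 16 ^ j)|%:~R <= c%:R * D j.
Proof.
elim: c => [|c IH] h.
  rewrite addn0 mul0r big1 // => y; rewrite in_segment.
  by case/andP=> _ /andP[h1 h2]; lia.
rewrite (@segment_sum_cat x _ ((q + c) * 16 ^ j)); last 2 first.
- by rewrite leq_mul2r leq_addr orbT.
- by rewrite leq_mul2r addnS leqnSn orbT.
have h1 : ((q + c) * 16 ^ j <= #|line b X x|)%N.
  by apply: leq_trans h; rewrite leq_mul2r addnS leqnSn orbT.
have h2 : `|G x ((q + c) * 16 ^ j) ((q + c.+1) * 16 ^ j)|%:~R <= D j.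
  by apply: hD; rewrite addnS; apply: full_segment_block; rewrite ?expn_gt0 // -addnS.
have := IH h1 => h3.
rewrite -natr1 mulrDl mul1r; apply: le_trans (lerD h3 h2).
by rewrite -intrD ler_int ler_normD.
Qed.

(** The base 16 digits of [r] say how many blocks of each size to take, largest first; every block
    starts at a multiple of its size, so it belongs to [blocks]. *)
Lemma segment_sum_digits x J q r : (r < 16 ^ J)%N -> (q * 16 ^ J + r <= #|line b X x|)%N ->
  `|G x (q * 16 ^ J) (q * 16 ^ J + r)|%:~R <= 15 * \sum_(j < J) D j.
Proof.
elim: J q r => [|J IH] q r.
  rewrite expn0 ltnS leqn0 => /eqP -> _; rewrite big_ord0 mulr0 big1 // => y.
  by rewrite in_segment => /andP[_ /andP[h1 h2]]; lia.
move=> hr hl; rewrite big_ord_recr /= mulrDr.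
have p0 : (0 < 16 ^ J)%N by rewrite expn_gt0.
pose c := (r %/ 16 ^ J)%N; pose r' := (r %% 16 ^ J)%N.
have rE : r = (c * 16 ^ J + r')%N by rewrite /c /r' -divn_eq.
have c16 : (c <= 15)%N by rewrite -ltnS /c ltn_divLR // -expnS.
have r'l : (r' < 16 ^ J)%N by rewrite ltn_mod.
have qE : (q * 16 ^ J.+1 = (16 * q) * 16 ^ J)%N by rewrite expnS; lia.
have E2 : (q * 16 ^ J.+1 + r = (16 * q + c) * 16 ^ J + r')%N by rewrite qE rE; lia.
rewrite E2 qE in hl *.
rewrite (@segment_sum_cat x _ ((16 * q + c) * 16 ^ J)) ?leq_addr ?leq_mul2r ?leq_addr ?orbT //.
have h1 := IH _ _ r'l hl.
have h2 : `|G x (16 * q * 16 ^ J) ((16 * q + c) * 16 ^ J)|%:~R <= c%:R * D J.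
  by apply: segment_sum_blocks; apply: leq_trans hl; apply: leq_addr.
have h3 : c%:R * D J <= 15 * D J by rewrite ler_wpM2r // ler_nat.
rewrite [leRHS]addrC; apply: le_trans (lerD (le_trans h2 h3) h1).
by rewrite -intrD ler_int ler_normD.
Qed.

(** In the order of the line, the progression meets [X] exactly in the ranks from [r1] to [r2 - 1];
    this is a difference of two prefixes, each with at most 15 blocks of each size. *)
Lemma AP_sum_le (a : 'I_d -> int) l : (0 < l)%N ->
  (forall (i : nat) (k : 'I_d), (i < l)%N -> 1 <= a k + i%:Z * b k <= N%:Z) ->
  `|\sum_(y in ap_set N a b l :&: X) g y|%:~R <= 30 * \sum_(j < #|X|) D j.
Proof.
move=> l0 inbox.
have rhs0 : 0 <= 30 * \sum_(j < #|X|) D j by rewrite mulr_ge0 // sumr_ge0.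
case: (set_0Vmem (ap_set N a b l :&: X)) => [->|[x]]; first by rewrite big_set0.
rewrite inE => /andP[xA xX].
have ord_lt (i : nat) (k : 'I_d) : (i < l)%N -> (`|(a k + i%:Z * b k)%R|.-1 < N)%N.
  by move=> /(inbox _ k); lia.
have ptP (i : nat) : (i < l)%N -> exists p : T, forall k, coord p k = a k + i%:Z * b k.
  move=> il; exists [ffun k => Ordinal (ord_lt i k il)] => k.
  by rewrite /coord ffunE /=; have := inbox _ k il; lia.
have [p0 Hp0] := ptP 0%N l0.
have l1 : (l.-1 < l)%N by rewrite prednK.
have [p1 Hp1] := ptP _ l1.
have p01 : offset b p0 p1 l.-1%:Z.
  by apply/offsetP => k; rewrite Hp0 Hp1; ring.
have inA y : (y \in ap_set N a b l) = before b p0 y && before b y p1.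
  rewrite inE; apply/existsP/andP => [[i /forallP Hi]|[/(beforeP b0)[t t0 Ht] /(beforeP b0)[s s0 Hs]]].
    have oy : offset b p0 y (i : nat)%:Z.
      by apply/offsetP => k; rewrite (eqP (Hi k)) Hp0; ring.
    split; apply/(beforeP b0); first by exists (i : nat)%:Z.
    exists (l.-1%:Z - (i : nat)%:Z); first by have := ltn_ord i; lia.
    by rewrite addrC; apply: offsetD (offsetN oy) p01.
  have ts : t + s = l.-1%:Z by apply: (offset_unique b0 (offsetD Ht Hs) p01).
  case: t t0 ts Ht => // i _ ts Ht.
  have il : (i < l)%N by lia.
  exists (Ordinal il); apply/forallP => k; apply/eqP.
  by rewrite (offsetP _ _ _ _ Ht) Hp0 /=; ring.
have col01 : collinear b x p0 /\ collinear b x p1.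
  by move: xA; rewrite inA /collinear => /andP[-> ->]; rewrite orbT.
have [cx0 cx1] := col01.
pose r1 := #|[set z in X | sbefore b z p0]|.
pose r2 := #|[set z in X | before b z p1]|.
have AE : ap_set N a b l :&: X = segment b X x r1 r2.
  apply/setP => y; rewrite in_setI in_segment in_line inA.
  case: (boolP (y \in X)) => yX /=; last by rewrite andbF.
  rewrite andbT; case: (boolP (collinear b x y)) => /= cxy; last first.
    apply/negP => /andP[h _]; case/negP: cxy; apply: (collinear_trans b0 cx0).
    by rewrite /collinear h.
  have c0y : collinear b p0 y by apply: (collinear_trans b0 _ cxy); rewrite collinear_sym.
  have cy1 : collinear b y p1 by apply: (collinear_trans b0 _ cx1); rewrite collinear_sym.
  congr andb.
    apply/idP/idP => h.
      apply: subset_leq_card; apply/subsetP => z; rewrite !inE => /andP[-> hz] /=.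
      exact: (sbefore_trans2 b0 hz h).
    case: (boolP (before b p0 y)) => // nh; have hy := not_before b0 c0y nh; exfalso.
    move: h; rewrite leqNgt => /negP; apply; apply: proper_card; apply/properP; split.
      apply/subsetP => z; rewrite !inE => /andP[-> hz] /=.
      exact: (sbefore_trans1 b0 (sbeforeW hz) hy).
    by exists y; rewrite !inE yX ?hy // /sbefore eqxx andbF.
  apply/idP/idP => h.
    apply: proper_card; apply/properP; split.
      apply/subsetP => z; rewrite !inE => /andP[-> hz] /=.
      exact: (before_trans b0 (sbeforeW hz) h).
    by exists y; rewrite !inE yX ?h // /sbefore eqxx andbF.
  case: (boolP (before b y p1)) => // nh; have hy := not_before b0 cy1 nh; exfalso.
  move: h; rewrite ltnNge => /negP; apply; apply: subset_leq_card.
  apply/subsetP => z; rewrite !inE => /andP[-> hz] /=.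
  exact: (sbefore_trans1 b0 hz hy).
have r12 : (r1 <= r2)%N.
  apply: subset_leq_card; apply/subsetP => z; rewrite !inE => /andP[-> hz] /=.
  apply: (before_trans b0 (sbeforeW hz)); apply/(beforeP b0).
  by exists l.-1%:Z.
have r2l : (r2 <= #|line b X x|)%N.
  apply: subset_leq_card; apply/subsetP => z; rewrite in_line inE => /andP[-> hz] /=.
  by apply: (collinear_trans b0 cx1); rewrite /collinear hz orbT.
have lX : (#|line b X x| < 16 ^ #|X|)%N.
  apply: leq_ltn_trans (ltn_expl _ (isT : 1 < 16)%N).
  by apply: subset_leq_card; apply/subsetP => z; rewrite in_line => /andP[].
rewrite AE.
have pre r : (r <= #|line b X x|)%N -> `|G x 0 r|%:~R <= 15 * \sum_(j < #|X|) D j.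
  move=> rl; have := @segment_sum_digits x #|X| 0 r (leq_ltn_trans rl lX).
  by rewrite mul0n add0n => /(_ rl).
have := pre _ r2l; have := pre _ (leq_trans r12 r2l).
rewrite (segment_sum_cat x (leq0n r1) r12).
move: (G x 0 r1) (G x r1 r2) => u v h1 h2.
apply: (@le_trans _ _ (`|u + v|%:~R + `|u|%:~R)).
  by rewrite -intrD ler_int -[in leLHS](addKr u v) addrC (le_trans (ler_normD _ _)) ?normrN.
apply: le_trans (lerD h2 h1) _; rewrite -mulrDl ler_wpM2r ?sumr_ge0 //; lra.
Qed.

End Blocks.

(** * The number of blocks of a given size in all directions *)

Section Family.
Variables (d N : nat).
Hypothesis d0 : (0 < d)%N.
Local Notation T := (point d N).
Local Notation dir := {ffun 'I_d -> 'I_(2 * N).+1}.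
Variable X : {set T}.

Definition nonzero_dir (b : dir) : bool := [exists k, dirv b k != 0].

Definition block_family (s : nat) : {set {set T}} :=
  \bigcup_(b : dir | nonzero_dir b) blocks (dirv b) X s.

Lemma nonzero_dirP (b : dir) : nonzero_dir b -> exists k, dirv b k != 0.
Proof. by move=> /existsP. Qed.

Lemma card_dir_box z : (#|[set b : dir | [forall k, `|dirv b k| <= z]%N]| <= (2 * z).+1 ^ d)%N.
Proof.
pose P (v : 'I_(2 * N).+1) := (`|((v : nat)%:Z - N%:Z)%R| <= z)%N.
have -> : #|[set b : dir | [forall k, `|dirv b k| <= z]%N]| = (#|P| ^ d)%N.
  rewrite -[X in (_ ^ X)%N](card_ord d) -card_ffun_on; apply: eq_card => b.
  rewrite inE; apply/forallP/ffun_onP => H k; exact: H.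
have h : (#|P| <= (2 * z).+1)%N.
  have := @count_congruent _ P 1 (N - z) (2 * z).+1 isT; rewrite mul1n addn1; apply.
    by move=> x; rewrite /P; lia.
  by move=> x y _ _ _; rewrite dvd1n.
by case: (d) => // n; rewrite leq_exp2r.
Qed.

(** If [dirv b k] is nonzero, the [s] points of a block have distinct [k]-th coordinates, all
    congruent modulo [dirv b k], among [N] values. *)
Lemma block_extent (b : dir) s k : (0 < s)%N -> nonzero_dir b -> blocks (dirv b) X s != set0 ->
  (`|dirv b k| * s <= 2 * N)%N.
Proof.
move=> s0 bn /set0Pn[B /imsetP[x]]; rewrite inE => /andP[xX /eqP cB] _.
have dN : (`|dirv b k| <= N)%N by rewrite /dirv; have := ltn_ord (b k); lia.
case: (posnP `|dirv b k|) => [->//|bk0].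
have b0 := nonzero_dirP bn.
pose P (v : 'I_N) := [exists y in block (dirv b) X s x, y k == v].
have off y z : y \in block (dirv b) X s x -> z \in block (dirv b) X s x ->
   exists t, offset (dirv b) y z t.
  rewrite !in_segment !in_line => /andP[/andP[_ xy] _] /andP[/andP[_ xz] _].
  apply/(collinearP b0); apply: (collinear_trans b0 _ xz); by rewrite collinear_sym.
have sP : (s <= #|P|)%N.
  rewrite -{1}cB -(@card_in_imset _ _ (fun y : T => y k)).
    apply: subset_leq_card; apply/subsetP => v /imsetP[y yB ->].
    by apply/existsP; exists y; rewrite yB eqxx.
  move=> y z yB zB E; have [t Ht] := off _ _ yB zB.
  have /(_ k) := offsetP _ _ _ _ Ht; rewrite /coord E => H.
  have t0 : t = 0.
    have : t * dirv b k = 0 by apply: (addrI ((z k).+1)%:Z); rewrite -H addr0.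
    by move/eqP; rewrite mulf_eq0 => /orP[/eqP//|/eqP bz]; rewrite bz in bk0.
  by rewrite t0 in Ht; apply: offset0_eq Ht.
have := @count_congruent _ P `|dirv b k| 0 N bk0 => /(_ _ _) h.
have {h} : (`|dirv b k| * #|P| <= (N + `|dirv b k|).-1)%N.
  apply: h => [v _|u v /existsP[y /andP[yB /eqP <-]] /existsP[z /andP[zB /eqP <-]] uv].
    by rewrite /= add0n ltn_ord.
  have [t Ht] := off _ _ yB zB.
  have /(_ k) := offsetP _ _ _ _ Ht; rewrite /coord => H.
  have : ((z k - y k)%N)%:Z = t * dirv b k.
    have -> : t * dirv b k = ((z k).+1)%:Z - ((y k).+1)%:Z by rewrite H [RHS]addrC addKr.
    by rewrite -subzn //; lia.
  by move/(congr1 absz); rewrite abszM absz_nat => ->; rewrite dvdn_mull.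
have : (`|dirv b k| * s <= `|dirv b k| * #|P|)%N by rewrite leq_mul2l sP orbT.
move: (`|dirv b k|)%N dN bk0 => a; move: #|P| => p; nia.
Qed.

(** Only directions with entries at most [z = 2 N / s] carry blocks, at most
    [(2 z + 1)^d <= (3 z)^d] of them, and each carries at most [|X| / s]. If [z = 0], there are no
    blocks at all. *)
Lemma card_block_family s : (0 < s)%N ->
  (#|block_family s| * s ^ d.+1 <= #|X| * (6 * N) ^ d)%N.
Proof.
move=> s0.
pose z := (2 * N %/ s)%N.
pose small := [set b : dir | [forall k, `|dirv b k| <= z]%N].
have h1 : (#|block_family s| <= \sum_(b in small | nonzero_dir b) #|blocks (dirv b) X s|)%N.
  apply: (@leq_trans (\sum_(b : dir | nonzero_dir b) #|blocks (dirv b) X s|)).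
    rewrite /block_family; elim/big_rec2: _ => [|b n S _ IH]; first by rewrite cards0.
    by apply: leq_trans (leq_card_setU _ _) _; rewrite leq_add2l.
  rewrite [X in (_ <= X)%N]big_mkcond [X in (X <= _)%N]big_mkcond /=.
  apply: leq_sum => b _; case: (boolP (nonzero_dir b)) => bn; last by rewrite andbF.
  rewrite andbT; case: (boolP (b \in small)) => // bs.
  case: (eqVneq (blocks (dirv b) X s) set0) => [->|H]; first by rewrite cards0.
  case/negP: bs; rewrite inE; apply/forallP => k.
  by rewrite leq_divRL // block_extent.
case: (posnP #|block_family s|) => [->//|F0].
have z1 : (0 < z)%N.
  rewrite lt0n; apply/negP => /eqP z0; move: F0; rewrite lt0n => /negP; apply.
  rewrite -leqn0; apply: leq_trans h1 _; rewrite big1 // => b /andP[].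
  rewrite inE => /forallP bs /nonzero_dirP[k]; have := bs k; rewrite z0 leqn0 absz_eq0 => ->; by [].
have h2 : (#|block_family s| * s <= #|X| * (2 * z).+1 ^ d)%N.
  apply: (@leq_trans (\sum_(b in small | nonzero_dir b) #|X|)).
    apply: leq_trans (leq_mul h1 (leqnn s)) _; rewrite big_distrl /=.
    apply: leq_sum => b /andP[_ /nonzero_dirP bn]; exact: card_blocks.
  rewrite sum_nat_const mulnC leq_mul2l; apply/orP; right.
  apply: leq_trans (card_dir_box z); apply: subset_leq_card; apply/subsetP => b.
  by rewrite -topredE /= => /andP[].
rewrite expnS mulnA.
apply: leq_trans (leq_mul h2 (leqnn _)) _.
rewrite -mulnA -expnMn leq_mul2l; apply/orP; right.
rewrite leq_exp2r //.
have := leq_trunc_div (2 * N) s; rewrite -/z; nia.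
Qed.

(** Directions with all entries at most [z] are counted trivially. Any other direction has an entry
    above [z], so collinear points in the box differ by fewer than [N / (z + 1) <= S] steps and are
    neighbours. The factor 2 accounts for the two signs of the offset. *)
Lemma card_block_family_walks s z S Q : (0 < s)%N -> (2 * N <= Q * s)%N -> (N <= S * z.+1)%N ->
  (#|block_family s| * s ^ 2 <=
   #|X| * (3 * z) ^ d * s + 2 * total_walks (@coord d N) X S Q 1)%N.
Proof.
move=> s0 Qs NS.
pose small := [set b : dir | [forall k, `|dirv b k| <= z]%N].
pose inQ (b : dir) := [forall k, (`|dirv b k| <= Q)%N].
have h1 : (#|block_family s| <= \sum_(b in small | nonzero_dir b) #|blocks (dirv b) X s|
    + \sum_(b | (b \notin small) && (nonzero_dir b && inQ b)) #|blocks (dirv b) X s|)%N.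
  apply: (@leq_trans (\sum_(b : dir | nonzero_dir b) #|blocks (dirv b) X s|)).
    rewrite /block_family; elim/big_rec2: _ => [|b n S' _ IH]; first by rewrite cards0.
    by apply: leq_trans (leq_card_setU _ _) _; rewrite leq_add2l.
  rewrite [X in (X <= _)%N]big_mkcond [X in (_ <= X + _)%N]big_mkcond.
  rewrite [X in (_ <= _ + X)%N]big_mkcond -big_split /=.
  apply: leq_sum => b _; case: (boolP (nonzero_dir b)) => bn; rewrite ?andbF //=.
  case: (boolP (b \in small)) => bs /=; first by rewrite leq_addr.
  case: (boolP (inQ b)) => // nQ.
  case: (eqVneq (blocks (dirv b) X s) set0) => [->|H]; first by rewrite cards0.
  case/negP: nQ; apply/forallP => k; have := block_extent k s0 bn H.
  by move=> h; rewrite -(leq_pmul2r s0); apply: leq_trans h Qs.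
apply: leq_trans (leq_mul h1 (leqnn _)) _; rewrite mulnDl; apply: leq_add.
  rewrite -mulnn mulnA leq_mul2r; apply/orP; right.
  apply: (@leq_trans (\sum_(b in small | nonzero_dir b) #|X|)).
    rewrite big_distrl /=.
    apply: leq_sum => b /andP[_ /nonzero_dirP bn]; exact: card_blocks.
  rewrite sum_nat_const mulnC leq_mul2l; apply/orP; right.
  case: (posnP z) => [z0|z1].
    rewrite (eq_card0 (A := fun i => _)) // => b; apply/negP.
    rewrite -topredE /= => /andP[]; rewrite inE => /forallP bs /nonzero_dirP[k].
    by have := bs k; rewrite z0 leqn0 absz_eq0 => ->.
  apply: (@leq_trans ((2 * z).+1 ^ d)); last by rewrite leq_exp2r //; lia.
  apply: leq_trans (card_dir_box z); apply: subset_leq_card; apply/subsetP => b.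
  by rewrite -topredE /= => /andP[].
rewrite big_distrl /=.
pose h (b : dir) : {ffun 'I_d -> 'I_(2 * Q).+1} := [ffun k => inord `|dirv b k + Q%:Z|].
have hE b k : inQ b -> dirv (h b) k = dirv b k.
  move=> /forallP/(_ k) bQ; rewrite /h [LHS]/dirv ffunE inordK; last by lia.
  by lia.
have h_inj : {in inQ &, injective h}.
  move=> b b' bQ b'Q E; apply/ffunP => k; apply/val_inj.
  have : dirv b k = dirv b' k by rewrite -(hE _ _ bQ) -(hE _ _ b'Q) E.
  by rewrite /dirv => /addIr[].
pose F (c : {ffun 'I_d -> 'I_(2 * Q).+1}) := (\sum_(x in X) \sum_(y in X) \sum_(i < S)
   (step (@coord d N) i c x y + step (@coord d N) i c y x))%N.
apply: (@leq_trans (\sum_(b | (b \notin small) && (nonzero_dir b && inQ b)) F (h b))).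
  apply: leq_sum => b /and3P[bs /nonzero_dirP bn bQ].
  apply: leq_trans (card_blocks_sq X bn s0) _.
  apply: leq_sum => x _; apply: leq_sum => y _.
  case: (boolP (collinear _ _ _)) => // /(collinearP bn)[t Ht].
  have [k bk] : exists k, (z < `|dirv b k|)%N.
    by move: bs; rewrite inE => /forallPn[k]; rewrite -ltnNge => bk; exists k.
  have := offset_mul_lt k Ht.
  move=> tb; have tS : (`|t| < S)%N by nia.
  rewrite (bigD1 (Ordinal tS)) //=.
  have stepE u v : offset (dirv b) u v `|t|%N%:Z -> step (@coord d N) `|t|%N (h b) u v.
    by move=> /offsetP H; apply/stepP => j; rewrite H hE.
  case: (lerP 0 t) => t0.
    by rewrite stepE // gez0_abs.
  rewrite (stepE y x); first by rewrite addnAC leq_addl.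
  by rewrite ltz0_abs //; apply: offsetN.
apply: (@leq_trans (\sum_c F c)).
  rewrite -(big_imset F) /=.
    by rewrite [X in (_ <= X)%N](bigID (mem (h @: [pred b | (b \notin small) && (nonzero_dir b && inQ b)]))) leq_addr.
  by move=> b b' /and3P[_ _ bQ] /and3P[_ _ b'Q]; apply: h_inj.
set W := total_walks (@coord d N) X S Q 1.
have E1 : W = (\sum_(c : {ffun 'I_d -> 'I_(2 * Q).+1}) \sum_(x in X) \sum_(y in X) \sum_(i < S) step (@coord d N) i c x y)%N.
  rewrite /W /total_walks /= [RHS]exchange_big /=; apply: eq_bigr => x _.
  rewrite [RHS]exchange_big /=; apply: eq_bigr => y _.
  by rewrite muln1 /adj exchange_big.
have E2 : W = (\sum_(c : {ffun 'I_d -> 'I_(2 * Q).+1}) \sum_(x in X) \sum_(y in X) \sum_(i < S) step (@coord d N) i c y x)%N.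
  rewrite E1; apply: eq_bigr => c _; exact: exchange_big.
rewrite [X in (_ <= X)%N]mul2n -addnn {1}E1 {1}E2 -big_split /=.
apply: leq_sum => c _; rewrite /F -big_split /=; apply: leq_sum => x _.
rewrite -big_split /=; apply: leq_sum => y _.
by rewrite -big_split.
Qed.

End Family.

(** * Upper bound *)

Section PartialStep.
Variables (R : realType).

Lemma sum_two_sided (j1 J : nat) :
  \sum_(j < J) (2^-1 : R) ^+ ((j - j1) + (j1 - j)) <= 3.
Proof.
have A : forall J, (J <= j1)%N -> \sum_(j < J) (2^-1 : R) ^+ ((j - j1) + (j1 - j)) <= 2^-1 ^+ (j1 - J).
  elim=> [_|K IH KJ]; first by rewrite big_ord0 exprn_ge0 // invr_ge0.
  rewrite big_ord_recr /=; have -> : (K - j1 = 0)%N by lia.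
  rewrite add0n; apply: le_trans (lerD (IH (ltnW KJ)) (lexx _)) _.
  have -> : (j1 - K = (j1 - K.+1).+1)%N by lia.
  rewrite exprS; move: (2^-1 ^+ _) => z; lra.
have B : forall i, \sum_(j < j1 + i) (2^-1 : R) ^+ ((j - j1) + (j1 - j)) <= 3 - 2 * 2^-1 ^+ i.
  elim=> [|i IH].
    rewrite addn0 expr0; have := A j1 (leqnn _); rewrite subnn expr0; lra.
  rewrite addnS big_ord_recr /=; have -> : (j1 + i - j1 + (j1 - (j1 + i)) = i)%N by lia.
  apply: le_trans (lerD IH (lexx _)) _; rewrite exprS; lra.
case: (leqP J j1) => h.
  apply: le_trans (A J h) _; apply: (@le_trans _ _ 1); last by rewrite ler1n.
  by rewrite exprn_ile1 ?invr_ge0 // invf_le1 // ler1n.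
have -> : J = (j1 + (J - j1))%N by lia.
apply: le_trans (B _) _; rewrite gerBl mulr_ge0 // exprn_ge0 // invr_ge0 //.
Qed.

Lemma exists_scale (x : R) : 1 <= x ->
  exists j, 2 * x <= (16 ^ j)%:R < 32 * x.
Proof.
move=> x1.
have ex : exists j, 2 * x <= (16 ^ j)%:R.
  exists (Num.truncn (2 * x)).+1.
  have x0 : 0 <= 2 * x by lra.
  have /andP[_ h] := truncn_itv x0.
  apply: le_trans (ltW h) _.
  by rewrite ler_nat ltnW // ltn_expl.
case: (ex_minnP ex) => j Hj jmin; exists j; rewrite Hj /=.
case: j Hj jmin => [|j] Hj jmin.
  by rewrite expn0; lra.
have : ~~ (2 * x <= (16 ^ j)%:R) by apply/negP => /jmin; rewrite ltnn.
rewrite -ltNge expnS natrM; move: ((16 ^ j)%:R : R) => z; lra.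
Qed.

Lemma sum_subset_sub (T : finType) (X B : {set T}) (F : T -> int) : B \subset X ->
  \sum_(x in B) F x = \sum_(z : {x | x \in X} | val z \in B) F (val z).
Proof.
move=> BX; rewrite (reindex_omap val (insub : T -> option {x | x \in X})); last first.
  move=> x xB; have xX := subsetP BX _ xB; by rewrite (insubT (mem X) xX).
by apply: eq_bigl => z; rewrite valK eqxx andbT.
Qed.

(** Replaces the direction by one from the finite set indexing the block families. *)
Lemma is_AP_dir d N (A : {set point d N}) : (0 < N)%N -> is_AP A ->
  exists (b : {ffun 'I_d -> 'I_(2 * N).+1}) a l, [/\ nonzero_dir b, (0 < l)%N,
     forall (i : nat) (k : 'I_d), (i < l)%N -> 1 <= a k + i%:Z * dirv b k <= N%:Z &
     A = ap_set N a (dirv b) l].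
Proof.
move=> N0 [a [b [l [[k0 bk0] l0 inbox ->]]]].
have [b' [b'0 b'N E]] : exists b' : 'I_d -> int, [/\ b' k0 != 0, forall k, `|b' k| <= N%:Z &
    forall i k, (i < l)%N -> i%:Z * b' k = i%:Z * b k].
  (* A progression of one point may have an arbitrarily large direction, which is exchanged for the
     all-ones vector; with two points the box already bounds it. *)
  case: l l0 inbox => [//|[|l]] _ inbox.
    exists (fun=> 1); split=> // i k.
    by rewrite ltnS leqn0 => /eqP ->; rewrite !mul0r.
  exists b; split=> // k.
  have := inbox 0%N k isT; have := inbox 1%N k isT; lia.
pose b'' : {ffun 'I_d -> 'I_(2 * N).+1} := [ffun k => inord `|b' k + N%:Z|].
have bE k : dirv b'' k = b' k.
  have := b'N k; rewrite /dirv ffunE => h; rewrite inordK; lia.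
exists b'', a, l; split=> //.
- by apply/existsP; exists k0; rewrite bE.
- by move=> i k il; rewrite bE E // inbox.
apply/setP => x; rewrite !inE; apply/existsP/existsP => -[i /forallP H]; exists i;
  apply/forallP => k; have := H k; rewrite bE E //; exact: ltn_ord.
Qed.


Variable d : nat.
Hypothesis d0 : (0 < d)%N.
Local Notation E := (density_exponent d).

(* 16^j1 is about N^(d/(d+1)) u with u = v^4 a small power of the density of X. Above this
   scale the blocks are counted by total_walks1_bound, below it by card_block_family;
   the tolerances lam decay or grow so that both the costs and the errors lam 4^j are
   geometric around j1. *)
Lemma block_cost_bound : exists2 K0 : R, 0 < K0 &
  forall N (X : {set point d N}) (n v kappa : R) (j1 j : nat),
   1 <= n -> 0 < v <= 1 -> 1 <= kappa -> n ^+ d.+1 = N%:R ->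
   #|X|%:R = v ^+ (4 * E) * n ^+ (d * d.+1) ->
   2 * (n ^+ d * v ^+ 4) <= (16 ^ j1)%:R ->
   let lam := if (j1 <= j)%N then kappa / 8 ^+ (j - j1) else kappa * 2 ^+ (j1 - j) / v in
   let q := if (j1 <= j)%N then 1%N else (2 * d + 3)%N in
   #|block_family X (16 ^ j)|%:R * (cost_const R q / lam ^+ (2 * q).-1) <=
   #|X|%:R * K0 / kappa * 2^-1 ^+ ((j - j1) + (j1 - j)).
Proof.
have [C C0 hC] := total_walks1_bound R d0.
pose c1 := cost_const R 1; pose c2 := cost_const R (2 * d + 3).
have c10 : 0 <= c1 by apply: cost_const_ge0.
have c20 : 0 <= c2 by apply: cost_const_ge0.
pose C2 : R := 3 ^+ d + C.
have C20 : 0 < C2 by rewrite addr_gt0 // exprn_gt0.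
exists (C2 * c1 + 6 ^+ d * c2 + 1).
  by rewrite ltr_wpDl // addr_ge0 ?mulr_ge0 ?exprn_ge0 // ltW.
move=> N X n v kappa j1 j n1 /andP[v0 v1] k1 nN mE hj1.
have n0 : 0 < n by apply: lt_le_trans n1.
have k0 : 0 < kappa by apply: lt_le_trans k1.
pose u := v ^+ 4.
have u0 : 0 < u by rewrite exprn_gt0.
have u1 : u <= 1 by rewrite exprn_ile1 // ltW.
set m : R := #|X|%:R in mE *.
have m0 : 0 <= m by [].
have nd0 : 0 < n ^+ d by rewrite exprn_gt0.
have cub0 i : 0 < (2^-1 : R) ^+ i by rewrite exprn_gt0 // invr_gt0.
have s16 : (0 < 16 ^ j)%N by rewrite expn_gt0.
have sR0 : 0 < (16 ^ j)%:R :> R by rewrite ltr0n.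
case: (leqP j1 j) => hj /=.
  have -> : (j1 - j = 0)%N by apply/eqP; rewrite subn_eq0.
  rewrite addn0; set i := (j - j1)%N.
  have sE : (16 ^ j)%:R = 16 ^+ i * (16 ^ j1)%:R :> R.
    by rewrite -natrX -natrM -expnD subnK.
  have i0 : 0 < (16 : R) ^+ i by rewrite exprn_gt0.
  have i1 : 1 <= (16 : R) ^+ i by rewrite exprn_ege1 // ler1n.
  have sge : 16 ^+ i * (2 * (n ^+ d * u)) <= (16 ^ j)%:R by rewrite sE ler_pM2l.
  have nu1 : 1 <= n / u by rewrite ler_pdivlMr // mul1r (le_trans u1).
  have ndu1 : 1 <= n ^+ d / u by rewrite ler_pdivlMr // mul1r (le_trans u1) // exprn_ege1.
  (* [Q] is about [n / u] so that [Q 16^j >= 2 N]; [S] of order [n^d / u] and [z] about [u n] give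
     [S (z + 1) >= N]. *)
  pose Q := (Num.truncn (n / u)).+1.
  have Qb : n / u <= Q%:R <= 2 * (n / u).
    have h0 : 0 <= n / u by apply: le_trans nu1.
    have /andP[h1 h2] := truncn_itv h0.
    rewrite /Q (ltW h2) /= -[(_.+1)%:R]natr1; lra.
  pose S := (Num.truncn (8 * (n ^+ d / u))).+1.
  have Sb : 8 * (n ^+ d / u) <= S%:R <= 16 * (n ^+ d / u).
    have h0 : 0 <= 8 * (n ^+ d / u) by lra.
    have /andP[h1 h2] := truncn_itv h0.
    rewrite /S (ltW h2) /= -[(_.+1)%:R]natr1; lra.
  pose z := Num.truncn (u * n).
  have un0 : 0 <= u * n by rewrite mulr_ge0 // ltW.
  have /andP[z1 z2] := truncn_itv un0; rewrite -/z in z1 z2.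
  have Qs : (2 * N <= Q * 16 ^ j)%N.
    rewrite -(ler_nat R) !natrM -nN.
    have /andP[h1 _] := Qb.
    apply: (@le_trans _ _ (n / u * (2 * (n ^+ d * u)))).
      have -> : n / u * (2 * (n ^+ d * u)) = 2 * n ^+ d.+1 by rewrite exprS; field; lra.
      by [].
    apply: ler_pM => //; first by apply: le_trans nu1.
      by rewrite !mulr_ge0 // ltW.
    apply: le_trans sge; rewrite ler_peMl // !mulr_ge0 // ltW //.
  have NS : (N <= S * z.+1)%N.
    rewrite -(ler_nat R) natrM -nN.
    have /andP[h1 _] := Sb.
    apply: (@le_trans _ _ (n ^+ d / u * (u * n))).
      by rewrite mulrA mulfVK ?gt_eqF // exprSr.
    apply: ler_pM => //; [by apply: le_trans ndu1 | lra | exact: ltW].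
  set F : R := #|_|%:R.
  have hF : F * (16 ^ j)%N%:R ^+ 2 <= m * (3 * z%:R) ^+ d * (16 ^ j)%N%:R
       + 2 * (total_walks (@coord d N) X S Q 1)%:R.
    rewrite /F /m -natrM -!natrX -!natrM -natrD ler_nat.
    exact: card_block_family_walks.
  have mle : #|X|%:R <= u ^+ E * n ^+ (d * d.+1) by rewrite /u -exprM -mE.
  have := hC _ (@coord d N) X S Q n u (@coord_inj d N) _ n1 Qb Sb mle; rewrite u0 u1 => /(_ isT).
  rewrite -/m; set W : R := (total_walks _ _ _ _ _)%:R in hF * => hW.
  set s : R := (16 ^ j)%:R in sR0 sE sge hF *.
  have FB : F <= m * C2 / 16 ^+ i.
    have s2 : 0 < s ^+ 2 by rewrite exprn_gt0.
    rewrite -(ler_pM2r s2). apply: le_trans hF _.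
    have p1 : m * (3 * z%:R) ^+ d * s <= m * 3 ^+ d / 16 ^+ i * s ^+ 2.
      rewrite expr2 mulrA ler_wpM2r ?(ltW sR0) // -!mulrA ler_wpM2l //.
      rewrite exprMn ler_wpM2l ?exprn_ge0 //.
      apply: (@le_trans _ _ ((u * n) ^+ d)); first by rewrite lerXn2r ?nnegrE.
      rewrite [leRHS]mulrC ler_pdivlMr //.
      apply: le_trans sge; rewrite [leLHS]mulrC ler_pM2l // exprMn [X in _ <= 2 * X]mulrC.
      have ud : u ^+ d <= u by rewrite -[leRHS]expr1 ler_wiXn2l // ltW.
      have : u ^+ d * n ^+ d <= u * n ^+ d by rewrite ler_pM2r.
      have : 0 <= u * n ^+ d by rewrite mulr_ge0 // ltW.
      lra.
    have p2 : 2 * W <= m * C / 16 ^+ i * s ^+ 2.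
      apply: (@le_trans _ _ (m * C / 16 ^+ i * (16 ^+ i * (2 * (n ^+ d * u))) ^+ 2)); last first.
        rewrite ler_wpM2l ?mulr_ge0 ?invr_ge0 ?(ltW C0) ?(ltW i0) //.
        by rewrite lerXn2r ?nnegrE ?(ltW sR0) // !mulr_ge0 // ltW.
      have -> : m * C / 16 ^+ i * (16 ^+ i * (2 * (n ^+ d * u))) ^+ 2 =
         16 ^+ i * 2 * (2 * (C * m * n ^+ (2 * d) * u ^+ 2)).
        rewrite mul2n -addnn exprD; field; lra.
      have h1 : 2 * W <= 2 * (C * m * n ^+ (2 * d) * u ^+ 2) by rewrite ler_pM2l.
      have h2 : 0 <= 2 * (C * m * n ^+ (2 * d) * u ^+ 2).
        by rewrite !mulr_ge0 ?exprn_ge0 // ltW.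
      by apply: le_trans h1 _; rewrite ler_peMl // (le_trans i1) // ler_peMr ?(ltW i0) // ler1n.
    by rewrite /C2 [m * (_ + _)]mulrDr [(_ + _) / _]mulrDl [leRHS]mulrDl; apply: lerD.
  have cst : 0 <= c1 / (kappa / 8 ^+ i) ^+ 1.
    by rewrite expr1 divr_ge0 // divr_ge0 ?exprn_ge0 // ltW.
  apply: le_trans (ler_wpM2r cst FB) _.
  (* The block count falls like [16^-i] while the cost of one block grows like [8^i]. *)
  have -> : m * C2 / 16 ^+ i * (c1 / (kappa / 8 ^+ i) ^+ 1) = m * (C2 * c1) / kappa * 2^-1 ^+ i.
    rewrite expr1 (_ : 16 = 8 * 2); last by ring.
    rewrite exprMn exprVn.
    have h8 : (8 : R) ^+ i != 0 by rewrite expf_neq0 // pnatr_eq0.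
    have h2 : (2 : R) ^+ i != 0 by rewrite expf_neq0 // pnatr_eq0.
    by field; rewrite h8 h2 gt_eqF.
  rewrite ler_wpM2r ?(ltW (cub0 _)) // ler_wpM2r ?invr_ge0 ?(ltW k0) // ler_wpM2l //.
  by rewrite -addrA lerDl addr_ge0 // mulr_ge0 // exprn_ge0.
have -> : (j - j1 = 0)%N by apply/eqP; rewrite subn_eq0 ltnW.
rewrite add0n; set i := (j1 - j)%N.
have i0 : 0 < (16 : R) ^+ i by rewrite exprn_gt0.
have sE : (16 ^ j1)%:R = 16 ^+ i * (16 ^ j)%:R :> R.
  by rewrite -natrX -natrM -expnD subnK // ltnW.
set F : R := #|_|%:R.
have hF : F * (16 ^ j)%N%:R ^+ d.+1 <= m * (6 * N%:R) ^+ d.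
  by rewrite /F /m -natrM -!natrX -!natrM ler_nat; apply: card_block_family.
set s : R := (16 ^ j)%:R in sR0 sE hF *.
pose w : R := 2 ^+ i / v.
have w0 : 0 < w by rewrite divr_gt0 // exprn_gt0.
have w4 : w ^+ 4 = 16 ^+ i / u.
  have -> : (16 : R) = 2 ^+ 4 by ring.
  by rewrite expr_div_n -!exprM [(i * 4)%N]mulnC.
have nsw : n ^+ d <= w ^+ 4 * s.
  rewrite w4 mulrAC -sE ler_pdivlMr //.
  have h : 0 <= n ^+ d * u by rewrite mulr_ge0 // ltW.
  rewrite -/u in hj1; lra.
have FB : F <= m * 6 ^+ d * w ^+ (4 * d.+1).
  have sd : 0 < s ^+ d.+1 by rewrite exprn_gt0.
  rewrite -(ler_pM2r sd); apply: le_trans hF _.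
  rewrite exprMn -nN -!mulrA ler_wpM2l // ler_wpM2l ?exprn_ge0 //.
  rewrite [in leRHS]exprM -exprMn -exprM mulnC exprM lerXn2r ?nnegrE ?(ltW nd0) //.
  by rewrite mulr_ge0 ?exprn_ge0 // ltW.
(* The choice [q = 2 d + 3] makes the exponent of the cost exceed by one the exponent [4 (d + 1)] of
   [w] in the block count; the spare factor [1 / w] gives the decay [2^-i]. *)
have -> : (2 * (2 * d + 3)).-1 = (4 * d.+1).+1.
  by clear; lia.
have -> : kappa * 2 ^+ i / v = kappa * w by rewrite mulrA.
have kw0 : 0 < kappa * w by rewrite mulr_gt0.
have cst : 0 <= c2 / (kappa * w) ^+ (4 * d.+1).+1.
  by rewrite divr_ge0 // exprn_ge0 // ltW.
apply: le_trans (ler_wpM2r cst FB) _.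
have wi : w^-1 <= 2^-1 ^+ i.
  by rewrite /w invfM invrK exprVn ler_piMr // invr_ge0 exprn_ge0.
have kp : kappa <= kappa ^+ (4 * d.+1).+1 by rewrite -{1}[kappa]expr1 ler_weXn2l.
apply: (@le_trans _ _ (m * (6 ^+ d * c2) / kappa * w^-1)); last first.
  apply: ler_pM => //; first by rewrite !mulr_ge0 ?exprn_ge0 ?invr_ge0 // ltW.
    by rewrite invr_ge0 ltW.
  rewrite ler_wpM2r ?invr_ge0 ?(ltW k0) // ler_wpM2l //.
  by rewrite addrAC lerDr addr_ge0 // mulr_ge0 // ltW.
rewrite [(kappa * w) ^+ _]exprMn (exprS w (4 * d.+1)).
set kk := kappa ^+ (4 * d.+1).+1 in kp *; set ww := w ^+ (4 * d.+1).
have kk0 : 0 < kk by rewrite exprn_gt0.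
have ww0 : ww != 0 by rewrite expf_neq0 // gt_eqF.
have -> : m * 6 ^+ d * ww * (c2 / (kk * (w * ww))) = m * (6 ^+ d * c2) / kk * w^-1.
  by field; rewrite ww0 !gt_eqF.
rewrite ler_wpM2r ?invr_ge0 ?(ltW w0) // ler_wpM2l ?mulr_ge0 ?exprn_ge0 //.
by rewrite lef_pV2 ?posrE.
Qed.

End PartialStep.

Lemma block_family_sub d N (X : {set point d N}) s B : B \in block_family X s ->
  B \subset X /\ #|B| = s.
Proof.
move=> /bigcupP[b _ /imsetP[x]]; rewrite inE => /andP[xX /eqP cB] ->; split=> //.
by apply/subsetP => y; apply: block_sub.
Qed.

(** * One round of partial coloring with a density gain *)

Section Step.
Variables (R : realType) (d : nat).
Hypothesis d0 : (0 < d)%N.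
Local Notation E := (density_exponent d).

Lemma partial_step : exists2 C : R, 0 < C &
  forall N (X : {set point d N}) (n v y : R), (0 < N)%N -> X != set0 ->
   1 <= n -> 0 < v <= 1 -> 0 < y -> n ^+ d.+1 = N%:R -> y ^+ 2 = n ^+ d ->
   #|X|%:R = v ^+ (4 * E) * n ^+ (d * d.+1) ->
   exists h : point d N -> int,
    [/\ forall x, h x = 0 \/ x \in X /\ (h x = 1 \/ h x = -1),
       (#|X| <= 16 * #|[set x in X | h x != 0]|)%N &
       forall A, is_AP A -> `|\sum_(x in A) h x|%:~R <= C * y * v].
Proof.
have [K0 K00 hK] := block_cost_bound R d0.
(* The two-sided sum of the costs is at most [3 |X| K0 / kappa], which must not exceed [|X| / 4]. *)
pose kappa := 12 * K0 + 1.
have k1 : 1 <= kappa by rewrite /kappa; lra.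
have k0 : 0 < kappa by apply: lt_le_trans k1.
(* [540 = 30 * 3 * 6]: the blocks of a progression, the two-sided geometric sum, and the bound
   [6 y v^2] for [4^j1]. *)
exists (540 * kappa); first by rewrite mulr_gt0.
move=> N X n v y N0 Xn0 n1 /andP[v0 v1] y0 nN yn mE.
have vb : 0 < v <= 1 by rewrite v0.
have n0 : 0 < n by apply: lt_le_trans n1.
have m0 : (0 < #|X|)%N by rewrite card_gt0.
have E0 : (0 < E)%N by rewrite /density_exponent !muln_gt0 expn_gt0 addn_gt0 orbT.
pose x := n ^+ d * v ^+ 4.
have x0 : 0 < x by rewrite mulr_gt0 // exprn_gt0.
(* As [E >= d + 1] and [n >= 1], the power [x^E] is at least [|X|], hence at least 1. *)
have x1 : 1 <= x.
  rewrite -(ler_pXn2r E0) ?nnegrE ?(ltW x0) // expr1n /x exprMn -exprM.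
  apply: (@le_trans _ _ #|X|%:R); first by rewrite ler1n.
  rewrite mE mulrC -exprM ler_pM2r ?exprn_gt0 // ler_weXn2l // leq_mul2l.
  apply/orP; right; rewrite /density_exponent mulnC mulnA.
  by rewrite leq_pmull // muln_gt0 addn_gt0 orbT expn_gt0.
have [j1 /andP[hj1 hj1']] := exists_scale x1.
pose lam j := if (j1 <= j)%N then kappa / 8 ^+ (j - j1) else kappa * 2 ^+ (j1 - j) / v.
pose q j := if (j1 <= j)%N then 1%N else (2 * d + 3)%N.
have cost j := hK N X n v kappa j1 j n1 vb k1 nN mE hj1.
have lam0 j : 0 < lam j.
  by rewrite /lam; case: ifP => _; rewrite ?divr_gt0 ?mulr_gt0 ?exprn_gt0.
pose T' := {z : point d N | z \in X}.
(* A block of size [16^j] inside [X] forces [j < |X|], so this finite type indexes the blocks of all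
   sizes. *)
pose I := {p : 'I_#|X| * {set point d N} | p.2 \in block_family X (16 ^ p.1)}.
pose S (i : I) : {set T'} := [set z | val z \in (val i).2].
have cT : #|{: T'}| = #|X| by rewrite card_sig.
have cS (i : I) : #|S i| = (16 ^ (val i).1)%N.
  have [BX cB] := block_family_sub (valP i).
  rewrite -[RHS]cB -(card_imset _ val_inj); apply: eq_card => z.
  apply/imsetP/idP => [[w]|zB]; first by rewrite inE => h ->.
  by exists (exist _ z (subsetP BX _ zB)) => //; rewrite inE.
have p4 j : 0 < (4 : R) ^+ j by rewrite exprn_gt0.
have [] := @partial_coloring R T' I S (fun i => lam (val i).1) (fun i => (4 ^+ (val i).1)^-1)
   (fun i => q (val i).1).
- by rewrite cT.
- by move=> i; apply: lam0.
- by move=> i; rewrite invr_gt0.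
- move=> i; rewrite cS exprVn -exprM mulnC exprM natrX.
  have -> : (4 : R) ^+ 2 = 16 by ring.
  by rewrite mulVf // expf_neq0 // pnatr_eq0.
- by move=> i; rewrite /q; case: ifP => // _; rewrite addn_gt0 orbT.
- rewrite cT.
  have -> : \sum_(i : I) cost_const R (q (val i).1) / lam (val i).1 ^+ (2 * q (val i).1).-1 =
    \sum_(j < #|X|) #|block_family X (16 ^ j)|%:R * (cost_const R (q j) / lam j ^+ (2 * q j).-1).
    transitivity (\sum_(j < #|X|) \sum_(B in block_family X (16 ^ j))
        cost_const R (q j) / lam j ^+ (2 * q j).-1); last first.
      by apply: eq_bigr => j _; rewrite sumr_const -[LHS]mulr_natl.
    rewrite pair_big_dep /=.
    rewrite [RHS](reindex_omap val (insub : _ -> option I)) /=; last first.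
      by move=> p hp; rewrite insubT.
    by apply: eq_bigl => i; rewrite valK eqxx andbT (valP i).
  apply: le_trans (ler_sum _ (fun (j : 'I__) _ => cost j)) _.
  rewrite -mulr_sumr.
  have P0 : 0 <= #|X|%:R * K0 / kappa by rewrite !mulr_ge0 ?invr_ge0 // ltW.
  apply: le_trans (ler_wpM2l P0 (sum_two_sided R j1 #|X|)) _.
  have -> : #|X|%:R * K0 / kappa * 3 = #|X|%:R * (K0 / kappa * 3) by rewrite !mulrA.
  rewrite ler_wpM2l // -mulrAC ler_pdivrMr // /kappa.
  by move: K00; clear; lra.
move=> f [g [far disc]].
(* Half the difference of the two colorings: it takes the values 0, 1, -1, and vanishes exactly
   where they agree or outside [X]. *)
pose h z : int := if insub z is Some w then
   (if f (w : T') == g w then 0 else sgn (f w)) else 0.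
have hval (w : T') : h (val w) = if f w == g w then 0 else sgn (f w) by rewrite /h valK.
have hout z : z \notin X -> h z = 0 by move=> zX; rewrite /h insubN.
exists h; split.
- move=> z; rewrite /h; case: insubP => [w wX <-|_]; last by left.
  case: (f w == g w); first by left.
  by right; split; rewrite ?(valP w) //; case: (f w); [right|left].
- rewrite -{1}cT; apply: leq_trans far _; rewrite leq_mul2l /=.
  rewrite -(card_imset _ val_inj); apply: subset_leq_card; apply/subsetP => z /imsetP[w].
  rewrite inE => fg ->; rewrite inE (valP w) hval (negbTE fg); by case: (f w).
move=> A APA; have [b [a [l [bn l0 inbox ->]]]] := is_AP_dir N0 APA.
pose D j := lam j * 4 ^+ j.
have D0 j : 0 <= D j by rewrite mulr_ge0 // ltW.
have suph (B : {set point d N}) : \sum_(z in B) h z = \sum_(z in B :&: X) h z.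
  rewrite [LHS](bigID (mem X)) /= [X in _ + X]big1 ?addr0; last by move=> z /andP[_ /hout].
  by apply: eq_bigl => z; rewrite inE.
have hD j B : B \in blocks (dirv b) X (16 ^ j) -> `|\sum_(z in B) h z|%:~R <= D j.
  move=> Bb.
  have BF : B \in block_family X (16 ^ j) by apply/bigcupP; exists b.
  have [BX cB] := block_family_sub BF.
  have jX : (j < #|X|)%N.
    apply: leq_trans (ltn_expl j (isT : 1 < 16)%N) _.
    by rewrite -cB subset_leq_card.
  pose i : I := exist (fun p : 'I_#|X| * {set point d N} => p.2 \in block_family X (16 ^ p.1)) (Ordinal jX, B) BF.
  have := disc i; rewrite /= -ler_pdivlMl ?invr_gt0 // invrK => H.
  have E2 : 2 * \sum_(z in B) h z = csum f (S i) - csum g (S i).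
    rewrite (sum_subset_sub h BX) /csum -sumrB mulr_sumr.
    apply: eq_big => [w|w wB]; first by rewrite inE.
    rewrite hval; case: (f w); case: (g w) => //=.
  move: H; rewrite -E2 -intr_norm normrM intrM ger0_norm // => H.
  rewrite /D; move: H; move: (`|\sum_(z in B) h z|%:~R : R) (lam j) (4 ^+ j : R).
  by clear => z1 z2 z3; lra.
rewrite suph.
have := @AP_sum_le d N (dirv b) X (nonzero_dirP bn) R h D D0 hD a l l0 inbox.
move=> /le_trans -> //.
pose M : R := kappa * 4 ^+ j1 / v.
have DM j : D j <= M * 2^-1 ^+ ((j - j1) + (j1 - j)).
  have n4 i : (4 : R) ^+ i != 0 by rewrite expf_neq0 // pnatr_eq0.
  have n2 i : (2 : R) ^+ i != 0 by rewrite expf_neq0 // pnatr_eq0.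
  rewrite /D /lam /M; case: (leqP j1 j) => hj.
    have -> : (j1 - j = 0)%N by apply/eqP; rewrite subn_eq0.
    rewrite addn0; set i := (j - j1)%N.
    have -> : 4 ^+ j = 4 ^+ i * 4 ^+ j1 :> R by rewrite -exprD subnK.
    have -> : kappa / 8 ^+ i * (4 ^+ i * 4 ^+ j1) = kappa * 4 ^+ j1 * 2^-1 ^+ i.
      rewrite (_ : 8 = 4 * 2); last by ring.
      by rewrite [(4 * 2) ^+ i]exprMn exprVn; field; rewrite n4 n2.
    rewrite ler_wpM2r ?exprn_ge0 ?invr_ge0 // ler_pdivlMr // ler_piMr //.
    by rewrite mulr_ge0 ?exprn_ge0 // ltW.
  have -> : (j - j1 = 0)%N by apply/eqP; rewrite subn_eq0 ltnW.
  rewrite add0n; set i := (j1 - j)%N.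
  have -> : 4 ^+ j1 = 4 ^+ i * 4 ^+ j :> R by rewrite -exprD subnK // ltnW.
  rewrite le_eqVlt; apply/orP; left; apply/eqP.
  have -> : 4 ^+ i = 2 ^+ i * 2 ^+ i :> R by rewrite -exprMn; congr (_ ^+ _); ring.
  by rewrite exprVn; field; rewrite n2 gt_eqF.
have M0 : 0 <= M by rewrite /M !mulr_ge0 ?exprn_ge0 ?invr_ge0 // ltW.
have S1 : \sum_(j < #|X|) D j <= M * 3.
  apply: le_trans (ler_sum _ (fun (j : 'I__) _ => DM j)) _.
  by rewrite -mulr_sumr ler_wpM2l // sum_two_sided.
(* Square root of [16^j1 < 32 y^2 v^4], with 32 rounded up to the square 36. *)
have J4 : 4 ^+ j1 <= 6 * y * v ^+ 2.
  have c0 : 0 <= 6 * y * v ^+ 2 by rewrite !mulr_ge0 ?exprn_ge0 // ltW.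
  rewrite -(ler_pXn2r (isT : 0 < 2)%N) ?nnegrE ?exprn_ge0 //.
  rewrite -exprM mulnC exprM (_ : 4 ^+ 2 = 16); last by ring.
  rewrite -natrX; apply: le_trans (ltW hj1') _.
  have -> : (6 * y * v ^+ 2) ^+ 2 = 36 * (y ^+ 2 * v ^+ 4) by ring.
  by rewrite yn -/x ler_pM2r // ler_nat.
have MB : M <= 6 * kappa * y * v.
  rewrite /M ler_pdivrMr //.
  have -> : 6 * kappa * y * v * v = kappa * (6 * y * v ^+ 2) by ring.
  by rewrite ler_pM2l.
move: S1 MB; move: (\sum_(j < #|X|) D j) => s; clear; nra.
Qed.

End Step.

Lemma exists_root (R : realType) (a : R) k : 0 <= a -> (0 < k)%N -> exists2 r : R, 0 <= r & r ^+ k = a.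
Proof.
move=> a0 k0; exists (a `^ k%:R^-1); first exact: powR_ge0.
by rewrite -powR_mulrn ?powR_ge0 // -powRrM mulVf ?powRr1 // pnatr_eq0 -lt0n.
Qed.

(** * Iteration to a full coloring *)

Section Full.
Variables (R : realType) (d : nat).
Hypothesis d0 : (0 < d)%N.
Local Notation E := (density_exponent d).

(** Each round colors at least a sixteenth of [X], so [v] shrinks at least by
    [th = (15/16)^(1/(4E)) < 1], and the errors sum to a geometric series with factor
    [1 / (1 - th)]. *)
Lemma full_coloring : exists2 C : R, 0 < C &
  forall N (n y : R), (0 < N)%N -> 1 <= n -> 0 < y -> n ^+ d.+1 = N%:R -> y ^+ 2 = n ^+ d ->
  forall (X : {set point d N}) (v : R), 0 <= v -> #|X|%:R = v ^+ (4 * E) * n ^+ (d * d.+1) ->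
  exists chi : {ffun point d N -> bool}, forall A, is_AP A ->
    `|\sum_(x in A :&: X) sgn (chi x)|%:~R <= C * y * v.
Proof.
have [C0 C00 hC] := partial_step R d0.
have E0 : (0 < 4 * E)%N.
  by rewrite muln_gt0 /density_exponent !muln_gt0 expn_gt0 addn_gt0 orbT.
have [||th th0 thE] := @exists_root R (15 / 16) (4 * E) => //; first by rewrite divr_ge0.
have th1 : th < 1.
  rewrite -(ltr_pXn2r E0) ?nnegrE // thE expr1n; lra.
have C1 : 0 < C0 / (1 - th) by rewrite divr_gt0 // subr_gt0.
exists (C0 / (1 - th)) => // N n y N0 n1 y0 nN yn X.
have n0 : 0 < n by apply: lt_le_trans n1.
have nd0 : 0 < n ^+ (d * d.+1) by rewrite exprn_gt0.
have [k] := ubnP #|X|; elim: k X => // k IH X kX v v0 vE.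
case: (eqVneq X set0) => [X0|Xn0].
  exists [ffun=> false] => A _; rewrite X0 setI0 big_set0 normr0.
  exact: mulr_ge0 (mulr_ge0 (ltW C1) (ltW y0)) v0.
have X0 : (0 < #|X|)%N by rewrite card_gt0.
have vp : 0 < v.
  rewrite lt_neqAle v0 andbT eq_sym; apply/eqP => v00; move: vE; rewrite v00 expr0n.
  rewrite gtn_eqF // mul0r => /eqP; rewrite pnatr_eq0 => /eqP XX; by rewrite XX in X0.
have v1 : v <= 1.
  rewrite -(ler_pXn2r E0) ?nnegrE // expr1n -(ler_pM2r nd0) -vE mul1r.
  rewrite mulnC exprM nN -natrX ler_nat.
  by apply: leq_trans (max_card _) _; rewrite card_ffun !card_ord.
have [|h [h1 h2 h3]] := hC N X n v y N0 Xn0 n1 _ y0 nN yn vE; first by rewrite vp.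
pose X' := X :\: [set x in X | h x != 0].
have cX' : (#|X'| + #|[set x in X | h x != 0]| = #|X|)%N.
  rewrite /X' cardsD (setIidPr _); last by apply/subsetP => x; rewrite inE => /andP[].
  by rewrite subnK // subset_leq_card //; apply/subsetP => x; rewrite inE => /andP[].
have X'X : (16 * #|X'| <= 15 * #|X|)%N /\ (#|X'| < k)%N.
  move: cX' h2 kX X0; move: #|X'| #|[set x in X | h x != 0]| #|X|; clear => a b c.
  by split; lia.
have {X'X} [X'X X'k] := X'X.
have [||v' v'0 v'E] := @exists_root R (#|X'|%:R / n ^+ (d * d.+1)) (4 * E) => //.
  by rewrite divr_ge0 // ltW.
have v'v : v' <= th * v.
  rewrite -(ler_pXn2r E0) ?nnegrE ?mulr_ge0 // exprMn thE v'E ler_pdivrMr // -mulrA -vE.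
  have : (16 * #|X'|)%:R <= (15 * #|X|)%:R :> R by rewrite ler_nat.
  rewrite !natrM; move: (#|X'|%:R : R) (#|X|%:R : R); clear => a b; lra.
have [|chi' hchi'] := IH X' X'k v' v'0; first by rewrite v'E divfK // gt_eqF.
(* [sgn] sends [true] to -1, so the newly colored points receive the boolean [h x == -1]. *)
exists [ffun x => if h x == 0 then chi' x else h x == -1] => A APA.
have -> : \sum_(x in A :&: X) sgn ([ffun x => if h x == 0 then chi' x else h x == -1] x) =
  \sum_(x in A) h x + \sum_(x in A :&: X') sgn (chi' x).
  rewrite big_mkcond [X in X + _]big_mkcond [X in _ + X]big_mkcond -big_split /=.
  apply: eq_bigr => x _; rewrite ffunE !inE.
  case: (x \in A) => //=; case: (h1 x) => [hx|[xX hx]].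
    by rewrite hx eqxx /= andbF add0r.
  by rewrite xX; case: hx => ->.
have H1 := h3 A APA; have H2 := hchi' A APA.
apply: (@le_trans _ _ (C0 * y * v + C0 / (1 - th) * y * (th * v))).
  rewrite (le_trans (y := `|\sum_(x in A) h x|%:~R + `|\sum_(x in A :&: X') sgn (chi' x)|%:~R)) //.
    by rewrite -intrD ler_int ler_normD.
  apply: lerD => //; apply: le_trans H2 _.
  by rewrite ler_wpM2l // mulr_ge0 // ltW.
rewrite le_eqVlt; apply/orP; left; apply/eqP.
by field; rewrite subr_eq0 gt_eqF.
Qed.

End Full.

Lemma bigminn_le (I : eqType) (r : seq I) (F : I -> nat) x0 i : i \in r ->
  (\big[minn/x0]_(j <- r) F j <= F i)%N.
Proof.
elim: r => // j r IH; rewrite inE big_cons => /orP[/eqP <-|/IH h]; first exact: geq_minl.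
exact: leq_trans (geq_minr _ _) h.
Qed.

Lemma disc_AP_le (R : realType) d N (chi : {ffun point d N -> bool}) (c : R) : 0 <= c ->
  (forall A, is_AP A -> `|chi_sum chi A|%:~R <= c) -> (disc_AP d N)%:R <= c.
Proof.
move=> c0 H.
apply: (@le_trans _ _ (\max_(A : {set point d N} | `[< is_AP A >]) `|chi_sum chi A|%N)%:R).
  rewrite ler_nat; exact: (@bigminn_le _ _ (fun chi => \max_(A : {set point d N} | `[< is_AP A >]) `|chi_sum chi A|%N) _ chi (mem_index_enum _)).
elim/big_ind: _ => // [x y hx hy|A /asboolP APA].
  by rewrite /maxn; case: ifP.
by have := H A APA; rewrite -abszE pmulrn.
Qed.

Lemma disc_AP_upper (R : realType) d : (0 < d)%N -> exists2 C : R, 0 < C &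
  forall N (y : R), (0 < N)%N -> 0 < y -> y ^+ (2 * d.+1) = N%:R ^+ d ->
  (disc_AP d N)%:R <= C * y.
Proof.
move=> d0; have [C C0 hC] := full_coloring R d0; exists C => // N y N0 y0 yE.
have [||n n0 nN] := @exists_root R N%:R d.+1 => //.
have n1 : 1 <= n.
  by rewrite -(ler_pXn2r (isT : 0 < d.+1)%N) ?nnegrE // expr1n nN ler1n.
have yn : y ^+ 2 = n ^+ d.
  apply/eqP; rewrite -(eqrXn2 (isT : 0 < d.+1)%N) ?exprn_ge0 ?(ltW y0) //.
  by rewrite -!exprM yE -nN -exprM mulnC.
have [||chi hchi] := hC N n y N0 n1 y0 nN yn setT 1 => //.
  by rewrite expr1n mul1r mulnC exprM nN cardsT card_ffun !card_ord natrX.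
apply: (disc_AP_le (chi := chi)) => [|A APA]; first by rewrite mulr_ge0 // ltW.
by have := hchi A APA; rewrite setIT mulr1.
Qed.

(** * Lower bound *)

Section Parseval.
Variables (R : realType) (M : nat).
Hypothesis M0 : (0 < M)%N.

Definition angle (z : int) : R := 2 * pi * z%:~R / M%:R.

Lemma angleD z w : angle (z + w) = angle z + angle w.
Proof. by rewrite /angle intrD mulrDr mulrDl. Qed.

Lemma angleB z w : angle (z - w) = angle z - angle w.
Proof. by rewrite /angle intrB mulrBr mulrBl. Qed.

Lemma angle_period (q : nat) : angle (M%:Z * q%:Z) = (pi *+ 2) *+ q.
Proof.
rewrite /angle intrM -!pmulrn -[RHS]mulr_natr -[pi *+ 2]mulr_natl.
by field; rewrite pnatr_eq0 -lt0n.
Qed.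

Lemma cos_angle_mod z : cos (angle z) = cos (angle (z %% M)%Z).
Proof.
have P (q : nat) w : cos (angle (w + M%:Z * q%:Z)) = cos (angle w).
  by rewrite angleD angle_period (periodicn (@cosD2pi R)).
rewrite {1}(divz_eq z M) addrC mulrC; case: (z %/ M)%Z => q; first exact: P.
by rewrite NegzE mulrN -[LHS](P q.+1) subrK.
Qed.

Lemma cos_angle_lt1 z : ~~ (M %| z)%Z -> cos (angle z) < 1.
Proof.
move=> Mz; rewrite cos_angle_mod.
have MZ : M%:Z != 0 by rewrite eqz_nat -lt0n.
have zlt := ltz_pmod z (_ : 0 < M%:Z); have zge := modz_ge0 z MZ.
have z0 : (z %% M)%Z != 0 by apply: contra Mz => /eqP h; apply/dvdz_mod0P.
set w := (z %% M)%Z in zlt zge z0 *.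
have h : 0 < angle w / 2 < pi.
  have -> : angle w / 2 = pi * (w%:~R / M%:R) by rewrite /angle; field; rewrite pnatr_eq0 -lt0n.
  have w0 : 0 < (w%:~R : R) by rewrite ltr0z lt_neqAle eq_sym z0.
  have MR : 0 < (M%:R : R) by rewrite ltr0n.
  rewrite mulr_gt0 ?pi_gt0 ?divr_gt0 //= -[ltRHS]mulr1 ltr_pM2l ?pi_gt0 // ltr_pdivrMr // mul1r.
  by rewrite [ltRHS]pmulrn ltr_int; apply: zlt.
have := sin_gt0_pi h => s0.
have -> : angle w = angle w / 2 *+ 2 by rewrite -mulr_natr; field.
rewrite cos_mulr2n cos2sin2.
have : 0 < sin (angle w / 2) ^+ 2 by rewrite exprn_gt0.
rewrite -mulr_natr; lra.
Qed.

(** If [M] does not divide [k], shifting the index leaves the vector [(Cs, Ss)] unchanged but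
    rotates it by [angle k], which is not a multiple of a full turn; so the vector is 0. *)
Lemma sum_cos_angle (k : int) :
  \sum_(r < M) cos (angle ((r : nat)%:Z * k)) = M%:R * (M %| k)%Z%:R.
Proof.
case: (boolP (M %| k)%Z) => Mk.
  rewrite mulr1 (eq_bigr (fun=> 1)); first by rewrite sumr_const card_ord.
  move=> r _; rewrite cos_angle_mod.
  have /dvdz_mod0P -> : (M %| (r : nat)%:Z * k)%Z by rewrite dvdz_mull.
  by rewrite /angle mulr0 mul0r cos0.
rewrite mulr0.
have c1 := cos_angle_lt1 Mk.
pose Cs := \sum_(0 <= r < M) cos (angle (r%:Z * k)).
pose Ss := \sum_(0 <= r < M) sin (angle (r%:Z * k)).
have cM : cos (angle (M%:Z * k)) = 1.
  rewrite cos_angle_mod.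
  have /dvdz_mod0P -> : (M %| M%:Z * k)%Z by rewrite dvdz_mulr.
  by rewrite /angle mulr0 mul0r cos0.
have sM : sin (angle (M%:Z * k)) = 0.
  have := cos2Dsin2 (angle (M%:Z * k)); rewrite cM expr1n => /eqP.
  by rewrite -[X in _ == X]addr0 (inj_eq (addrI 1)) sqrf_eq0 => /eqP.
have a0 : angle (0%:Z * k) = 0 by rewrite /angle mul0r mulr0 mul0r.
have stepA r : angle (r.+1%:Z * k) = angle (r%:Z * k) + angle k.
  by rewrite -angleD; congr angle; rewrite -addn1 PoszD mulrDl mul1r.
have shC : Cs = \sum_(0 <= r < M) cos (angle (r.+1%:Z * k)).
  have : \sum_(0 <= r < M.+1) cos (angle (r%:Z * k)) = \sum_(0 <= r < M) cos (angle (r%:Z * k)) + cos (angle (M%:Z * k)).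
    by rewrite big_nat_recr.
  rewrite big_nat_recl //=.
  by rewrite a0 cos0 cM [RHS]addrC => /addrI.
have shS : Ss = \sum_(0 <= r < M) sin (angle (r.+1%:Z * k)).
  have : \sum_(0 <= r < M.+1) sin (angle (r%:Z * k)) = \sum_(0 <= r < M) sin (angle (r%:Z * k)) + sin (angle (M%:Z * k)).
    by rewrite big_nat_recr.
  rewrite big_nat_recl //=.
  by rewrite a0 sin0 sM add0r addr0.
have eC : Cs = Cs * cos (angle k) - Ss * sin (angle k).
  rewrite {1}shC; under eq_bigr => r _ do rewrite stepA cosD.
  by rewrite sumrB -!mulr_suml.
have eS : Ss = Ss * cos (angle k) + Cs * sin (angle k).
  rewrite {1}shS; under eq_bigr => r _ do rewrite stepA sinD.
  by rewrite big_split /= -!mulr_suml.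
have -> : \sum_(r < M) cos (angle ((r : nat)%:Z * k)) = Cs by rewrite /Cs big_mkord.
have cs := cos2Dsin2 (angle k).
move: c1 eC eS cs; clear shC shS; move: Cs Ss (cos (angle k)) (sin (angle k)); clear => C S c s c1 eC eS cs.
have : (2 - 2 * c) * C = 0.
  have -> : (2 - 2 * c) * C = (1 - c) * (C - C * c + S * s) + s * (C * s - (S - S * c)) + C * (1 - c ^+ 2 - s ^+ 2).
    ring.
  have e1 : C - C * c + S * s = 0 by rewrite {1}eC; ring.
  have e2 : C * s - (S - S * c) = 0 by clear -eS; lra.
  have e3 : 1 - c ^+ 2 - s ^+ 2 = 0 by rewrite -cs; ring.
  by rewrite e1 e2 e3 !mulr0 !addr0.
move/eqP; rewrite mulf_eq0 => /orP[/eqP h|/eqP //]; lra.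
Qed.

Variables (J : finType) (a : J -> R) (pos : J -> int).

(** The squared modulus of the Fourier coefficient at [r] of the masses [a j] placed at [pos j]. *)
Definition energy (r : nat) : R :=
  (\sum_j a j * cos (angle (r%:Z * pos j))) ^+ 2 + (\sum_j a j * sin (angle (r%:Z * pos j))) ^+ 2.

Lemma parseval :
  \sum_(r < M) energy r =
  M%:R * \sum_(y < M) (\sum_(j | (M %| pos j - (y : nat)%:Z)%Z) a j) ^+ 2.
Proof.
have lhs (r : nat) : energy r = \sum_j \sum_j' a j * a j' * cos (angle (r%:Z * (pos j - pos j'))).
  rewrite /energy !expr2 !big_distrl /= -big_split /=; apply: eq_bigr => j _.
  rewrite !big_distrr /= -big_split /=; apply: eq_bigr => j' _.
  by rewrite mulrBr angleB cosB; ring.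
under eq_bigr => r _ do rewrite lhs.
rewrite exchange_big mulr_sumr /=.
have rhs (y : 'I_M) : M%:R * (\sum_(j | (M %| pos j - (y : nat)%:Z)%Z) a j) ^+ 2 =
   \sum_j \sum_j' a j * a j' * (M%:R * ((M %| pos j - (y : nat)%:Z)%Z && (M %| pos j' - (y : nat)%:Z)%Z)%:R).
  rewrite expr2 big_mkcond big_distrl mulr_sumr /=; apply: eq_bigr => j _.
  rewrite mulrA mulr_sumr; apply: eq_bigr => j' _.
  case: (M %| pos j - _)%Z => /=; last by rewrite !(mulr0, mul0r).
  by case: (M %| pos j' - _)%Z => /=; rewrite ?(mulr0, mul0r, mulr1) //; ring.
rewrite [RHS](eq_bigr _ (fun y _ => rhs y)) [RHS]exchange_big /=; apply: eq_bigr => j _.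
rewrite exchange_big [RHS]exchange_big /=; apply: eq_bigr => j' _.
rewrite -!mulr_sumr sum_cos_angle; congr (_ * (_ * _)).
have MZ : M%:Z != 0 by rewrite eqz_nat -lt0n.
have yE : (`|(pos j %% M)%Z| < M)%N.
  have := ltz_pmod (pos j) (_ : 0 < M%:Z); have := modz_ge0 (pos j) MZ; lia.
have ydv (y : 'I_M) : (M %| pos j - (y : nat)%:Z)%Z = (y == Ordinal yE).
  rewrite -eqz_mod_dvd.
  have -> : ((y : nat)%:Z %% M)%Z = (y : nat)%:Z by rewrite modz_small //; have := ltn_ord y; lia.
  have h := modz_ge0 (pos j) MZ.
  by apply/eqP/eqP => [H|->/=]; [apply/val_inj => /=; lia | lia].
rewrite (bigD1 (Ordinal yE)) // ydv eqxx big1; last first.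
  by move=> y yn; rewrite ydv (negbTE yn).
rewrite /= addr0.
  have h := modz_ge0 (pos j) MZ.
  congr (nat_of_bool _)%:R; rewrite gez0_abs //.
  apply/idP/idP => H.
    have -> : pos j' - (pos j %% M)%Z = (pos j - (pos j %% M)%Z) - (pos j - pos j') by ring.
    rewrite rpredB // -eqz_mod_dvd modz_mod; exact/eqP.
  have -> : pos j - pos j' = (pos j - (pos j %% M)%Z) - (pos j' - (pos j %% M)%Z) by ring.
  rewrite rpredB // -eqz_mod_dvd modz_mod; exact/eqP.
Qed.

End Parseval.

Lemma pi_ge1 (R : realType) : 1 <= pi :> R.
Proof. by have := pi_ge2 R; lra. Qed.

Lemma cos_ge_cos1 (R : realType) (x : R) : `|x| <= 1 -> cos 1 <= cos x.
Proof.
move=> hx; have -> : cos x = cos `|x| by case: (ger0P x) => // _; rewrite cosN.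
have := pi_ge1 R => p1.
case: (ltrgtP `|x| 1) hx => // [h _|->//].
by apply/ltW; rewrite ltr_cos ?in_itv /= ?normr_ge0 ?ler01 // (le_trans (ltW h)).
Qed.

(* Digits in base B; B > 2 (L D + N) below, so that no progression of length L and step
   bounded by D wraps around modulo B^d (enc_eq0). *)
Definition enc (d B : nat) (w : 'I_d -> int) : int := \sum_k w k * (B ^ k)%N%:Z.

Lemma enc_lin d B (w w' : 'I_d -> int) (i : int) :
  enc B (fun k => w k + i * w' k) = enc B w + i * enc B w'.
Proof. by rewrite /enc mulr_sumr -big_split /=; apply: eq_bigr => k _; ring. Qed.

(** The lowest digit is divisible by [2 H + 1] and at most [H] in modulus, so it vanishes; dividing
    by the base leaves the same situation with one digit fewer. *)
Lemma enc_eq0 d H (w : 'I_d -> int) : (forall k, `|w k| <= H)%N ->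
  ((2 * H).+1 ^ d %| `|enc (2 * H).+1 w|)%N -> forall k, w k = 0.
Proof.
elim: d w => [|d IH] w wH hdv k; first by case: k.
set B := (2 * H).+1 in IH hdv *.
have E : enc B w = w ord0 + B%:Z * enc B (fun k => w (lift ord0 k)).
  rewrite /enc big_ord_recl expn0 mulr1; congr (_ + _); rewrite mulr_sumr.
  by apply: eq_bigr => i _; rewrite /= /bump /= add1n expnS PoszM mulrCA.
have w00 : w ord0 = 0.
  have : (B%:Z %| enc B w)%Z.
    by rewrite dvdzE; apply: dvdn_trans hdv; rewrite expnS dvdn_mulr.
  rewrite E rpredDr ?dvdz_mulr // => /dvdzP[q hq].
  have := wH ord0; rewrite hq; case: (eqVneq q 0) => [->|q0]; first by rewrite mul0r.
  have : (0 < `|q|)%N by rewrite absz_gt0.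
  by rewrite abszM absz_nat /B; nia.
case: (unliftP ord0 k) => [j ->|->//].
apply: (IH (fun k => w (lift ord0 k))) => //.
move: hdv; rewrite E w00 add0r expnS abszM absz_nat dvdn_pmul2l //.
Qed.

(** [ap_set] silently drops the terms outside the box. The box is convex, so the remaining indices
    are consecutive and can be renumbered from the first one. *)
Lemma ap_set_AP d N (a b : 'I_d -> int) l : (exists k, b k != 0) ->
  ap_set N a b l = set0 \/ is_AP (ap_set N a b l).
Proof.
move=> b0; case: (set_0Vmem (ap_set N a b l)) => [->|[p0]]; first by left.
rewrite inE => /existsP[i0 /forallP hi0]; right.
pose P i := (i < l)%N && [forall k, (1 <= a k + i%:Z * b k) && (a k + i%:Z * b k <= N%:Z)].
have PP (i : 'I_l) (p : point d N) : [forall k, coord p k == a k + (i : nat)%:Z * b k] -> P i.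
  move=> /forallP h; rewrite /P ltn_ord; apply/forallP => k; rewrite -(eqP (h k)).
  exact: coord_bound.
have exP : exists i, P i by exists i0; apply: (PP i0 p0); apply/forallP.
have leP' i : P i -> (i <= l)%N by case/andP => /ltnW.
case: (ex_minnP exP) => m Pm mmin; case: (ex_maxnP exP leP') => m' Pm' mmax.
have mm' : (m <= m')%N by apply: mmin.
exists (fun k => a k + m%:Z * b k), b, (m' - m).+1; split=> //.
  move=> i k; rewrite ltnS => im.
  have /andP[_ /forallP/(_ k)] := Pm; have /andP[_ /forallP/(_ k)] := Pm'.
  have -> : a k + m%:Z * b k + i%:Z * b k = a k + (m + i)%N%:Z * b k by rewrite PoszD; ring.
  have [j ->] : exists j, m' = (m + i + j)%N by exists (m' - m - i)%N; lia.
  move: (m + i)%N (leq_addr i m) => u mu.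
  have [v ->] : exists v, u = (m + v)%N by exists (u - m)%N; lia.
  rewrite !PoszD !mulrDl.
  case: (lerP 0 (b k)) => hb.
    have := mulr_ge0 (_ : 0 <= v%:Z) hb; have := mulr_ge0 (_ : 0 <= j%:Z) hb.
    move: (v%:Z * b k) (j%:Z * b k) (m%:Z * b k) => x1 x2 x3; lia.
  have := mulr_ge0_le0 (_ : 0 <= v%:Z) (ltW hb); have := mulr_ge0_le0 (_ : 0 <= j%:Z) (ltW hb).
  move: (v%:Z * b k) (j%:Z * b k) (m%:Z * b k) => x1 x2 x3; lia.
have /andP[m'l _] := Pm'.
apply/setP => p; rewrite !inE; apply/existsP/existsP => -[i /forallP h].
  have Pi : P i by apply: PP; apply/forallP.
  have im := mmin _ Pi; have im' := mmax _ Pi.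
  have il : (i - m < (m' - m).+1)%N by lia.
  exists (Ordinal il); apply/forallP => k; rewrite (eqP (h k)) /=.
  by apply/eqP; rewrite -subzn //; ring.
have il : (m + i < l)%N by have := ltn_ord i; lia.
exists (Ordinal il); apply/forallP => k; rewrite (eqP (h k)) /=.
by apply/eqP; rewrite PoszD; ring.
Qed.

Lemma dirichlet_pigeonhole (T : finType) (f : T -> nat) (M K : nat) :
  (0 < M)%N -> (0 < K < #|T|)%N -> (forall t, f t < M)%N ->
  exists t t', t != t' /\ (`|(f t)%:Z - (f t')%:Z| * K < M)%N.
Proof.
move=> M0 /andP[K0 KT] fM.
have g_lt t : (f t * K %/ M < K)%N by rewrite ltn_divLR // mulnC ltn_pmul2l.
pose g t := Ordinal (g_lt t).
have /injectivePn[t [t' tt' E]] : ~~ injectiveb g.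
  apply/negP => /injectiveP gi; have := leq_card g gi; rewrite card_ord; lia.
exists t, t'; split=> //.
have := congr1 val E; rewrite /= => {}E.
have h1 := leq_trunc_div (f t * K) M; have h2 := leq_trunc_div (f t' * K) M.
have h3 := ltn_ceil (f t * K) M0; have h4 := ltn_ceil (f t' * K) M0.
rewrite E in h1 h3; move: (_ %/ M)%N h1 h2 h3 h4 => q; nia.
Qed.

(** * Roth's estimate for a fixed coloring *)

Section Roth.
Variables (R : realType) (d N D L : nat).
Hypotheses (N0 : (0 < N)%N) (L0 : (0 < L)%N) (K0 : (0 < (D.+1 ^ d).-1)%N)
  (KL : (8 * L <= (D.+1 ^ d).-1)%N).
Let H := (L * D + N)%N.
Let B := (2 * H).+1.
Let M := (B ^ d)%N.
Local Notation T := (point d N).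
Local Notation dir := {ffun 'I_d -> 'I_(2 * D).+1}.

Let M0 : (0 < M)%N. Proof. by rewrite expn_gt0. Qed.

(** The pigeonhole principle acts on the [(D + 1)^d] vectors with entries in [[0, D]]; the direction
    is the difference of two whose phases are close. [8 L <= (D + 1)^d - 1] and [2 pi <= 8] keep all
    [L] phases within one radian. *)
Lemma exists_good_direction (r : nat) : exists2 b : dir, exists k, dirv b k != 0 &
  L%:R * cos 1 <= \sum_(i < L) cos (angle R M (r%:Z * ((i : nat)%:Z * enc B (dirv b)))).
Proof.
have MZ : M%:Z != 0 by rewrite eqz_nat -lt0n.
pose e (b : {ffun 'I_d -> 'I_D.+1}) := enc B (fun k => (b k : nat)%:Z).
pose f b := `|(r%:Z * e b %% M)%Z|%N.
have fE b : (f b)%:Z = (r%:Z * e b %% M)%Z by rewrite /f gez0_abs // modz_ge0.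
have fM b : (f b < M)%N.
  have := ltz_pmod (r%:Z * e b) (_ : 0 < M%:Z); have := fE b; lia.
have [|b [b' [bb' hf]]] := @dirichlet_pigeonhole _ f M (D.+1 ^ d).-1 M0 _ fM.
  by rewrite K0 /= card_ffun !card_ord prednK // expn_gt0.
pose c : dir := [ffun k => inord (b k + D - b' k)].
have cE k : dirv c k = (b k : nat)%:Z - (b' k : nat)%:Z.
  rewrite /dirv ffunE; have := ltn_ord (b k); have := ltn_ord (b' k) => h1 h2.
  by rewrite inordK; lia.
exists c.
  have [k bk] : exists k, b k != b' k.
    apply/existsP; apply: contraR bb'; rewrite negb_exists => /forallP h.
    by apply/eqP/ffunP => k; have := h k; rewrite negbK => /eqP.
  exists k; rewrite cE subr_eq0; apply: contra bk => /eqP[] h; exact/eqP/val_inj.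
have ecE : enc B (dirv c) = e b - e b'.
  rewrite /e /enc -sumrB; apply: eq_bigr => k _; rewrite cE; ring.
pose t : int := (f b)%:Z - (f b')%:Z.
have tE i : (M %| r%:Z * (i%:Z * enc B (dirv c)) - i%:Z * t)%Z.
  have -> : r%:Z * (i%:Z * enc B (dirv c)) - i%:Z * t =
     i%:Z * ((r%:Z * e b - (f b)%:Z) - (r%:Z * e b' - (f b')%:Z)) by rewrite ecE /t; ring.
  by rewrite dvdz_mull // rpredB // fE -eqz_mod_dvd modz_mod.
have -> : L%:R * cos 1 = \sum_(i < L) (cos 1 : R).
  by rewrite sumr_const card_ord -[RHS]mulr_natl.
apply: ler_sum => i _.
have -> : cos (angle R M (r%:Z * ((i : nat)%:Z * enc B (dirv c)))) = cos (angle R M ((i : nat)%:Z * t)).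
  rewrite cos_angle_mod // [RHS]cos_angle_mod //; congr (cos (angle _ _ _)); apply/eqP.
  by rewrite eqz_mod_dvd.
apply: cos_ge_cos1; rewrite /angle normrM normfV (ger0_norm (ler0n _ _)).
have MR : 0 < (M%:R : R) by rewrite ltr0n.
rewrite ler_pdivrMr // mul1r !normrM (ger0_norm (ler0n _ 2)) (ger0_norm (pi_ge0 R)).
have piR : pi <= 4 :> R by have := pihalf_lt2 R; lra.
have h : (8 * i * `|t| <= M)%N.
  have := ltn_ord i => iL; apply: leq_trans (ltnW hf); rewrite mulnC leq_mul2l; apply/orP; right.
  apply: leq_trans KL; lia.
rewrite -intr_norm normrM [`|(i : nat)%:Z|]ger0_norm // -abszE intrM -!pmulrn.
apply: (@le_trans _ _ ((8 * i * `|t|)%N%:R)); last by rewrite ler_nat.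
rewrite !natrM -[leRHS]mulrA ler_wpM2r ?mulr_ge0 //.
by lra.
Qed.

Variable chi : {ffun T -> bool}.
Let f (p : T) : R := (sgn (chi p))%:~R.

Lemma sgn_sq p : f p ^+ 2 = 1.
Proof. by rewrite /f /sgn; case: (chi p); rewrite ?expr1n // mulrN1z sqrrN expr1n. Qed.

Lemma coord_dist (p p' : T) k : (`|(coord p k - coord p' k)%R| < N)%N.
Proof. by have := coord_bound p k; have := coord_bound p' k; lia. Qed.

Lemma enc_dvd_eq0 (w : 'I_d -> int) : (forall k, `|w k| <= H)%N -> (M %| enc B w)%Z -> forall k, w k = 0.
Proof. by move=> wH; rewrite dvdzE; apply: enc_eq0. Qed.

Lemma enc_coord_inj (p p' : T) : (M %| enc B (coord p) - enc B (coord p'))%Z -> p = p'.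
Proof.
move=> h; apply: coord_inj => k; apply/eqP; rewrite -subr_eq0; apply/eqP.
apply: (@enc_dvd_eq0 (fun k => coord p k - coord p' k)).
  by move=> j; rewrite /H; apply: leq_trans (ltnW (coord_dist p p' j)) _; rewrite leq_addl.
move: h; rewrite /enc -sumrB.
by under eq_bigr => j _ do rewrite -mulrBl.
Qed.

(** [enc] separates the points modulo [M], so by [parseval] each occupied residue contributes a
    single square [f p ^+ 2 = 1]. *)
Lemma sum_energy_f : \sum_(r < M) energy M f (fun p => enc B (coord p)) r = M%:R * (N ^ d)%N%:R.
Proof.
rewrite parseval //; congr (_ * _).
have sq (y : 'I_M) : (\sum_(p | (M %| enc B (coord p) - (y : nat)%:Z)%Z) f p) ^+ 2 =
    \sum_(p : T | (M %| enc B (coord p) - (y : nat)%:Z)%Z) 1.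
  have [p hp|h0] := pickP (fun p : T => (M %| enc B (coord p) - (y : nat)%:Z)%Z); last first.
    by rewrite !(eq_bigl _ _ h0) !big_pred0_eq expr0n.
  have one p' : (M %| enc B (coord p') - (y : nat)%:Z)%Z = (p' == p).
    apply/idP/eqP => [hp'|->//]; apply: enc_coord_inj.
    have -> : enc B (coord p') - enc B (coord p) =
       (enc B (coord p') - (y : nat)%:Z) - (enc B (coord p) - (y : nat)%:Z) by ring.
    exact: rpredB.
  by rewrite !(big_pred1 p) // sgn_sq.
rewrite (eq_bigr _ (fun y _ => sq y)) (exchange_big_dep xpredT) //=.
have yone (p : T) : \sum_(y < M | (M %| enc B (coord p) - (y : nat)%:Z)%Z) (1 : R) = 1.
  have MZ : M%:Z != 0 by rewrite eqz_nat -lt0n.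
  have h := modz_ge0 (enc B (coord p)) MZ.
  have yE : (`|(enc B (coord p) %% M)%Z| < M)%N.
    have := ltz_pmod (enc B (coord p)) (_ : 0 < M%:Z); move: h; lia.
  rewrite (big_pred1 (Ordinal yE)) // => y /=.
  rewrite -eqz_mod_dvd.
  have -> : ((y : nat)%:Z %% M)%Z = (y : nat)%:Z by rewrite modz_small //; have := ltn_ord y; lia.
  by apply/eqP/eqP => [E|->/=]; [apply/val_inj => /=; rewrite E | rewrite gez0_abs].
rewrite (eq_bigr _ (fun p _ => yone p)) sumr_const card_ffun !card_ord.
by [].
Qed.

Definition pair_pos (b : dir) (j : T * 'I_L) : int :=
  enc B (coord j.1) + (j.2 : nat)%:Z * enc B (dirv b).

(** The pairs realize the convolution of [f] with the progression of step [b], whose Fourier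
    coefficient is the product of the two. *)
Lemma energy_pair (b : dir) (r : nat) :
  energy M (fun j : T * 'I_L => f j.1) (pair_pos b) r =
  energy M f (fun p => enc B (coord p)) r *
   ((\sum_(i < L) cos (angle R M (r%:Z * ((i : nat)%:Z * enc B (dirv b))))) ^+ 2 +
    (\sum_(i < L) sin (angle R M (r%:Z * ((i : nat)%:Z * enc B (dirv b))))) ^+ 2).
Proof.
rewrite /energy.
set C1 := \sum_p f p * cos _; set S1 := \sum_p f p * sin _.
set C2 := \sum_(i < L) cos _; set S2 := \sum_(i < L) sin _.
have -> : \sum_(j : T * 'I_L) f j.1 * cos (angle R M (r%:Z * pair_pos b j)) = C1 * C2 - S1 * S2.
  rewrite /C1 /S1 !mulr_suml -sumrB.
  rewrite -(pair_bigA _ (fun (p : T) (i : 'I_L) => f p * cos (angle R M (r%:Z * pair_pos b (p, i))))) /=.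
  apply: eq_bigr => p _; rewrite /C2 /S2 [X in _ = X - _]mulr_sumr [X in _ = _ - X]mulr_sumr -sumrB.
  apply: eq_bigr => i _.
  by rewrite /pair_pos /= mulrDr angleD cosD; ring.
have -> : \sum_(j : T * 'I_L) f j.1 * sin (angle R M (r%:Z * pair_pos b j)) = S1 * C2 + C1 * S2.
  rewrite /C1 /S1 !mulr_suml -big_split /=.
  rewrite -(pair_bigA _ (fun (p : T) (i : 'I_L) => f p * sin (angle R M (r%:Z * pair_pos b (p, i))))) /=.
  apply: eq_bigr => p _; rewrite /C2 /S2 [X in _ = X + _]mulr_sumr [X in _ = _ + X]mulr_sumr -big_split /=.
  apply: eq_bigr => i _.
  by rewrite /pair_pos /= mulrDr angleD sinD; ring.
ring.
Qed.

Variable Delta : R.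
Hypothesis D0 : 0 <= Delta.
Hypothesis hDelta : forall A, is_AP A -> `|chi_sum chi A|%:~R <= Delta.

(** If [(p0, i0)] lies in the residue class, its pairs are exactly those with [p = p0 + i0 b - i b]:
    no wrap-around occurs. The points therefore run through a progression with direction [-b], cut
    to the box. *)
Lemma pair_sum_le (b : dir) (y : int) : (exists k, dirv b k != 0) ->
  (\sum_(j | (M %| pair_pos b j - y)%Z) f j.1) ^+ 2 <= Delta ^+ 2.
Proof.
move=> b0.
have [[p0 i0] h0|h0] := pickP (fun j => (M %| pair_pos b j - y)%Z); last first.
  by rewrite (eq_bigl _ _ h0) big_pred0_eq expr0n /= exprn_ge0.
pose a k := coord p0 k + (i0 : nat)%:Z * dirv b k.
pose nb k := - dirv b k.
have nb0 : exists k, nb k != 0 by case: b0 => k bk; exists k; rewrite oppr_eq0.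
have encE (p : T) (i : 'I_L) : pair_pos b (p, i) - pair_pos b (p0, i0) =
    enc B (fun k => (coord p k - coord p0 k) + ((i : nat)%:Z - (i0 : nat)%:Z) * dirv b k).
  rewrite enc_lin /pair_pos /=.
  have -> : enc B (fun k => coord p k - coord p0 k) = enc B (coord p) - enc B (coord p0).
    by rewrite /enc -sumrB; apply: eq_bigr => k _; ring.
  ring.
have iff (p : T) (i : 'I_L) : (M %| pair_pos b (p, i) - y)%Z =
    [forall k, coord p k == a k + (i : nat)%:Z * nb k].
  apply/idP/forallP => h.
    have hz : (M %| pair_pos b (p, i) - pair_pos b (p0, i0))%Z.
      have -> : pair_pos b (p, i) - pair_pos b (p0, i0) =
        (pair_pos b (p, i) - y) - (pair_pos b (p0, i0) - y) by ring.
      exact: rpredB.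
    rewrite encE in hz => k.
    have := enc_dvd_eq0 _ hz => /(_ _ k) w0.
    apply/eqP/subr0_eq; rewrite -[RHS]w0 /a /nb; first by ring.
    move=> j; rewrite /H.
    have h1 := coord_dist p p0 j.
    have h2 : (`|(((i : nat)%:Z - (i0 : nat)%:Z) * dirv b j)%R| <= L * D)%N.
      rewrite abszM; apply: leq_mul.
        by have := ltn_ord i; have := ltn_ord i0; lia.
      by rewrite /dirv; have := ltn_ord (b j); lia.
    by move: h1 h2; move: (coord p j - coord p0 j) (_ * dirv b j) => x1 x2; lia.
  have E0 : pair_pos b (p, i) - pair_pos b (p0, i0) = 0.
    rewrite encE /enc big1 // => k _.
    by rewrite (eqP (h k)) /a /nb; ring.
  by rewrite (subr0_eq E0).
pose A := ap_set N a nb L.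
have sumA : \sum_(j | (M %| pair_pos b j - y)%Z) f j.1 = \sum_(p in A) f p.
  rewrite big_mkcond [RHS]big_mkcond /=.
  rewrite -(pair_bigA _ (fun (p : T) (i : 'I_L) => if (M %| pair_pos b (p, i) - y)%Z then f p else 0)) /=.
  apply: eq_bigr => p _; rewrite inE.
  case: existsP => [[i hi]|hno].
    rewrite (bigD1 i) //= iff hi big1 ?addr0 // => i' ii'.
    rewrite iff; case: forallP => // hi'; case/eqP: ii'.
    have [k bk] := nb0; have := eqP (hi' k); rewrite (eqP (forallP hi k)) => /addrI /(mulIf bk) [] E.
    exact/val_inj.
  rewrite big1 // => i _; rewrite iff; case: ifP => // hi.
  by case: hno; exists i.
rewrite sumA.
have [A0|AP] := ap_set_AP N a L nb0.
  by rewrite /A A0 big_set0 expr0n /= exprn_ge0.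
have -> : \sum_(p in A) f p = (chi_sum chi A)%:~R by rewrite /chi_sum rmorph_sum.
rewrite -real_normK ?num_real // lerXn2r ?nnegrE // -intr_norm.
exact: hDelta AP.
Qed.

(** The good direction depends on the frequency; summing over all nonzero directions includes each
    frequency's own one, and the other terms are nonnegative. *)
Lemma roth_estimate : (L%:R * cos 1) ^+ 2 * (N ^ d)%N%:R <= ((2 * D).+1 ^ d * M)%N%:R * Delta ^+ 2.
Proof.
have MR : 0 < (M%:R : R) by rewrite ltr0n.
pose G (b : dir) := \sum_(r < M) energy M (fun j : T * 'I_L => f j.1) (pair_pos b) r.
have Gle b : (exists k, dirv b k != 0) -> G b <= M%:R * (M%:R * Delta ^+ 2).
  move=> b0; rewrite /G parseval // ler_pM2l //.
  apply: le_trans (ler_sum _ (fun y _ => pair_sum_le _ b0)) _.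
  by rewrite sumr_const card_ord -[leLHS]mulr_natl.
pose nz (b : dir) := [exists k, dirv b k != 0].
have upper : \sum_(b | nz b) G b <= ((2 * D).+1 ^ d)%N%:R * (M%:R * (M%:R * Delta ^+ 2)).
  apply: (@le_trans _ _ (\sum_(b | nz b) M%:R * (M%:R * Delta ^+ 2))).
    by apply: ler_sum => b /existsP; apply: Gle.
  rewrite sumr_const -[leLHS]mulr_natl ler_wpM2r ?mulr_ge0 ?exprn_ge0 // ler_nat.
  by apply: leq_trans (max_card _) _; rewrite card_ffun !card_ord.
have lower : M%:R * (N ^ d)%N%:R * (L%:R * cos 1) ^+ 2 <= \sum_(b | nz b) G b.
  rewrite -sum_energy_f mulr_suml exchange_big /=; apply: ler_sum => r _.
  have [b b0 hb] := exists_good_direction r.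
  have e0 : 0 <= energy M f (fun p => enc B (coord p)) r.
    by rewrite addr_ge0 ?sqr_ge0.
  rewrite (bigD1 b) /=; last by apply/existsP.
  rewrite energy_pair; apply: (@le_trans _ _ (energy M f (fun p => enc B (coord p)) r *
   ((\sum_(i < L) cos (angle R M ((r : nat)%:Z * ((i : nat)%:Z * enc B (dirv b))))) ^+ 2 +
    (\sum_(i < L) sin (angle R M ((r : nat)%:Z * ((i : nat)%:Z * enc B (dirv b))))) ^+ 2))); last first.
    by rewrite lerDl sumr_ge0 // => b' _; rewrite addr_ge0 ?sqr_ge0.
  rewrite ler_wpM2l //.
  apply: le_trans (_ : _ <= (\sum_(i < L) cos (angle R M ((r : nat)%:Z * ((i : nat)%:Z * enc B (dirv b))))) ^+ 2) _.
    have p0 : 0 <= L%:R * cos 1 :> R by rewrite mulr_ge0 // ltW // cos1_gt0.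
    by rewrite lerXn2r ?nnegrE // (le_trans p0).
  by rewrite lerDl sqr_ge0.
have h := le_trans lower upper; rewrite -(ler_pM2l MR) natrM; move: h.
move: ((L%:R * cos 1) ^+ 2 : R) (Delta ^+ 2) ((N ^ d)%N%:R : R) (((2 * D).+1 ^ d)%N%:R : R).
move=> a e s t h; apply: le_trans (le_trans _ h) _; rewrite le_eqVlt; apply/orP; left; apply/eqP; ring.
Qed.

End Roth.

(** * From Roth's estimate to the power of [N] *)

Section Lower.
Variables (R : realType) (d : nat).
Hypothesis d0 : (0 < d)%N.

Definition disc_of N (chi : {ffun point d N -> bool}) : nat :=
  (\max_(A : {set point d N} | `[< is_AP A >]) `|chi_sum chi A|)%N.

Lemma disc_of_ge N (chi : {ffun point d N -> bool}) A : is_AP A ->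
  `|chi_sum chi A|%:~R <= (disc_of chi)%:R :> R.
Proof.
move=> APA; rewrite -abszE -pmulrn ler_nat.
by apply: (@leq_bigmax_cond _ _ (fun A => `|chi_sum chi A|%N)); apply/asboolP.
Qed.

Lemma disc_of_le N (chi : {ffun point d N -> bool}) : (disc_of chi <= #|point d N|)%N.
Proof.
apply/bigmax_leqP => A _; apply: leq_trans (max_card A).
rewrite -lez_nat abszE; apply: le_trans (ler_norm_sum _ _ _) _.
apply: (@le_trans _ _ (\sum_(x in A) (1 : int))).
  by apply: ler_sum => x _; rewrite /sgn; case: (chi x).
by rewrite sumr_const natz.
Qed.

(** The default value of the minimum in [disc_AP] exceeds every possible discrepancy, hence also
    satisfies the bound. *)
Lemma le_disc_AP N (c : R) : (forall chi : {ffun point d N -> bool}, c <= (disc_of chi)%:R) ->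
  c <= (disc_AP d N)%:R.
Proof.
move=> H; rewrite /disc_AP; elim/big_ind: _ => [|x y hx hy|chi _].
- apply: le_trans (H [ffun=> false]) _; rewrite ler_nat.
  exact: leq_trans (disc_of_le _) _.
- by rewrite /minn; case: ifP.
- exact: H.
Qed.

Lemma disc_of_ge1 N (chi : {ffun point d N -> bool}) : (0 < N)%N -> 1 <= (disc_of chi)%:R :> R.
Proof.
move=> N0; pose p : point d N := [ffun=> Ordinal N0].
have pA : ap_set N (coord p) (fun=> 1) 1 = [set p].
  apply/setP => x; rewrite !inE; apply/existsP/eqP => [[i /forallP h]|->].
    by apply: coord_inj => k; rewrite (eqP (h k)) (ord1 i) mul0r addr0.
  by exists ord0; apply/forallP => k; rewrite mul0r addr0.
have AP1 : is_AP [set p].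
  exists (coord p), (fun=> 1), 1%N; split=> //.
    by exists (Ordinal d0).
  by move=> i k; rewrite ltnS leqn0 => /eqP ->; rewrite mul0r addr0; apply: coord_bound.
have := disc_of_ge chi AP1; rewrite /chi_sum big_set1 /sgn.
by case: (chi p).
Qed.

Lemma disc_AP_lower : exists2 c : R, 0 < c &
  forall N (y : R), (0 < N)%N -> 0 < y -> y ^+ (2 * d.+1) = N%:R ^+ d ->
  c * y <= (disc_AP d N)%:R.
Proof.
have g0 := cos1_gt0 R; have g1 : cos 1 <= 1 :> R by apply: cos_le1.
(* 16 is the loss in [D^d <= 16 L]; [30 = 15 * 2], with 15 from [2 D + 1 <= 3 D] and base at most
   [5 N], and 2 from [D + 1 <= 2 D]. *)
pose c : R := cos 1 / (16 * 30 ^+ d).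
have q0 : 0 < 16 * 30 ^+ d :> R by rewrite mulr_gt0 ?exprn_gt0.
have c0 : 0 < c by rewrite divr_gt0.
exists c => // N y N0 y0 yE; apply: le_disc_AP => chi.
set Delta : R := (disc_of chi)%:R.
have D1 : 1 <= Delta by apply: disc_of_ge1.
have exD : exists D, (D ^ d.+1 <= N)%N by exists 0%N; rewrite exp0n.
have bD D : (D ^ d.+1 <= N)%N -> (D <= N)%N.
  by apply: leq_trans; case: D => // D; rewrite -{1}(expn1 D.+1) leq_pexp2l.
case: (ex_maxnP exD bD) => D hD Dmax.
have D1' : (0 < D)%N by apply: Dmax; rewrite exp1n.
have ND : (N < D.+1 ^ d.+1)%N by rewrite ltnNge; apply/negP => /Dmax; rewrite ltnn.
have y2 : y ^+ 2 <= 2 ^+ d * D%:R ^+ d.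
  rewrite -(ler_pXn2r (isT : 0 < d.+1)%N) ?nnegrE ?exprn_ge0 ?(ltW y0) //; last first.
    by rewrite mulr_ge0 ?exprn_ge0.
  rewrite -exprM yE -exprMn -natrM -!natrX ler_nat.
  have -> : (((2 * D) ^ d) ^ d.+1 = ((2 * D) ^ d.+1) ^ d)%N by rewrite -!expnM [(d * d.+1)%N]mulnC.
  rewrite leq_exp2r //; apply: leq_trans (ltnW ND) _.
  by rewrite leq_exp2r //; lia.
rewrite -(ler_pXn2r (isT : 0 < 2)%N) ?nnegrE ?(mulr_ge0 (ltW c0) (ltW y0)) ?(le_trans ler01 D1) //.
rewrite exprMn.
(* If [D^d < 8] then [L] would be 0; here [y] is bounded and a one-point progression already gives
   discrepancy 1. *)
case: (ltnP (D ^ d) 8) => hD8.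
  apply: (@le_trans _ _ 1); last by rewrite exprn_ege1.
  have y16 : y ^+ 2 <= 16 * 30 ^+ d.
    apply: le_trans y2 _; rewrite mulrC ler_pM ?exprn_ge0 //.
      by rewrite -natrX ler_nat ltnW // (ltn_trans hD8).
    by rewrite lerXn2r ?nnegrE // ler_nat.
  apply: (@le_trans _ _ (c ^+ 2 * (16 * 30 ^+ d))); first by rewrite ler_wpM2l ?sqr_ge0.
  rewrite expr2 -mulrA {2}/c divfK ?gt_eqF // /c mulrAC ler_pdivrMr // mul1r.
  apply: (@le_trans _ _ 1); first by rewrite mulr_ile1 ?(ltW g0).
  by rewrite mulr_ege1 ?exprn_ege1 ?ler1n.
pose L := (D ^ d %/ 8)%N.
have L0 : (0 < L)%N by rewrite divn_gt0.
have L8 : (8 * L <= D ^ d)%N by rewrite mulnC leq_trunc_div.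
have L16 : (D ^ d <= 16 * L)%N by have := ltn_ceil (D ^ d) (isT : 0 < 8)%N; rewrite -/L; lia.
have KD : (D ^ d <= (D.+1 ^ d).-1)%N.
  by rewrite -ltnS prednK ?expn_gt0 // ltn_exp2r.
have KL : (8 * L <= (D.+1 ^ d).-1)%N by apply: leq_trans L8 KD.
have K0 : (0 < (D.+1 ^ d).-1)%N by apply: leq_trans KL; rewrite muln_gt0.
(* The progressions fit the scale of the box, so the modulus is only a constant factor larger than
   [N^d]. *)
have LDN : (L * D <= N)%N.
  apply: leq_trans hD; rewrite expnSr leq_mul2r; apply/orP; right.
  by apply: leq_trans L8; rewrite leq_pmull.
have Dl0 : 0 <= Delta by apply: le_trans D1.
have := roth_estimate N0 L0 K0 KL Dl0 (fun A => @disc_of_ge N chi A).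
set H := (2 * D).+1 => est.
have ub : ((H ^ d * (2 * (L * D + N)).+1 ^ d)%N%:R : R) <= (15 ^+ d * D%:R ^+ d) * (N ^ d)%N%:R.
  rewrite -natrX -natrX -!natrM ler_nat -!expnMn leq_exp2r //.
  have h1 : (H <= 3 * D)%N by rewrite /H; move: D1'; clear; lia.
  have h2 : ((2 * (L * D + N)).+1 <= 5 * N)%N.
    by move: LDN N0; move: (L * D)%N; clear => x; lia.
  apply: leq_trans (leq_mul h1 h2) _; apply: eq_leq.
  by rewrite mulnACA mulnA.
have Nd0 : 0 < (N ^ d)%N%:R :> R by rewrite ltr0n expn_gt0 N0.
have est2 : (L%:R * cos 1) ^+ 2 <= 15 ^+ d * D%:R ^+ d * Delta ^+ 2.
  rewrite -(ler_pM2r Nd0); apply: le_trans est _.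
  rewrite [leRHS]mulrAC ler_wpM2r ?sqr_ge0 //.
have Dd0 : 0 < D%:R ^+ d :> R by rewrite exprn_gt0 // ltr0n.
have est3 : cos 1 ^+ 2 * D%:R ^+ d <= 256 * 15 ^+ d * Delta ^+ 2.
  rewrite -(ler_pM2r Dd0).
  apply: (@le_trans _ _ (256 * (L%:R * cos 1) ^+ 2)).
    have h : D%:R ^+ d <= 16 * L%:R :> R by rewrite -natrX -natrM ler_nat.
    have h2 : D%:R ^+ d * D%:R ^+ d <= (16 * L%:R) * (16 * L%:R) :> R by apply: ler_pM => //; apply: ltW.
    rewrite -mulrA exprMn.
    apply: le_trans (ler_wpM2l (sqr_ge0 _) h2) _.
    by rewrite le_eqVlt; apply/orP; left; apply/eqP; ring.
  apply: le_trans (ler_wpM2l (ler0n _ 256) est2) _.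
  by rewrite le_eqVlt; apply/orP; left; apply/eqP; ring.
apply: (@le_trans _ _ (c ^+ 2 * (2 ^+ d * D%:R ^+ d))); first by rewrite ler_wpM2l ?sqr_ge0.
have -> : c ^+ 2 * (2 ^+ d * D%:R ^+ d) = (cos 1 ^+ 2 * D%:R ^+ d) * (2 ^+ d / (16 * 30 ^+ d) ^+ 2).
  rewrite /c; have := lt0r_neq0 q0; move: (16 * 30 ^+ d) => x x0.
  by field; exact: x0.
have r0 : 0 <= 2 ^+ d / (16 * 30 ^+ d) ^+ 2 :> R by rewrite divr_ge0 ?exprn_ge0 // ltW.
apply: le_trans (ler_wpM2r r0 est3) _.
have -> : 256 * 15 ^+ d * Delta ^+ 2 * (2 ^+ d / (16 * 30 ^+ d) ^+ 2) = Delta ^+ 2 / 30 ^+ d.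
  have -> : (30 : R) ^+ d = 15 ^+ d * 2 ^+ d by rewrite -exprMn; congr (_ ^+ _); ring.
  have h1 : (15 : R) ^+ d != 0 by rewrite expf_neq0 // pnatr_eq0.
  have h2 : (2 : R) ^+ d != 0 by rewrite expf_neq0 // pnatr_eq0.
  by field; rewrite h1 h2.
by rewrite ler_pdivrMr ?exprn_gt0 // ler_peMr ?sqr_ge0 // exprn_ege1 // ler1n.
Qed.

End Lower.

Import Rstruct.

(** Links the real power of the statement to its algebraic characterization, the only property of
    [y] used by the two bounds besides positivity. *)
Lemma Rpower_root (d N : nat) : (0 < N)%N ->
  let y := Rpower (INR N) (Rdiv (INR d) (INR (Nat.add (Nat.mul 2 d) 2))) in
  0 < y /\ y ^+ (2 * d.+1) = N%:R ^+ d.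
Proof.
move=> N0 y.
have N0' : Rlt 0 (INR N) by apply: lt_0_INR; apply/ssrnat.ltP.
have y0 : Rlt 0 y by apply: exp_pos.
split; first exact/RltP.
have E : (2 * d.+1 = (Nat.add (Nat.mul 2 d) 2))%N by rewrite plusE multE mulnS addnC.
rewrite E -RpowE -(Rpower_pow _ _ y0) Rpower_mult.
have n0 : INR (Nat.add (Nat.mul 2 d) 2) <> 0 by apply: not_0_INR; rewrite -E; lia.
have -> : Rmult (Rdiv (INR d) (INR (Nat.add (Nat.mul 2 d) 2))) (INR (Nat.add (Nat.mul 2 d) 2)) = INR d.
  by rewrite /Rdiv Rmult_assoc Rinv_l // Rmult_1_r.
by rewrite (Rpower_pow _ _ N0') RpowE INRE.
Qed.

Lemma disc_AP_Theta (d : nat) : Peano.lt 0 d ->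
  exists c C : Rdefinitions.R, Rlt (IZR 0) c /\ Rlt (IZR 0) C /\
    forall N : nat, Peano.lt 0 N ->
      Rle (Rmult c (Rpower (INR N) (Rdiv (INR d) (INR (Nat.add (Nat.mul 2 d) 2))))) (INR (disc_AP d N)) /\
      Rle (INR (disc_AP d N)) (Rmult C (Rpower (INR N) (Rdiv (INR d) (INR (Nat.add (Nat.mul 2 d) 2))))).
Proof.
move=> /ssrnat.ltP d0.
have [c c0 hc] := disc_AP_lower Rdefinitions.R d0.
have [C C0 hC] := disc_AP_upper Rdefinitions.R d0.
exists c, C; split; first exact/RltP.
split; first exact/RltP.
move=> N /ssrnat.ltP N0; have [y0 yE] := Rpower_root d N0.
by rewrite (INRE (disc_AP d N)); split; apply/RleP; [apply: hc | apply: hC].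
Qed.

End Discrepancy.

Theorem theorem1p1 :
  forall d : nat, (0 < d)%nat ->
  exists c C : R, 0 < c /\ 0 < C /\
    forall N : nat, (0 < N)%nat ->
      c * Rpower (INR N) (INR d / INR (2 * d + 2)) <= INR (disc_AP d N) /\
      INR (disc_AP d N) <= C * Rpower (INR N) (INR d / INR (2 * d + 2)).
Proof.
exact Discrepancy.disc_AP_Theta.
Qed.
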